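(* Let $\Gamma$ be a connected negative definite plumbing graph of a rational homology sphere $\Sigma=\partial\widetilde X(\Gamma)$, $v$ a vertex of $\Gamma$, and $\Gamma_i$ the connected components of $\Gamma\setminus v$. Let $\sigma\in\mathrm{Spin}^c(\Sigma)$, let $\widetilde\sigma=l'*\widetilde{\sigma_{\mathrm{can}}}$ ($l'\in L'$) be an extension of $\sigma$ to $\widetilde X(\Gamma)$ such that $r_v:=(l',E_v^* )$ satisfies $-1<r_v\le0$, and let $\widetilde\sigma_i$, $\sigma_i$ be the restrictions of $\widetilde\sigma$ to $\widetilde X(\Gamma_i)$ and $\Sigma_i=\partial\widetilde X(\Gamma_i)$. Then $$c_1(\widetilde\sigma)^2+|\mathcal V(\Gamma)|-\sum_i\bigl(c_1(\widetilde\sigma_i)^2+|\mathcal V(\Gamma_i)|\bigr)=1-\frac{(\alpha_v+d+2dr_v)^2}{d\,a_{vv}},$$ $$\mathrm{sw}_\sigma(\Sigma)-\sum_i\mathrm{sw}_{\sigma_i}(\Sigma_i)=-\mathcal H^{\mathrm{pol}}_{\sigma,v}(1)-\frac18+\frac{(\alpha_v+d+2dr_v)^2}{8d\,a_{vv}},$$ $$24\frac{\lambda(\Sigma)}{|H|}-\sum_i24\frac{\lambda(\Sigma_i)}{|H_i|}=-3+\frac{d^2-\beta_v}{d\,a_{vv}},$$ $$\mathcal T_\sigma(\Sigma)-\sum_i\mathcal T_{\sigma_i}(\Sigma_i)=\mathcal H^{\mathrm{pol}}_{\sigma,v}(1)+\frac{d^2-\beta_v}{24d\,a_{vv}}-\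frac{(\alpha_v+d+2dr_v)^2}{8d\,a_{vv}}.$$
   Context: **Plumbing data.** $\Gamma$ is a finite connected graph with vertex set $\mathcal V(\Gamma)$, each vertex $w$ decorated by an integer $b_w$. $\widetilde X(\Gamma)$ is the oriented $4$-manifold with boundary obtained by plumbing: a tubular neighbourhood of oriented $2$-spheres $E_w$, where $b_w$ is the Euler number of the normal bundle of $E_w$, the spheres of two adjacent vertices meet transversally at one point, and there are no other intersections. $\Sigma=\partial\widetilde X(\Gamma)$ is a rational homology sphere (equivalently, $\Gamma$ is a tree). $L:=H_2(\widetilde X(\Gamma);\mathbb Z)$ is free with basis $E_w$; the intersection form is $(E_w,E_w)=b_w$, and for $u\neq w$, $(E_u,E_w)=1$ if $u,w$ are adjacent and $0$ otherwise; its matrix $I$ is negative definite. $L':=H^2(\widetilde X(\Gamma);\mathbb Z)$ is the dual lattice, with basis $E^*_w$, $(E^*_w,E_u)=\delta_{wu}$ (Kronecker delta); $L\subset L'\subset L\otimes\mathbb Q$, the form extends to $L'$; $x^2:=(x,x)$. $H:=L'/L\cong H_1(\Sigma;\mathbb Z)$, $[l']$ is the class of $l'$, $\widehat H:=\mathrm{Hom}(H,\mathbb C^* )$, $d:=\det(-I)=|H|$. $a_{uw}:=-|H|(E^*_u,E^*_w)$ (positive integers). $\delta_w$ is the degree of $w$ in $\Gamma$. Moreover $$\alpha_u:=\sum_{w\in\mathcal V(\Gamma)}(\delta_w-2)a_{uw},\qquad\beta_u:=\sum_{w\in\mathcal V(\Gamma)}(\delta_w-2)a_{uw}^2 .$$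 Objects with index $i$ (e.g. $H_i$) refer to the graph $\Gamma_i$. **$\mathrm{Spin}^c$ structures.** Those of $\widetilde X(\Gamma)$ form an $L'$-torsor (action $*$), with $c_1(l'*\widetilde\sigma)=c_1(\widetilde\sigma)+2l'$; $\widetilde{\sigma_{\mathrm{can}}}$ is characterized by $(c_1(\widetilde{\sigma_{\mathrm{can}}}),E_w)=b_w+2$ for all $w$. Those of $\Sigma$ form an $H$-torsor; restriction is compatible with $L'\to H$; $\sigma_{\mathrm{can}}$ is the restriction of $\widetilde{\sigma_{\mathrm{can}}}$; $h_\sigma\in H$ is defined by $h_\sigma*\sigma_{\mathrm{can}}=\sigma$. The restriction of $l'*\widetilde{\sigma_{\mathrm{can}}}$ to $\widetilde X(\Gamma_i)\subset\widetilde X(\Gamma)$ is $R_i(l')*\widetilde{\sigma_{\mathrm{can},i}}$, where $R_i:L'\to L_i'$, $R_i(E_w^* )=E^*_{w,i}$ if $w\in\mathcal V(\Gamma_i)$ and $0$ otherwise. **Rational functions.** For $\rho\in\widehat H$, $u\in\mathcal V(\Gamma)$, $$P_{\rho,u}(t):=\prod_{w\in\mathcal V(\Gamma)}\bigl(1-\rho([E^*_w])t^{a_{wu}}\bigr)^{\delta_w-2},\qquad\mathcal H_{\sigma,u}(t):=\frac1{|H|}\sum_{\rho\in\widehat H}\rho(h_\sigma)^{-1}P_{\rho,u}(t).$$ $\mathcal H^{\mathrm{pol}}_{\sigma,v}$ is the unique polynomial such that $\mathcal H_{\sigma,v}-\mathcal H^{\mathrm{pol}}_{\sigma,v}$ is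 $0$ or has negative degree (degree of numerator less than degree of denominator). **Invariants.** $\lambda$ is the Casson–Walker invariant in Lescop's normalization, given for plumbed manifolds by $-24\lambda(\Sigma)/|H|=\sum_wb_w+3|\mathcal V(\Gamma)|+\frac1{|H|}\sum_w(\delta_w-2)a_{ww}$. $\mathcal T_\sigma(\Sigma)$ is the Reidemeister–Turaev torsion (coefficient at $0\in H$), given by $\mathcal T_\sigma(\Sigma)=\frac1{|H|}\sum_{\rho\in\widehat H\setminus\{1\}}\rho(h_\sigma)^{-1}\lim_{t\to1}P_{\rho,u_\rho}(t)$, where $u_\rho$ is any vertex such that $\rho([E^*_{u_\rho}])\neq1$ or $\rho([E^*_u])\neq1$ for some vertex $u$ adjacent to $u_\rho$. The Seiberg–Witten invariant is, with the paper's sign convention, $\mathrm{sw}_\sigma(\Sigma)=\lambda(\Sigma)/|H|-\mathcal T_\sigma(\Sigma)$. *)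

(* Defs.v *)
From HB Require Import structures.
From mathcomp Require Import all_boot all_order all_algebra.
From mathcomp Require Import generic_quotient ring_quotient.
From mathcomp Require Import complex.
From mathcomp Require Import all_classical all_reals all_analysis.

Set Implicit Arguments.
Unset Strict Implicit.
Unset Printing Implicit Defensive.

Import Order.TTheory GRing.Theory Num.Theory.
Import numFieldNormedType.Exports.

Local Open Scope quotient_scope.
Local Open Scope classical_set_scope.
Local Open Scope ring_scope.

(* Simple graphs: adjacent spheres meet transversally in exactly one point.
   All spheres have genus 0. *)
Record plumbing := Plumbing {
  vert :> finType;
  adj : rel vert;
  euler : vert -> int;
  adj_sym : symmetric adj;
  adj_irr : irreflexive adj }.

Section Graph.
Variable G : plumbing.

Definition connected_graph : Prop := forall u w : G, connect (@adj G) u w.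

(* Given negative definiteness, the plumbed 3-manifold of a connected graph of
   2-spheres is a rational homology sphere iff the graph is acyclic. *)
Definition acyclic_graph : Prop :=
  forall c : seq G, (2 < size c)%N -> ~~ ucycleb (@adj G) c.

Definition deg (w : G) : nat := #|[set u | adj w u]%SET|.

Definition induced_adj (A : {set G}) : rel {x : G | x \in A} :=
  fun x y => adj (val x) (val y).

Lemma induced_adj_sym A : symmetric (@induced_adj A).
Proof. by move=> x y; rewrite /induced_adj adj_sym. Qed.

Lemma induced_adj_irr A : irreflexive (@induced_adj A).
Proof. by move=> x; rewrite /induced_adj adj_irr. Qed.

Definition induced_graph (A : {set G}) : plumbing :=
  Plumbing (fun x : {x : G | x \in A} => euler (val x))
    (@induced_adj_sym A) (@induced_adj_irr A).

Definition del_adj (v : G) : rel G :=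
  fun x y => [&& x != v, y != v & adj x y].

Definition components (v : G) : {set {set G}} :=
  [set [set y | connect (del_adj v) x y] | x in [set~ v]]%SET.

Definition inter (u w : G) : int :=
  if u == w then euler u else (adj u w)%:Z.

(* [L], in the basis [E_w]. *)
Definition lat := {ffun G -> int}.

Definition formL (x y : lat) : int := \sum_u \sum_w x u * y w * inter u w.

Definition negative_definite : Prop :=
  forall x : lat, x != 0 -> formL x x < 0.

Definition inter_mx : 'M[int]_(#|G|) :=
  \matrix_(i, j) inter (enum_val i) (enum_val j).

Definition dG : int := \det (- inter_mx).

(* [L' = Hom(L, Z)], in the basis [E^*_w] dual to [E_w]: the coordinate of
   [l'] at [w] is the pairing of [l'] with [E_w]. *)
Definition dual_lat := {ffun G -> int}.

Definition Estar (w : G) : dual_lat := [ffun u => (u == w)%:Z].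

Definition dual_of (x : lat) : dual_lat := [ffun w => \sum_u x u * inter u w].

(* The rational extension of the form to [L']: in the bases [E^*_w] its matrix
   is the inverse of the intersection matrix. *)
Definition formQ (x y : dual_lat) : rat :=
  \sum_u \sum_w (x u)%:~R * (y w)%:~R *
    invmx (map_mx intr inter_mx) (enum_rank u) (enum_rank w).

Lemma inter_sym (u w : G) : inter u w = inter w u.
Proof. by rewrite /inter eq_sym adj_sym; case: eqP => [->|]. Qed.

(* [formQ] restricts to the evaluation pairing of [L'] with [L], and hence to
   [formL] on [L]. *)
Lemma formQ_dual_of (x : dual_lat) (c : lat) : dG != 0 ->
  formQ x (dual_of c) = (\sum_w x w * c w)%:~R.
Proof.
move=> d0; set I := map_mx (intr : int -> rat) inter_mx.
have uI : I \in unitmx.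
  rewrite unitmxE unitfE det_map_mx intr_eq0; apply: contra_neq d0.
  by rewrite /dG -scaleN1r detZ => ->; rewrite mulr0.
rewrite /formQ rmorph_sum; apply: eq_bigr => u _ /=.
under eq_bigr => w _ do rewrite -mulrA -/I.
rewrite -big_distrr rmorphM; congr (_ * _) => /=.
under eq_bigr => w _ do rewrite ffunE rmorph_sum mulr_suml.
rewrite exchange_big (bigD1 u) //= [X in (_ + X)%R]big1 ?addr0 => [|z zu].
- have := congr1 (fun M : 'M[rat]_(#|G|) => M (enum_rank u) (enum_rank u))
    (mulVmx uI).
  rewrite !mxE eqxx => E; rewrite -[RHS]mulr1 -[X in _ = (_ * X)%R]E mulr_sumr.
  rewrite (reindex (@enum_val _ (mem G))) /=; last exact/onW_bij/enum_val_bij.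
  by apply: eq_bigr => i _;
    rewrite !mxE enum_rankK enum_valK inter_sym rmorphM -mulrA
      (mulrC (invmx _ _ _)).
- have := congr1 (fun M : 'M[rat]_(#|G|) => M (enum_rank u) (enum_rank z))
    (mulVmx uI).
  rewrite !mxE (inj_eq enum_rank_inj) eq_sym (negbTE zu) => E.
  rewrite -[RHS](mulr0 (c z)%:~R) -[X in _ = (_ * X)%R]E mulr_sumr.
  rewrite (reindex (@enum_val _ (mem G))) /=; last exact/onW_bij/enum_val_bij.
  by apply: eq_bigr => i _;
    rewrite !mxE enum_rankK enum_valK inter_sym rmorphM -mulrA
      (mulrC (invmx _ _ _)).
Qed.

Definition in_lat : {pred dual_lat} := fun x =>
  `[< exists c : lat, x = dual_of c >].

Lemma in_lat_zmod_closed : zmod_closed in_lat.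
Proof.
split.
  apply/asboolP; exists 0; apply/ffunP => w; rewrite !ffunE big1 // => u _.
  by rewrite ffunE mul0r.
move=> x y /asboolP[a ->] /asboolP[b ->]; apply/asboolP; exists (a - b).
apply/ffunP => w; rewrite !ffunE -sumrB; apply: eq_bigr => u _.
by rewrite !ffunE mulrBl.
Qed.

HB.instance Definition _ :=
  GRing.isZmodClosed.Build dual_lat in_lat in_lat_zmod_closed.

(* [H = L'/L] *)
Definition Hgrp := Quotient.quot (in_lat : zmodClosed dual_lat).

Definition cls (x : dual_lat) : Hgrp := \pi x.

(* The rational number under [floor] is an entry of the adjugate of
   [- inter_mx], hence an integer. *)
Definition acoef (u w : G) : int :=
  Num.floor (- (dG%:~R * formQ (Estar u) (Estar w))).

Definition alpha (u : G) : int := \sum_w ((deg w)%:Z - 2) * acoef u w.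
Definition beta (u : G) : int := \sum_w ((deg w)%:Z - 2) * acoef u w ^+ 2.

(* The Spin^c structures of the plumbed 4-manifold form a torsor under [L'],
   and those of its boundary a torsor under [H].  Both torsors have a
   distinguished point, the canonical structure; a Spin^c structure is
   represented by its difference from the canonical one. *)
Definition spincX : Type := dual_lat.
Definition spincX_can : spincX := (0 : dual_lat).
Definition spincX_act (l : dual_lat) (s : spincX) : spincX := l + (s : dual_lat).

Definition spincM : Type := Hgrp.
Definition spincM_can : spincM := (0 : Hgrp).
Definition spincM_act (h : Hgrp) (s : spincM) : spincM := h + (s : Hgrp).

(* the only [h] such that [spincM_act h spincM_can = s] *)
Definition spincM_diff (s : spincM) : Hgrp := s.

Definition spinc_bdry (s : spincX) : spincM := cls s.

Definition c1_can : dual_lat := [ffun w => euler w + 2].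
Definition c1 (s : spincX) : dual_lat := c1_can + (s : dual_lat) *+ 2.

Lemma c1_act (l : dual_lat) (s : spincX) : c1 (spincX_act l s) = c1 s + l *+ 2.
Proof. by rewrite /c1 /spincX_act mulrnDl addrA addrAC. Qed.

Lemma spinc_bdry_act (l : dual_lat) (s : spincX) :
  spinc_bdry (spincX_act l s) = spincM_act (cls l) (spinc_bdry s).
Proof. exact: raddfD. Qed.

(* [R : L' -> L'_A]: it sends [E^*_w] to [E^*_w] if [w] is in [A], else to 0. *)
Definition dual_res (A : {set G}) (l : dual_lat) : {ffun induced_graph A -> int} :=
  [ffun w => l (val w)].

End Graph.

Definition spinc_res (G : plumbing) (A : {set G}) (s : spincX G) :
  spincX (induced_graph A) :=
  spincX_act (dual_res A s : dual_lat (induced_graph A)) (spincX_can (induced_graph A)).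

Section Rational.
Variables (C : numClosedFieldType) (G : plumbing).

Definition Hhat : set (Hgrp G -> C) :=
  [set rho | rho 0 = 1 /\ forall x y, rho (x + y) = rho x * rho y].

(* [P_{rho,u}] evaluated in any field [K] containing [C] *)
Definition Pfun (K : fieldType) (iota : C -> K) (rho : Hgrp G -> C) (u : G)
    (t : K) : K :=
  \prod_(w : G) (1 - iota (rho (cls (Estar w))) * t ^ acoef w u)
                 ^ ((deg w)%:Z - 2).

Definition ratfun := {fraction {poly C}}.

Definition poly_frac (p : {poly C}) : ratfun := tofrac p.

Definition Prat (rho : Hgrp G -> C) (u : G) : ratfun :=
  Pfun (fun c => poly_frac c%:P) rho u (poly_frac 'X).

Definition Hrat (s : spincM G) (u : G) : ratfun :=
  poly_frac ((dG G)%:~R^-1)%:P *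
  \sum_(rho \in Hhat) poly_frac ((rho (spincM_diff s))^-1)%:P * Prat rho u.

Definition is_polpart (f : ratfun) (p : {poly C}) : Prop :=
  exists n q : {poly C}, [/\ q != 0, (size n < size q)%N
    & f - poly_frac p = poly_frac n / poly_frac q].

Definition polpart (f : ratfun) : {poly C} := xget 0 [set p | is_polpart f p].

Definition Hpol (s : spincM G) (u : G) : {poly C} := polpart (Hrat s u).

(* vertices admissible as [u_rho] *)
Definition torsion_vertex (rho : Hgrp G -> C) : pred G := fun u =>
  (rho (cls (Estar u)) != 1) ||
  [exists w, adj u w && (rho (cls (Estar w)) != 1)].

(* The limit does not depend on the admissible vertex; the default 0 is never
   reached, the classes [E^*_w] generating [H]. *)
Definition torsion_term (rho : Hgrp G -> C) : C :=
  if [pick u | torsion_vertex rho u] is Some u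
  then lim (Pfun id rho u t @[t --> (1 : C)^']) else 0.

(* coefficient at 0 of the Reidemeister-Turaev torsion *)
Definition torsion (s : spincM G) : C :=
  (dG G)%:~R^-1 *
  \sum_(rho \in Hhat `\ (fun=> 1)) (rho (spincM_diff s))^-1 * torsion_term rho.

End Rational.

(* Casson-Walker invariant in Lescop's normalization *)
Definition casson_walker (G : plumbing) : rat :=
  - ((dG G)%:~R / 24) *
  ((\sum_(w : G) euler w)%:~R + (3 * #|G|)%:R +
   (\sum_(w : G) ((deg w)%:Z - 2) * acoef w w)%:~R / (dG G)%:~R).

Definition sw (C : numClosedFieldType) (G : plumbing) (s : spincM G) : C :=
  ratr (casson_walker G / (dG G)%:~R) - torsion C s.

(* Main.v *)
From HB Require Import structures.
Require Import Defs.
From mathcomp Require Import all_boot all_order all_algebra.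
From mathcomp Require Import ring zify.
From mathcomp Require Import complex.
From mathcomp Require Import all_classical all_reals all_analysis.
From mathcomp Require Import finset.

(** The theorem compares the boundary of a plumbed tree with the boundaries of
    the branches that remain when the vertex [v] is deleted.

    The formulas for [c_1] and for the Casson-Walker invariant are linear
    algebra.  Together, the restrictions [R_i] are the orthogonal projection
    along [E^*_v], so a quadratic expression on [L'] is the sum of those of the
    branches plus a rank-one term, the square of the pairing with [E^*_v]
    divided by [- a_vv / d].  In coordinates this is the Schur complement
    formula [green_schur] for the inverse of minus the intersection matrix.
    Evaluated at [c_1] it gives [chern_difference]; its diagonal gives
    [casson_difference].  The Seiberg-Witten formula is the difference of the
    Casson-Walker formula and the torsion formula.

    For the torsion, a character [rho] of [H] is recorded by the labelling
    [r_w = rho [E^*_w]] of the vertices, subject to one relation per vertex;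
    the characters of [H_i] become labellings that are [1] off a branch.  The
    order at [t = 1] of the product [P] of a labelling is the sum of
    [delta_w - 2] over the [w] with [r_w = 1].  By induction over rooted trees
    ([ord_facts], [vanord_neg]) this order is [-2] for the trivial labelling
    and otherwise at least [-1], even when the relation at [v] is dropped; it
    is [-1] only for a labelling carried by a single branch, with a value
    different from [1] at the root of that branch.

    Near [t = c] the function [P_(rho, v)] behaves as the one of the twisted
    labelling [r_w c^(a_wv)] behaves near [1], and a twist spoils only the
    relation at [v].  Hence all the poles of [H_(sigma, v)] are known: with
    [n = - d r_v] they are those of
    - simple fractions [C t^n / (1 - r_u t^d)], one for each labelling of a
      branch whose value [r_u] at the root is not [1];
    - one fraction with double poles, coming from the trivial labelling.
    The assumption on [r_v] says that [0 <= n < d], so these fractions have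
    negative degree.  Subtracting them leaves a function that is regular
    everywhere, hence the polynomial part ([regular_diff], [polynomial_part]).
    Its value at [1] has three sources.  The trivial character contributes the
    explicit terms in [alpha] and [beta], through a second order expansion
    ([jet_constant_term]).  The other characters of [H] contribute their
    limits at [v].  The simple fractions contribute, negatively, the terms of
    the torsions of the branches whose value at the root is not [1].  In the
    torsion the limit is taken at an admissible vertex, on which it does not
    depend ([lead_adm]).  When [v] is not admissible, replacing it by an
    admissible vertex changes the limit by the limit for the branch that
    carries the character ([lead_limit]); this accounts for the terms of the
    torsions of the branches whose value at the root is [1]
    ([torsion_difference]). *)

Set Implicit Arguments.
Unset Strict Implicit.
Unset Printing Implicit Defensive.

Import Order.TTheory GRing.Theory Num.Theory.
Import numFieldNormedType.Exports.

Local Open Scope ring_scope.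

(** * Green functions of subgraphs *)

Section Green.
Variable G : plumbing.
Implicit Types (A B : {set G}) (x y z u v w : G).

(** The sign turns the negative definite form into a positive definite one. *)
Definition ninter x y : rat := - (inter x y)%:~R.

Lemma ninter_sym x y : ninter x y = ninter y x.
Proof. by rewrite /ninter inter_sym. Qed.

Lemma ninter_nbr x y : x != y -> ninter x y = - (adj x y)%:R.
Proof. by move=> xy; rewrite /ninter /inter (negbTE xy); case: (adj x y). Qed.

Lemma ninter_non x y : x != y -> ~~ adj x y -> ninter x y = 0.
Proof. by move=> xy a; rewrite ninter_nbr // (negbTE a) oppr0. Qed.

Hypothesis Gneg : negative_definite G.

(** Clearing denominators reduces the claim to lattice vectors. *)
Lemma ninter_gt0 (f : G -> rat) x0 : f x0 != 0 ->
  0 < \sum_x \sum_y f x * f y * ninter x y.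
Proof.
move=> fx0.
pose N : int := \prod_x denq (f x).
have N0 : 0 < N by apply: prodr_gt0 => x _; exact: denq_gt0.
pose c : lat G := [ffun x => numq (f x) * \prod_(y | y != x) denq (f y)].
have cE x : (c x)%:~R = N%:~R * f x.
  rewrite ffunE [in RHS]/N [in RHS](bigD1 x) //= !intrM -{3}(divq_num_den (f x)).
  by field; rewrite intr_eq0 denq_neq0.
have c0 : c != 0.
  apply: contra_neq fx0 => c0; have := cE x0; rewrite c0 ffunE.
  move/esym/eqP; rewrite mulf_eq0 intr_eq0 (gt_eqF N0) /=; exact: eqP.
have := Gneg c0; rewrite -oppr_gt0 -(ltr0z rat) /formL => h.
have N2 : 0 < (N%:~R * N%:~R : rat) by rewrite mulr_gt0 // ltr0z.
rewrite -(pmulr_rgt0 _ N2); suff -> : N%:~R * N%:~R *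
  (\sum_x \sum_y f x * f y * ninter x y) = (- (\sum_u \sum_w c u * c w * inter u w))%:~R by [].
rewrite rmorphN /= rmorph_sum -sumrN mulr_sumr; apply: eq_bigr => x _.
rewrite rmorph_sum -sumrN mulr_sumr; apply: eq_bigr => y _.
rewrite /= !intrM !cE /ninter; ring.
Qed.

(** Multiplying the equations by the values of [f] and summing gives the energy
    of [f], which is positive unless [f] vanishes. The identities between Green
    functions below all follow from this uniqueness principle. *)
Lemma harmonic0 A (f : G -> rat) : (forall x, x \notin A -> f x = 0) ->
  (forall x, x \in A -> \sum_z ninter x z * f z = 0) -> forall x, f x = 0.
Proof.
move=> f0 fA x; apply/eqP; apply: contraT => /ninter_gt0.
rewrite big1 ?ltxx // => y _; under eq_bigr => z _ do rewrite -mulrA (mulrC (f z)).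
rewrite -mulr_sumr; have [yA|/f0 ->] := boolP (y \in A); last by rewrite mul0r.
by rewrite fA // mulr0.
Qed.

(** The block of [A], completed by an identity block so that all subsets share
    one matrix size; determinant and inverse are those of the block. *)
Definition ninter_mx A : 'M[rat]_#|G| := \matrix_(i, j)
  if (enum_val i \in A) && (enum_val j \in A) then ninter (enum_val i) (enum_val j)
  else (i == j)%:R.

Definition disc A : rat := \det (ninter_mx A).

Lemma sum_enum_val (R : nmodType) (F : 'I_#|G| -> R) :
  \sum_i F i = \sum_(x : G) F (enum_rank x).
Proof.
rewrite (reindex enum_rank) //=; exact: onW_bij (enum_rank_bij _).
Qed.

Lemma ninter_mxE A x y : ninter_mx A (enum_rank x) (enum_rank y) =
  if (x \in A) && (y \in A) then ninter x y else (x == y)%:R.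
Proof. by rewrite mxE !enum_rankK (inj_eq enum_rank_inj). Qed.

Lemma ninter_mx_sym A : (ninter_mx A)^T = ninter_mx A.
Proof. by apply/matrixP => i j; rewrite !mxE andbC ninter_sym eq_sym. Qed.

Lemma ninter_mx_unit A : ninter_mx A \in unitmx.
Proof.
rewrite unitmxE unitfE; apply/det0P => -[b b0 bq]; move/negP: b0; apply.
have E y : \sum_x b 0 (enum_rank x) *
    (if (x \in A) && (y \in A) then ninter x y else (x == y)%:R) = 0.
  have := congr1 (fun M : 'rV[rat]_#|G| => M 0 (enum_rank y)) bq; rewrite !mxE sum_enum_val.
  by under eq_bigr do rewrite ninter_mxE.
have fN y : y \notin A -> b 0 (enum_rank y) = 0.
  move=> yA; rewrite -[RHS](E y) (bigD1 y) //= (negbTE yA) andbF eqxx mulr1.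
  by rewrite big1 ?addr0 // => x xy; rewrite andbF (negbTE xy) mulr0.
have f0 := @harmonic0 A (fun x => b 0 (enum_rank x)) fN.
apply/eqP/rowP => i; rewrite mxE -(enum_valK i); apply: f0 => x xA.
rewrite -[RHS](E x); apply: eq_bigr => z _.
have [zA|/fN ->] := boolP (z \in A); last by rewrite mulr0 mul0r.
by rewrite xA mulrC ninter_sym.
Qed.

(** Up to sign, the form on the dual lattice of the subgraph [A], in the basis
    [E^*_w]. *)
Definition green A x y : rat :=
  if (x \in A) && (y \in A) then invmx (ninter_mx A) (enum_rank x) (enum_rank y)
  else 0.

Lemma green_offl A x y : x \notin A -> green A x y = 0.
Proof. by rewrite /green => /negbTE ->. Qed.

Lemma green_offr A x y : y \notin A -> green A x y = 0.
Proof. by rewrite /green andbC => /negbTE ->. Qed.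

Lemma green_sym A x y : green A x y = green A y x.
Proof.
rewrite /green andbC; case: ifP => // _.
by rewrite -{2}(ninter_mx_sym A) -trmx_inv mxE.
Qed.

Lemma greenE A x y : x \in A -> y \in A ->
  \sum_z ninter x z * green A z y = (x == y)%:R.
Proof.
move=> xA yA.
have := congr1 (fun M : 'M[rat]_#|G| => M (enum_rank x) (enum_rank y))
  (mulmxV (ninter_mx_unit A)).
rewrite !mxE (inj_eq enum_rank_inj) => <-; rewrite sum_enum_val.
apply: eq_bigr => z _; rewrite ninter_mxE xA /green yA /= andbT.
case: ifPn => // zA; rewrite mulr0; have -> : (x == z) = false.
  by apply: contraNF zA => /eqP <-.
by rewrite mul0r.
Qed.

Lemma green_uniq A (f g : G -> rat) :
  (forall x, x \notin A -> f x = g x) ->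
  (forall x, x \in A -> \sum_z ninter x z * f z = \sum_z ninter x z * g z) ->
  f =1 g.
Proof.
move=> fN fA x; apply/eqP; rewrite -subr_eq0; apply/eqP.
apply: (@harmonic0 A (fun x => f x - g x)) => {x} [x xA|x xA].
  by rewrite fN // subrr.
under eq_bigr do rewrite mulrBr; by rewrite sumrB fA // subrr.
Qed.

(** The energy of the function [green A ^~ v] is its value at [v]. *)
Lemma green_gt0 A v : v \in A -> 0 < green A v v.
Proof.
move=> vA; have [x fx] : exists x, green A x v != 0.
  apply: contrapT => h; have := greenE vA vA; rewrite eqxx big1 => [/eqP|z _].
    by rewrite eq_sym oner_eq0.
  have -> : green A z v = 0; last by rewrite mulr0.
  by apply/eqP; apply: contrapT => /negP zz; apply: h; exists z.
have := @ninter_gt0 (fun x => green A x v) x fx.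
rewrite (bigD1 v) //= [X in _ + X]big1 => [|y yv].
  rewrite addr0; under eq_bigr => z _ do rewrite -mulrA (mulrC (green A z v)).
  by rewrite -mulr_sumr greenE // eqxx mulr1.
under eq_bigr => z _ do rewrite -mulrA (mulrC (green A z v)).
rewrite -mulr_sumr; have [yA|yA] := boolP (y \in A).
  by rewrite greenE // (negbTE yv) mulr0.
by rewrite green_offl // mul0r.
Qed.

(** Cramer's rule: the cofactor of the block of [A] at [v] is the determinant of
    the block of [A :\ v]. *)
Lemma disc_green A v : v \in A -> disc A * green A v v = disc (A :\ v).
Proof.
move=> vA; rewrite /green vA /= /invmx ninter_mx_unit mxE mulrA divff ?mul1r; last first.
  by have := ninter_mx_unit A; rewrite unitmxE unitfE.
rewrite mxE /disc (expand_det_row _ (enum_rank v)) (bigD1 (enum_rank v)) //=.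
rewrite ninter_mxE setD11 /= eqxx mul1r [X in _ + X]big1 => [|j jv].
  rewrite addr0; congr (_ * \det _); apply/matrixP => i j.
  have E k : enum_val (lift (enum_rank v) k) \in A :\ v =
             (enum_val (lift (enum_rank v) k) \in A).
    rewrite in_setD1; case: eqP => //= e.
    case/eqP: (neq_lift (enum_rank v) k); apply: enum_val_inj.
    by rewrite e enum_rankK.
  by rewrite !mxE !E.
by rewrite mxE enum_rankK setD11 /= eq_sym (negbTE jv) mul0r.
Qed.

Lemma disc0 : disc set0 = 1.
Proof.
rewrite -[RHS](det1 _ #|G|); congr (\det _); apply/matrixP => i j.
by rewrite !mxE in_set0.
Qed.

(** By [disc_green], removing a vertex multiplies by a positive number. *)
Lemma disc_gt0 A : 0 < disc A.
Proof.
elim: {A}_.+1 {-2}A (ltnSn #|A|) => // n IH A An.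
have [->|[v vA]] := set_0Vmem A; first by rewrite disc0.
rewrite -(pmulr_lgt0 _ (green_gt0 vA)) disc_green //; apply: IH.
by move: An; rewrite (cardsD1 v) vA add1n ltnS.
Qed.

Lemma disc_neq0 A : disc A != 0. Proof. by rewrite gt_eqF ?disc_gt0. Qed.

(** Without edges between [A] and [B], the completed block of the union is the
    product of the two completed blocks. *)
Lemma discU A B : [disjoint A & B] ->
  (forall x y, x \in A -> y \in B -> ~~ adj x y) ->
  disc (A :|: B) = disc A * disc B.
Proof.
move=> AB nadj; rewrite /disc -det_mulmx; congr (\det _).
have AN x : x \in B -> (x \in A) = false.
  by move=> xB; apply: contraTF xB => xA; rewrite (disjointFr AB).
have BN x : x \in A -> (x \in B) = false by move=> xA; rewrite (disjointFr AB).
apply/matrixP => i j; rewrite -(enum_valK i) -(enum_valK j).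
move: (enum_val i) (enum_val j) => {i j} x y.
rewrite ninter_mxE mxE sum_enum_val.
have [xA|xA] := boolP (x \in A).
  under eq_bigr do rewrite !ninter_mxE xA /=.
  rewrite (bigID (mem A)) /= [X in _ + X]big1 => [|z zA]; last first.
    rewrite (negbTE zA); case: eqP zA => [<-|_ _]; first by rewrite xA.
    by rewrite mul0r.
  rewrite addr0 in_setU xA /= in_setU.
  under eq_bigr => z zA do rewrite (zA : z \in A) (BN z zA) /=.
  have [yA|yA] /= := boolP (y \in A).
    rewrite (bigD1 y) //= eqxx mulr1 big1 ?addr0 // => z /andP[_ zy].
    by rewrite (negbTE zy) mulr0.
  rewrite big1 => [|z zA]; last first.
    case: eqP => [zy|_]; last by rewrite mulr0.
    by rewrite -zy zA in yA.
  have xy : x != y by apply: contraNneq yA => <-.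
  by case: ifP => yB; [rewrite ninter_non // nadj | rewrite (negbTE xy)].
under eq_bigr do rewrite !ninter_mxE (negbTE xA) /=.
rewrite (bigD1 x) //= eqxx mul1r [X in _ + X]big1 ?addr0 => [|z zx]; last first.
  by rewrite eq_sym (negbTE zx) mul0r.
rewrite !in_setU (negbTE xA) /=; case: ifP => [/andP[xB yAB]|].
  rewrite xB /=; case: ifP yAB => // yB; rewrite orbF => yA.
  have xy : x != y by apply: contraNneq xA => ->.
  by rewrite (negbTE xy) ninter_non // adj_sym nadj.
by case: (x \in B) (y \in B) => -[] //=; rewrite orbT.
Qed.

End Green.

(** * Branches of a tree *)

Section Branches.
Variable G : plumbing.
Implicit Types (A B : {set G}) (x y z u v w : G).

Definition adj_in A : rel G := fun x y => [&& x \in A, y \in A & adj x y].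
Definition connected_set A : Prop := {in A &, forall x y, connect (adj_in A) x y}.
Definition nbrs A v : {set G} := [set u in A | adj v u].
(** Meant for a neighbour [u] of [v], which becomes the root of the branch. *)
Definition branch A v u : {set G} := [set x | connect (adj_in (A :\ v)) u x].

Lemma adj_in_sym A : symmetric (adj_in A).
Proof. by move=> x y; rewrite /adj_in adj_sym andbCA. Qed.

Lemma connect_in_sym A : connect_sym (adj_in A).
Proof. exact: sym_connect_sym (@adj_in_sym A). Qed.

Lemma adj_neq x y : adj x y -> x != y.
Proof. by apply: contraTneq => ->; rewrite adj_irr. Qed.

Lemma nbrsP A v u : reflect (u \in A /\ adj v u) (u \in nbrs A v).
Proof. by rewrite inE; exact: andP. Qed.

Lemma nbrsD1 A v u : u \in nbrs A v -> u \in A :\ v.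
Proof. by move=> /nbrsP[uA vu]; rewrite in_setD1 uA eq_sym adj_neq. Qed.

Lemma connect_in_mem A x y : x \in A -> connect (adj_in A) x y -> y \in A.
Proof.
move=> xA /connectP[p pp ->]; elim: p x xA pp => //= z p IH x xA.
by case/andP=> /and3P[_ zA _]; exact: IH.
Qed.

Lemma root_in_branch A v u : u \in branch A v u.
Proof. by rewrite inE connect0. Qed.

Lemma branch_sub A v u : u \in nbrs A v -> branch A v u \subset A :\ v.
Proof.
move=> /nbrsD1 uA; apply/fintype.subsetP => x; rewrite inE; exact: connect_in_mem.
Qed.

Lemma branch_mem A v u x : u \in nbrs A v -> x \in branch A v u ->
  x \in A /\ x != v.
Proof.
by move=> /branch_sub /fintype.subsetP s /s; rewrite in_setD1 => /andP[].
Qed.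

Lemma branch_proper A v u : v \in A -> u \in nbrs A v ->
  (#|branch A v u| < #|A|)%N.
Proof.
move=> vA uN; rewrite (cardsD1 v A) vA add1n ltnS.
exact/subset_leq_card/branch_sub.
Qed.

Lemma branch_closed A v u x y : u \in nbrs A v -> x \in branch A v u ->
  y \in A -> y != v -> adj x y -> y \in branch A v u.
Proof.
move=> uN xB yA yv xy; have [xA xv] := branch_mem uN xB.
move: xB; rewrite !inE => /connect_trans; apply; apply: connect1.
by rewrite /adj_in !in_setD1 xA xv yA yv.
Qed.

Lemma path_sub_connect (e e' : rel G) u :
  (forall x y, connect e' u x -> e x y -> e' x y) ->
  forall x, connect e u x -> connect e' u x.
Proof.
move=> h x /connectP[p + ->]; elim/last_ind: p => //= p y IH.
rewrite rcons_path last_rcons => /andP[/IH c e1].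
exact: connect_trans c (connect1 (h _ _ c e1)).
Qed.

Lemma conn_branch A v u : u \in nbrs A v -> connected_set (branch A v u).
Proof.
move=> uN; have h x : x \in branch A v u -> connect (adj_in (branch A v u)) u x.
  rewrite inE; apply: path_sub_connect => {}x y c.
  case/and3P; rewrite !in_setD1 => /andP[xv xA] /andP[yv yA] xy.
  have xB := connect_in_mem (root_in_branch A v u) c.
  by rewrite /adj_in xB (branch_closed uN xB) ?xy.
move=> x y xB yB; apply: connect_trans (h _ yB).
by rewrite connect_in_sym h.
Qed.

Lemma branch_exists A v x : connected_set A -> v \in A -> x \in A -> x != v ->
  exists2 u, u \in nbrs A v & x \in branch A v u.
Proof.
move=> cA vA xA; have := cA _ _ vA xA; case/connectP => p pp ->.
case/shortenP: pp => -[|u p'] /=; rewrite ?eqxx // => /andP[/and3P[_ uA vu] pp].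
case/andP=> vp _ _ _; exists u; first by apply/nbrsP.
rewrite inE; apply/connectP; exists p' => //.
elim: p' u uA vp pp {vu} => //= z p' IH u uA; rewrite in_cons negb_or.
move=> /andP[vu vp] /andP[/and3P[_ zA uz] pp]; rewrite /adj_in !in_setD1 uA zA uz.
rewrite IH ?zA //; move: vp; rewrite in_cons negb_or => /andP[vz _].
by rewrite eq_sym vu eq_sym vz.
Qed.

Hypothesis Gacyclic : acyclic_graph G.

(** A path inside the branch from [u] to another neighbour of [v] would close up
    to a cycle through [v]. *)
Lemma branch_root_uniq A v u w : u \in nbrs A v -> w \in nbrs A v ->
  w \in branch A v u -> w = u.
Proof.
move=> uN wN; rewrite inE => /connectP[p pp wE]; move: wN; rewrite {}wE.
case/shortenP: pp => -[|z p'] //; set s := z :: p' => pp up _ wN.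
case/negP: (@Gacyclic [:: v, u & s] isT).
have [_ vu] := nbrsP _ _ _ uN; have [_ vl] := nbrsP _ _ _ wN.
apply/andP; split; last first.
  rewrite cons_uniq up andbT; apply/negP => vs.
  have /connect_in_mem : connect (adj_in (A :\ v)) u v by apply: (path_connect pp).
  by move=> /(_ (nbrsD1 uN)); rewrite setD11.
rewrite /cycle rcons_path /= vu /= (adj_sym _ v) vl andbT.
by apply: sub_path pp => x y /and3P[].
Qed.

Lemma branch_uniq A v u w x : u \in nbrs A v -> w \in nbrs A v ->
  x \in branch A v u -> x \in branch A v w -> w = u.
Proof.
move=> uN wN xu xw; apply: branch_root_uniq (uN) (wN) _.
move: xu xw; rewrite !inE => xu; rewrite connect_in_sym; exact: connect_trans.
Qed.

Lemma branch_nbr A v u x : u \in nbrs A v -> x \in branch A v u -> adj v x ->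
  x = u.
Proof.
move=> uN xB vx; apply: branch_root_uniq (uN) _ (xB).
by apply/nbrsP; split=> //; case: (branch_mem uN xB).
Qed.

Lemma branch_sep A v u w x y : u \in nbrs A v -> w \in nbrs A v -> u != w ->
  x \in branch A v u -> y \in branch A v w -> ~~ adj x y.
Proof.
move=> uN wN uw xu yw; apply: contra_neqN uw => xy.
have [yA yv] := branch_mem wN yw.
by rewrite (branch_uniq uN wN (branch_closed uN xu yA yv xy) yw).
Qed.

Lemma nbrs_branch A v u w : u \in nbrs A v -> w \in branch A v u ->
  nbrs (branch A v u) w = nbrs A w :\ v.
Proof.
move=> uN wB; apply/setP => y; rewrite in_setD1.
apply/nbrsP/andP => [[yB wy]|[yv /nbrsP[yA wy]]].
  by have [yA yv] := branch_mem uN yB; split=> //; apply/nbrsP.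
by split=> //; exact: branch_closed uN wB yA yv wy.
Qed.

Lemma card_nbrs_branch A v u w : v \in A -> u \in nbrs A v ->
  w \in branch A v u ->
  #|nbrs A w| = (#|nbrs (branch A v u) w| + (w == u))%N.
Proof.
move=> vA uN wB; rewrite (nbrs_branch uN wB) (cardsD1 v (nbrs A w)) addnC.
congr (_ + nat_of_bool _)%N; apply/nbrsP/eqP => [[_ wv]|->].
  by apply: branch_nbr uN wB _; rewrite adj_sym.
by have [_] := nbrsP _ _ _ uN; rewrite adj_sym.
Qed.

Lemma nbr_back A v u : v \in A -> u \in nbrs A v -> v \in nbrs A u.
Proof.
by move=> vA /nbrsP[uA vu]; apply/nbrsP; rewrite adj_sym.
Qed.

(** Re-rooting: seen from [u], the branches that do not contain [v] are the
    branches of [branch A v u] at its own root. *)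
Lemma branch_branch A v u w : u \in nbrs A v -> w \in nbrs (branch A v u) u ->
  branch (branch A v u) u w = branch A u w.
Proof.
set B := branch A v u => uN wN; have BA := branch_sub uN.
have uB := root_in_branch A v u.
have wNA : w \in nbrs A u.
  by move: wN; rewrite nbrs_branch // in_setD1 => /andP[].
apply/setP => x; apply/idP/idP; rewrite !inE.
  apply: connect_sub => {}x y; rewrite /adj_in !in_setD1 => /and3P[/andP[xu xB]].
  case/andP=> yu yB xy; apply: connect1; rewrite /adj_in !in_setD1 xu yu xy.
  by have [-> _] := branch_mem uN xB; have [-> _] := branch_mem uN yB.
apply: path_sub_connect => {}x y /(connect_in_mem (nbrsD1 wN)).
rewrite /adj_in !in_setD1 => /andP[xu xB] /and3P[_ /andP[yu yA] xy].
rewrite xu yu xB xy /= andbT; apply: branch_closed (uN) (xB) yA _ (xy).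
apply: contraNneq xu => yv; rewrite yv adj_sym in xy.
by rewrite (branch_nbr uN xB xy).
Qed.

(** The branches at the two ends of an edge are the halves of the tree cut
    there. *)
Lemma branch_back A v u : connected_set A -> v \in A -> u \in nbrs A v ->
  branch A u v = A :\: branch A v u.
Proof.
move=> cA vA uN; have vN := nbr_back vA uN; set B := branch A v u.
have uB : u \in B := root_in_branch A v u.
apply/setP => x; rewrite in_setD; apply/idP/andP.
  move=> xv; have [xA xu] := branch_mem vN xv; split=> //; apply/negP => xB.
  have [w wN xw] := branch_exists (conn_branch uN) uB xB xu.
  have wNA : w \in nbrs A u.
    by move: wN; rewrite nbrs_branch // in_setD1 => /andP[].
  have [wB _] := nbrsP _ _ _ wN.
  rewrite branch_branch // in xw.
  have e := branch_uniq vN wNA xv xw; rewrite e in wB.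
  by have [_] := branch_mem uN wB; rewrite eqxx.
move=> [xB xA]; have [->|xv] := eqVneq x v; first exact: root_in_branch.
have [w wN xw] := branch_exists cA vA xA xv.
have uw : u \notin branch A v w.
  apply: contra xB => uw; have := branch_root_uniq wN uN uw => e.
  by rewrite /B e.
have [wA vw] := nbrsP _ _ _ wN.
have wu : w != u by apply: contraNneq uw => <-; exact: root_in_branch.
rewrite inE; apply: (@connect_trans _ _ w).
  apply: connect1; rewrite /adj_in !in_setD1 wA vw vA wu.
  by rewrite adj_neq //; have [_] := nbrsP _ _ _ uN.
have := conn_branch wN (root_in_branch _ _ _) xw.
apply: connect_sub => y z /and3P[yB zB yz]; apply: connect1.
have [yA _] := branch_mem wN yB; have [zA _] := branch_mem wN zB.
rewrite /adj_in !in_setD1 yA zA yz !andbT.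
by apply/andP; split; apply: contraNneq uw => <-.
Qed.

Lemma big_branch (R : Type) (idx : R) (op : Monoid.com_law idx) A v
    (F : G -> R) : connected_set A -> v \in A ->
  \big[op/idx]_(w in A) F w = op (F v)
    (\big[op/idx]_(u in nbrs A v) \big[op/idx]_(w in branch A v u) F w).
Proof.
move=> cA vA; rewrite (bigD1 v) //=; congr (op _ _).
(* Each vertex of [A] other than [v] is sent to the root of its branch. *)
pose root x := odflt v [pick u | (u \in nbrs A v) && (x \in branch A v u)].
have rootP x u : u \in nbrs A v -> x \in branch A v u -> root x = u.
  move=> uN xu; rewrite /root; case: pickP => [w /andP[wN xw]|/(_ u)] /=.
    exact: branch_uniq uN wN xu xw.
  by rewrite uN xu.
rewrite (partition_big root (fun u => u \in nbrs A v)) /=; last first.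
  move=> x /andP[xA xv]; have [u uN xu] := branch_exists cA vA xA xv.
  by rewrite (rootP _ _ uN xu).
apply: eq_bigr => u uN; apply: eq_bigl => x.
apply/andP/idP => [[/andP[xA xv] /eqP <-]|xu].
  by have [w wN xw] := branch_exists cA vA xA xv; rewrite (rootP _ _ wN xw).
by have [-> ->] := branch_mem uN xu; rewrite (rootP _ _ uN xu).
Qed.

(** Induction over rooted trees, the subtrees of [(A, v)] being the branches at
    [v] with their roots. *)
Lemma rooted_ind (Q : {set G} -> G -> Prop) :
  (forall A v, connected_set A -> v \in A ->
     (forall u, u \in nbrs A v -> Q (branch A v u) u) -> Q A v) ->
  forall A v, connected_set A -> v \in A -> Q A v.
Proof.
move=> H A; elim: {A}_.+1 {-2}A (ltnSn #|A|) => // n IH A An v cA vA.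
apply: H => // u uN; apply: IH; last exact: root_in_branch.
- exact: leq_trans (branch_proper vA uN) An.
- exact: conn_branch.
Qed.

End Branches.

(** * Green functions on trees *)

Section TreeGreen.
Variable G : plumbing.
Implicit Types (A B : {set G}) (x y z u v w : G).
Hypothesis Gacyclic : acyclic_graph G.
Hypothesis Gneg : negative_definite G.

(** The root is the only vertex of its branch adjacent to [v]. *)
Lemma ninter_sum_root A v u (f : G -> rat) : u \in nbrs A v ->
  (forall z, z \notin branch A v u -> f z = 0) ->
  \sum_z ninter v z * f z = - f u.
Proof.
move=> uN f0; have [uA vu] := nbrsP _ _ _ uN.
rewrite (bigD1 u) //= ninter_nbr ?adj_neq // vu big1 ?addr0 ?mulN1r // => z zu.
have [zB|/f0->] := boolP (z \in branch A v u); last by rewrite mulr0.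
have [zA zv] := branch_mem uN zB.
rewrite ninter_non ?mul0r // 1?eq_sym //; apply: contraNN zu => vz.
by rewrite (branch_nbr Gacyclic uN zB vz).
Qed.

Lemma ninter_sum_other A v u w x (f : G -> rat) : u \in nbrs A v ->
  w \in nbrs A v -> u != w -> x \in branch A v u ->
  (forall z, z \notin branch A v w -> f z = 0) ->
  \sum_z ninter x z * f z = 0.
Proof.
move=> uN wN uw xB f0; apply: big1 => z _.
have [zB|/f0->] := boolP (z \in branch A v w); last by rewrite mulr0.
rewrite ninter_non ?mul0r //; last exact: (branch_sep Gacyclic uN wN uw xB zB).
by apply: contraNneq uw => e; rewrite e in xB; rewrite (branch_uniq Gacyclic wN uN zB xB).
Qed.

Lemma ninter_sum_nbrs A v (f : G -> rat) : v \in A -> (forall z, z \notin A -> f z = 0) ->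
  \sum_z ninter v z * f z = ninter v v * f v - \sum_(u in nbrs A v) f u.
Proof.
move=> vA f0; rewrite (bigD1 v) //=; congr (_ + _).
rewrite (bigID (mem (nbrs A v))) /= [X in _ + X]big1 ?addr0 => [|z /andP[zv zN]].
  rewrite -sumrN; apply: eq_big => [z|z /andP[zv /nbrsP[zA vz]]].
    by apply: andb_idl => /nbrsD1; rewrite in_setD1 => /andP[].
  by rewrite ninter_nbr 1?eq_sym // vz mulN1r.
have [zA|/f0 ->] := boolP (z \in A); last by rewrite mulr0.
rewrite ninter_non ?mul0r // 1?eq_sym //; apply: contraNN zN => vz.
by apply/nbrsP.
Qed.

(** On the branch, both sides are harmonic off the root and have the same source
    there, the value at [v]. *)
Lemma green_branch A v u w : connected_set A -> v \in A -> u \in nbrs A v ->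
  w \in branch A v u ->
  green A w v = green A v v * green (branch A v u) w u.
Proof.
move=> cA vA uN wB; set B := branch A v u.
pose f z := if z \in B then green A z v else 0.
have : f =1 (fun z => green A v v * green B z u).
  apply: (@green_uniq _ Gneg B) => x xB; first by rewrite /f (negbTE xB) (green_offl _ xB) mulr0.
  under [RHS]eq_bigr do rewrite mulrCA.
  rewrite -mulr_sumr greenE ?root_in_branch //.
  have [xA xv] := branch_mem uN xB.
  have := @greenE _ Gneg A x v xA vA; rewrite (negbTE xv) => E.
  have -> : \sum_z ninter x z * f z =
            \sum_z ninter x z * green A z v - ninter x v * green A v v.
    rewrite [in RHS](bigD1 v) //= [RHS]addrC addKr [LHS](bigD1 v) //=.
    rewrite {1}/f; case: ifP => [vB|_]; first by case/eqP: (branch_mem uN vB).2.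
    rewrite mulr0 add0r; apply: eq_bigr => z zv.
    rewrite /f; case: ifPn => // zB; rewrite mulr0.
    have [zA|zA] := boolP (z \in A); last by rewrite green_offl ?mulr0.
    rewrite ninter_non ?mul0r //; first by apply: contraNneq zB => <-.
    by apply: contra zB; apply: (branch_closed uN).
  rewrite E sub0r ninter_nbr // mulNr opprK mulrC; congr (_ * (nat_of_bool _)%:R).
  rewrite adj_sym; apply/idP/eqP; last first.
    by move->; have [_] := nbrsP _ _ _ uN.
  exact: branch_nbr uN xB.
by move/(_ w); rewrite /f wB.
Qed.

(** The last term is the Schur complement of the entry at [v]. The form has the
    same effect on both sides: on a branch only its own Green function acts as a
    source, and at [v] the values at the roots are supplied by [green_branch].
    *)
Lemma green_schur A v x y : connected_set A -> v \in A ->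
  green A x y = \sum_(u in nbrs A v) green (branch A v u) x y
                + green A x v * green A v y / green A v v.
Proof.
move=> cA vA; have gv := green_gt0 Gneg vA.
have brN u z : u \in nbrs A v -> z \notin A -> z \notin branch A v u.
  by move=> uN; apply: contra => /(branch_mem uN)[].
have [yA|yA] := boolP (y \in A); last first.
  rewrite !(green_offr _ yA) mulr0 mul0r addr0 big1 // => u uN.
  by rewrite green_offr // brN.
apply: (@green_uniq _ Gneg A (fun x => green A x y) (fun x => _ + _ )) => {}x xA.
  rewrite !(green_offl _ xA) !mul0r addr0 big1 // => u uN.
  by rewrite green_offl // brN.
rewrite greenE //.
under [RHS]eq_bigr => z _ do rewrite mulrDr mulr_sumr -mulrA mulrA.
rewrite big_split -mulr_suml greenE //= exchange_big /=.
have offB u z : z \notin branch A v u -> green (branch A v u) z y = 0.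
  exact: green_offl.
have [->|xv] := eqVneq x v; last first.
  rewrite mul0r addr0.
  have [w wN xw] := branch_exists cA vA xA xv.
  rewrite (bigD1 w) //= [X in _ + X]big1 ?addr0 => [|u /andP[uN uw]]; last first.
    by apply: (ninter_sum_other wN uN _ xw (offB u)); rewrite eq_sym.
  have [yw|yw] := boolP (y \in branch A v w); first by rewrite greenE.
  rewrite big1 => [|z _]; last by rewrite green_offr ?mulr0.
  by case: eqP xw yw => // -> ->.
rewrite mul1r; under eq_bigr => u uN do rewrite (ninter_sum_root uN (offB u)).
have [->|yv] := eqVneq y v.
  rewrite divff ?gt_eqF // big1 ?add0r // => u uN.
  by rewrite green_offr ?oppr0 //; apply/negP => /(branch_mem uN)[_ /eqP].
have [w wN yw] := branch_exists cA vA yA yv.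
rewrite (bigD1 w) //= [X in _ + X + _]big1 => [|u /andP[uN uw]].
  rewrite addr0 (green_sym A v y) (green_branch cA vA wN yw) mulrAC divff ?gt_eqF //.
  by rewrite mul1r (green_sym _ y w) addNr.
rewrite green_offr ?oppr0 //; apply: contra_neqN uw => yu.
exact: (branch_uniq Gacyclic wN uN yw yu).
Qed.

(** [disc_green] at [v], whose complement is the disjoint union of the branches.
    *)
Lemma disc_branches A v : connected_set A -> v \in A ->
  disc A * green A v v = \prod_(u in nbrs A v) disc (branch A v u).
Proof.
move=> cA vA; rewrite disc_green //.
have -> : A :\ v = \bigcup_(u in nbrs A v) branch A v u.
  apply/setP => x; apply/idP/bigcupP => [|[u uN /(branch_mem uN)[xA xv]]].
    by rewrite in_setD1 => /andP[xv xA]; have [u] := branch_exists cA vA xA xv; exists u.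
  by rewrite in_setD1 xA xv.
rewrite -(big_enum _ _ _ _) -(big_enum _ _ _ (fun u => disc _)) /=.
have : {subset enum (nbrs A v) <= nbrs A v} by move=> u; rewrite mem_enum.
elim: (enum _) (enum_uniq (nbrs A v)) => [|u s IH] /=; first by rewrite !big_nil disc0.
move=> /andP[us unq] sN; rewrite !big_cons discU ?IH //.
- by move=> w ws; apply: sN; rewrite in_cons ws orbT.
- rewrite bigcup_seq bigcup_disjoint // => w ws.
  rewrite disjoint_subset; apply/fintype.subsetP => x xu; apply: contraNN us => xw.
  rewrite -(branch_uniq Gacyclic _ _ xu xw) //; apply: sN; rewrite in_cons ?eqxx //.
  by rewrite [_ \in s]ws orbT.
- move=> x y xu; rewrite bigcup_seq => /bigcupP[w ws yw].
  have uN : u \in nbrs A v by apply: sN; rewrite mem_head.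
  have wN : w \in nbrs A v by apply: sN; rewrite in_cons [_ \in s]ws orbT.
  apply: branch_sep uN wN _ xu yw => //; by apply: contraNneq us => ->.
Qed.

(** The equation of [green A ^~ v] at [v], the values at the neighbours being
    replaced through [green_branch]; iterated, it expands the tree as a
    continued fraction. *)
Lemma green_inv A v : connected_set A -> v \in A ->
  (green A v v)^-1 = ninter v v - \sum_(u in nbrs A v) green (branch A v u) u u.
Proof.
move=> cA vA; have gv := green_gt0 Gneg vA.
have := greenE Gneg vA vA; rewrite eqxx (ninter_sum_nbrs vA); last first.
  by move=> z; exact: green_offl.
under eq_bigr => u uN do rewrite (green_branch cA vA uN (root_in_branch _ _ _)).
rewrite -mulr_sumr mulrC -mulrBr => E.
by apply: (mulfI (lt0r_neq0 gv)); rewrite E divff ?gt_eqF.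
Qed.

Lemma green_pos A v : connected_set A -> v \in A -> forall x, x \in A -> 0 < green A x v.
Proof.
move: A v; apply: rooted_ind => A v cA vA IH x xA.
have [->|xv] := eqVneq x v; first exact: green_gt0.
have [u uN xu] := branch_exists cA vA xA xv.
by rewrite (green_branch cA vA uN xu) mulr_gt0 ?green_gt0 ?IH.
Qed.

(** Both sides are expressed through the branches at [v] by [disc_branches] and
    [green_inv]. The defect of multiplicativity on the right is what separates
    the limits at [v] and at [u] in [lead_limit]. *)
Lemma disc_split A v u : connected_set A -> v \in A -> u \in nbrs A v ->
  disc (branch A v u) * disc (branch A u v) = disc A + disc A * green A u v.
Proof.
move=> cA vA uN; have uA := (nbrsP _ _ _ uN).1; have vN := nbr_back vA uN.
have vB' : v \in branch A u v := root_in_branch _ _ _.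
have cB' := conn_branch vN.
have := disc_branches cA vA; rewrite (bigD1 u) //=.
have -> : \prod_(w in nbrs A v | w != u) disc (branch A v w) =
   disc (branch A u v) * green (branch A u v) v v.
  rewrite disc_branches //; apply: eq_big => [w|w /andP[wN wu]].
    by rewrite nbrs_branch // in_setD1 andbC.
  by rewrite branch_branch // nbrs_branch // in_setD1 wu.
have := green_inv cB' vB'; rewrite nbrs_branch //.
have -> : \sum_(w in nbrs A v :\ u) green (branch (branch A u v) v w) w w =
          \sum_(w in nbrs A v | w != u) green (branch A v w) w w.
  apply: eq_big => [w|w]; first by rewrite in_setD1 andbC.
  by move=> wN; rewrite branch_branch // nbrs_branch.
have := green_inv cA vA; rewrite (bigD1 u) //=.
rewrite (green_branch cA vA uN (root_in_branch _ _ _)).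
have gA := lt0r_neq0 (green_gt0 Gneg vA).
have gB := lt0r_neq0 (green_gt0 Gneg vB').
move: (\sum_(i in _ | _) _) (green A v v) gA (green _ v v) gB
  (green (branch A v u) u u) => S gA gA0 gB gB0 gu E1 E2 E3.
have {}E1 : gA^-1 = gB^-1 - gu by rewrite E1 E2; ring.
move: E3; set a := disc A; set b := disc _; set c := disc _ => E3.
have E4 : a = b * c * (gB * gA^-1).
  by apply: (mulIf gA0); rewrite E3; field.
rewrite mulrA E3 {1}E4 E1; field; exact/gB0.
Qed.

Lemma disc_int A : disc A \is a Num.int.
Proof.
apply: rpred_sum => s _; rewrite rpredM ?rpredX ?rpredN ?rpred1 //.
apply: rpred_prod => i _; rewrite mxE; case: ifP => _; last exact: rpred_nat.
by rewrite rpredN rpred_int_num.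
Qed.

(** The product is a cofactor of an integral matrix. *)
Lemma wt_int A x y : disc A * green A x y \is a Num.int.
Proof.
rewrite /green; case: ifP => _; last by rewrite mulr0.
rewrite /invmx ninter_mx_unit // mxE mulrA divff ?disc_neq0 // mul1r mxE.
rewrite /cofactor rpredM ?rpredX ?rpredN ?rpred1 //.
apply: rpred_sum => s _; rewrite rpredM ?rpredX ?rpredN ?rpred1 //.
apply: rpred_prod => i _; rewrite !mxE; case: ifP => _; last exact: rpred_nat.
by rewrite rpredN rpred_int_num.
Qed.

(** The integers [a_xy] of the subgraph [A], as natural numbers since they serve
    as exponents of [t]. *)
Definition wt A x y : nat := Num.trunc (disc A * green A x y).
Definition dsc A : nat := Num.trunc (disc A).

Lemma dscE A : (dsc A)%:R = disc A.
Proof.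
by rewrite /dsc truncK // natrEint disc_int ltW ?disc_gt0.
Qed.

Lemma wtE A x y : connected_set A -> x \in A -> y \in A ->
  (wt A x y)%:R = disc A * green A x y.
Proof.
move=> cA xA yA; rewrite /wt truncK // natrEint wt_int mulr_ge0 // ltW ?disc_gt0 //.
exact: green_pos.
Qed.

Lemma dsc_gt0 A : (0 < dsc A)%N.
Proof. by rewrite -(ltr_nat rat) dscE disc_gt0. Qed.

Lemma wt_gt0 A x y : connected_set A -> x \in A -> y \in A -> (0 < wt A x y)%N.
Proof.
by move=> cA xA yA; rewrite -(ltr_nat rat) wtE // mulr_gt0 ?disc_gt0 ?green_pos.
Qed.

Lemma wt_sym A x y : wt A x y = wt A y x.
Proof. by rewrite /wt green_sym. Qed.

Lemma wt_branch A v u w : connected_set A -> v \in A -> u \in nbrs A v ->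
  w \in branch A v u ->
  (wt A w v * dsc (branch A v u) = wt (branch A v u) w u * wt A v v)%N.
Proof.
move=> cA vA uN wB; have [wA _] := branch_mem uN wB.
apply/eqP; rewrite -(eqr_nat rat) !natrM dscE !wtE ?root_in_branch //.
- by rewrite (green_branch cA vA uN wB); apply/eqP; ring.
- exact: conn_branch.
Qed.

Lemma wt_root A v : connected_set A -> v \in A ->
  wt A v v = (\prod_(u in nbrs A v) dsc (branch A v u))%N.
Proof.
move=> cA vA; apply/eqP; rewrite -(eqr_nat rat) wtE // disc_branches // natr_prod.
by apply/eqP; apply: eq_bigr => u _; rewrite dscE.
Qed.

Lemma dsc_split A v u : connected_set A -> v \in A -> u \in nbrs A v ->
  (dsc (branch A v u) * dsc (branch A u v) = dsc A + wt A u v)%N.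
Proof.
move=> cA vA uN; apply/eqP; rewrite -(eqr_nat rat) natrM natrD !dscE wtE //.
  by rewrite disc_split.
by have [] := nbrsP _ _ _ uN.
Qed.

End TreeGreen.

(** * Labellings and their orders at t = 1 *)

Section Orders.
Variables (C : numFieldType) (G : plumbing).
Implicit Types (A B : {set G}) (x y z u v w : G) (r : G -> C).
Hypothesis Gacyclic : acyclic_graph G.

Definition dg A w : int := #|nbrs A w|%:Z - 2.
(** The relation imposed by the class of [E_w] on the values [r u = rho [E^*_u]]
    of a character [rho]. *)
Definition rel_at A r w : Prop := r w ^ euler w * \prod_(u in nbrs A w) r u = 1.
Definition trivial_on A r : bool := [forall w in A, r w == 1].
(** The order at [t = 1] of the product of the [(1 - r w t^(a_wv))^(delta_w -
    2)] over [A]: only the factors with [r w = 1] vanish there. *)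
Definition vanord A r : int := \sum_(w in A) if r w == 1 then dg A w else 0.
(** The contribution of the branch to the order for [A], where the root has one
    more neighbour than in the branch; see [branch_ordE]. *)
Definition branch_ord A v u r : int := vanord (branch A v u) r + (r u == 1)%:Z.

Lemma trivP A r : reflect (forall w, w \in A -> r w = 1) (trivial_on A r).
Proof.
apply: (iffP forallP) => [h w wA|h w]; last by apply/implyP => /h/eqP.
by have := h w; rewrite wA => /eqP.
Qed.

Lemma dg_branch A v u w : v \in A -> u \in nbrs A v -> w \in branch A v u ->
  dg A w = dg (branch A v u) w + (w == u)%:Z.
Proof.
by move=> vA uN wB; rewrite /dg (card_nbrs_branch Gacyclic vA uN wB) PoszD addrAC.
Qed.

Lemma branch_ordE A v u r : v \in A -> u \in nbrs A v ->
  branch_ord A v u r = \sum_(w in branch A v u) if r w == 1 then dg A w else 0.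
Proof.
move=> vA uN; rewrite /branch_ord /vanord; have uB := root_in_branch A v u.
rewrite [in LHS](bigD1 u) //= [RHS](bigD1 u) //= (dg_branch vA uN uB) eqxx.
rewrite addrAC; congr (_ + _); first by case: (r u == 1); rewrite ?addr0.
apply: eq_bigr => w /andP[wB wu]; rewrite (dg_branch vA uN wB).
by rewrite (negbTE wu) addr0.
Qed.

Lemma vanord_branch A v r : connected_set A -> v \in A ->
  vanord A r = (if r v == 1 then dg A v else 0) + \sum_(u in nbrs A v) branch_ord A v u r.
Proof.
move=> cA vA; rewrite /vanord (big_branch _ _ _ cA vA) //=; congr (_ + _).
by apply: eq_bigr => u uN; rewrite branch_ordE.
Qed.

(** The degree of [v] is spread over the branches, which leaves the constant
    [-2]. *)
Lemma vanord_branch1 A v r : connected_set A -> v \in A -> r v = 1 ->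
  vanord A r = \sum_(u in nbrs A v) (1 + branch_ord A v u r) - 2.
Proof.
move=> cA vA rv; rewrite (vanord_branch _ cA vA) rv eqxx /dg [in RHS]big_split /=.
by rewrite sumr_const (natz #|nbrs A v|) addrAC.
Qed.

Lemma vanord_ge1 A v r u : connected_set A -> v \in A -> r v = 1 ->
  (forall w, w \in nbrs A v -> 0 <= 1 + branch_ord A v w r) ->
  u \in nbrs A v -> branch_ord A v u r - 1 <= vanord A r.
Proof.
move=> cA vA rv oc0 uN; rewrite (vanord_branch1 cA vA rv) (bigD1 u) //=.
rewrite (_ : branch_ord A v u r - 1 = 1 + branch_ord A v u r - 2); last by ring.
by rewrite lerB // lerDl; apply: sumr_ge0 => w /andP[/oc0].
Qed.

Lemma vanord_ge2 A v r u w : connected_set A -> v \in A -> r v = 1 ->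
  (forall w, w \in nbrs A v -> 0 <= 1 + branch_ord A v w r) ->
  u \in nbrs A v -> w \in nbrs A v -> u != w ->
  branch_ord A v u r + branch_ord A v w r <= vanord A r.
Proof.
move=> cA vA rv oc0 uN wN uw; rewrite (vanord_branch1 cA vA rv) (bigD1 u) //=.
rewrite (bigD1 w) /=; last by rewrite wN eq_sym.
rewrite (_ : branch_ord A v u r + branch_ord A v w r = 1 + branch_ord A v u r + (1 + branch_ord A v w r) - 2); last by ring.
rewrite lerB // lerD2l lerDl; apply: sumr_ge0 => y /andP[/andP[yN _] _]; exact: oc0.
Qed.

Lemma prod_nbrs_branch A v u w r : v \in A -> u \in nbrs A v ->
  w \in branch A v u ->
  \prod_(y in nbrs A w) r y =
  \prod_(y in nbrs (branch A v u) w) r y * (if w == u then r v else 1).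
Proof.
move=> vA uN wB; rewrite (nbrs_branch uN wB).
case: eqP => [->|wu].
  rewrite (bigD1 v) /=; last exact: nbr_back.
  rewrite mulrC; congr (_ * _).
  by apply: eq_bigl => y; rewrite in_setD1 andbC.
rewrite mulr1; apply: eq_bigl => y; rewrite in_setD1 andb_idl // => yN.
apply: contra_notN wu => /eqP yv; apply: (branch_nbr Gacyclic uN wB).
by have [_] := nbrsP _ _ _ yN; rewrite yv adj_sym.
Qed.

Lemma rel_at_branch A v u w r : v \in A -> u \in nbrs A v ->
  w \in branch A v u -> (w = u -> r v = 1) ->
  rel_at (branch A v u) r w <-> rel_at A r w.
Proof.
move=> vA uN wB h; rewrite /rel_at (prod_nbrs_branch _ vA uN wB).
by case: eqP => [/h ->|_]; rewrite mulr1.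
Qed.

(** On a trivial branch the relation at the root only involves the value at [v].
    *)
Lemma triv_branch_root A v u r : v \in A -> u \in nbrs A v ->
  rel_at A r u -> trivial_on (branch A v u) r -> r v = 1.
Proof.
move=> vA uN ru /trivP t; have uB := root_in_branch A v u; move: ru.
rewrite /rel_at (prod_nbrs_branch _ vA uN uB) eqxx (t _ uB) exp1rz mul1r.
by rewrite big1 ?mul1r // => y /nbrsP[/t].
Qed.

Lemma triv_branches A v r : connected_set A -> v \in A -> r v = 1 ->
  (forall u, u \in nbrs A v -> trivial_on (branch A v u) r) -> trivial_on A r.
Proof.
move=> cA vA rv h; apply/trivP => w wA.
have [->//|wv] := eqVneq w v.
have [u /h/trivP t wu] := branch_exists cA vA wA wv; exact: t.
Qed.

Lemma nontriv_branch A v r : connected_set A -> v \in A -> r v = 1 -> ~~ trivial_on A r ->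
  exists2 u, u \in nbrs A v & ~~ trivial_on (branch A v u) r.
Proof.
move=> cA vA rv nt; apply: contrapT => h; move/negP: nt; apply.
by apply: (triv_branches cA vA rv) => u uN; apply/negPn/negP => tu; apply: h; exists u.
Qed.

(** The invariant of the rooted induction. The relation at the root is only a
    hypothesis of the last clause, because a labelling twisted by the powers of
    a point [c] does not satisfy it. *)
Definition ord_spec A v r := [/\ trivial_on A r -> vanord A r = - 2,
  ~~ trivial_on A r -> -1 <= vanord A r,
  ~~ trivial_on A r -> r v != 1 -> 0 <= vanord A r &
  ~~ trivial_on A r -> rel_at A r v -> 0 <= vanord A r].

(** In a product equal to [1], a single factor cannot differ from [1]. *)
Lemma rel_second A v u r : rel_at A r v -> r v = 1 -> u \in nbrs A v ->
  r u != 1 -> exists2 w, w \in nbrs A v & (w != u) && (r w != 1).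
Proof.
move=> rv r1 uN ru; apply: contrapT => h; move: rv; rewrite /rel_at r1 exp1rz mul1r.
rewrite (bigD1 u) //= big1 ?mulr1 => [/eqP|w /andP[wN wu]].
  by rewrite (negbTE ru).
by apply/eqP; apply: contrapT => /negP rw; apply: h; exists w; rewrite ?wu.
Qed.

Lemma nontriv_root A v u r : r u != 1 -> ~~ trivial_on (branch A v u) r.
Proof.
by apply: contraNN => /trivP ->; rewrite ?root_in_branch.
Qed.

Section BranchOrder.
Variables (A : {set G}) (v : G) (r : G -> C).
Hypotheses (cA : connected_set A) (vA : v \in A).
Hypothesis relA : forall w, w \in A -> w != v -> rel_at A r w.

(** When [r v = 1], the relation for [A] at the root [u] is a relation for the
    branch, so the last clause of [ord_spec] applies to the branch. *)
Lemma branch_ord_facts_aux u : u \in nbrs A v -> ord_spec (branch A v u) u r ->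
  [/\ trivial_on (branch A v u) r -> branch_ord A v u r = -1,
   ~~ trivial_on (branch A v u) r -> 0 <= branch_ord A v u r &
   ~~ trivial_on (branch A v u) r -> r v = 1 -> r u = 1 -> 1 <= branch_ord A v u r].
Proof.
move=> uN [h1 h2 h3 h4]; have uB := root_in_branch A v u; rewrite /branch_ord; split.
- by move=> t; rewrite h1 // ((trivP _ _ t) u uB) eqxx.
- move=> nt; have [ru|ru] := eqVneq (r u) 1.
    by have := h2 nt; lia.
  by rewrite addr0; exact: h3.
- move=> nt rv ->; rewrite eqxx; suff: 0 <= vanord (branch A v u) r by lia.
  apply: h4 => //; apply/(rel_at_branch vA uN uB) => //.
  by have [uA uv] := branch_mem uN uB; exact: relA.
Qed.

(** If [r v != 1], no branch is trivial and none contributes negatively. If [r v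
    = 1], a nontrivial branch raises the order from [-2] to at least [-1]; the
    relation at [v] then provides either one more unit from this branch, when [r
    u = 1], or a second nontrivial branch. *)
Lemma ord_spec_step : (forall u, u \in nbrs A v -> ord_spec (branch A v u) u r) ->
  ord_spec A v r.
Proof.
move=> IH; have F u (uN : u \in nbrs A v) := branch_ord_facts_aux uN (IH u uN).
have oc0 u : u \in nbrs A v -> 0 <= 1 + branch_ord A v u r.
  move=> uN; have [a b _] := F u uN.
  by have [/a->//|/b] := boolP (trivial_on (branch A v u) r); lia.
have rel_u u : u \in nbrs A v -> rel_at A r u.
  move=> uN; have /nbrsD1 := uN; rewrite in_setD1 => /andP[uv uA]; exact: relA.
have oc1 u : u \in nbrs A v -> ~~ trivial_on (branch A v u) r -> 1 <= 1 + branch_ord A v u r.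
  by move=> uN nt; have [_ b _] := F u uN; have := b nt; lia.
have H3 : r v != 1 -> 0 <= vanord A r.
  move=> rv; rewrite (vanord_branch _ cA vA) (negbTE rv) add0r.
  apply: sumr_ge0 => u uN; have [_ b _] := F u uN; apply: b.
  by apply: contra rv => t; apply/eqP; apply: triv_branch_root vA uN (rel_u u uN) t.
split.
- move=> /trivP t; have rv := t v vA; rewrite (vanord_branch1 cA vA rv) big1 // => u uN.
  have [a _ _] := F u uN; rewrite a //; apply/trivP => w wB.
  by have [wA _] := branch_mem uN wB; exact: t.
- move=> nt; have [rv|/H3] := eqVneq (r v) 1; last by lia.
  have [u uN ntu] := nontriv_branch cA vA rv nt.
  by have := vanord_ge1 cA vA rv oc0 uN; have := oc1 u uN ntu; lia.
- by move=> _; exact: H3.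
- move=> nt relv; have [rv|/H3//] := eqVneq (r v) 1.
  have [u uN ntu] := nontriv_branch cA vA rv nt.
  have [ru|ru] := eqVneq (r u) 1.
    have [_ _ c] := F u uN; have := c ntu rv ru.
    by have := vanord_ge1 cA vA rv oc0 uN; lia.
  have [w wN /andP[wu rw]] := rel_second relv rv uN ru.
  have := oc1 u uN ntu; have := oc1 w wN (nontriv_root A v rw).
  by have := vanord_ge2 cA vA rv oc0 wN uN wu; lia.
Qed.

End BranchOrder.

Lemma ord_facts r A v : connected_set A -> v \in A ->
  (forall w, w \in A -> w != v -> rel_at A r w) -> ord_spec A v r.
Proof.
move: A v; apply: rooted_ind => A v cA vA IH relA.
apply: (ord_spec_step cA vA relA) => u uN; apply: IH => // w wB wu.
have [wA wv] := branch_mem uN wB; apply/(rel_at_branch vA uN wB); last exact: relA.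
by move=> e; rewrite e eqxx in wu.
Qed.

Section Classify.
Variables (A : {set G}) (v : G) (r : G -> C).
Hypotheses (cA : connected_set A) (vA : v \in A).
Hypothesis relA : forall w, w \in A -> w != v -> rel_at A r w.

Lemma branch_ord_facts u : u \in nbrs A v ->
  [/\ trivial_on (branch A v u) r -> branch_ord A v u r = -1,
   ~~ trivial_on (branch A v u) r -> 0 <= branch_ord A v u r &
   ~~ trivial_on (branch A v u) r -> r v = 1 -> r u = 1 -> 1 <= branch_ord A v u r].
Proof.
move=> uN; apply: branch_ord_facts_aux => //; apply: ord_facts.
- exact: conn_branch.
- exact: root_in_branch.
move=> w wB wu; have [wA wv] := branch_mem uN wB.
apply/(rel_at_branch vA uN wB); last exact: relA.
by move=> e; rewrite e eqxx in wu.
Qed.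

Lemma branch_ord_ge u : u \in nbrs A v -> 0 <= 1 + branch_ord A v u r.
Proof.
move=> uN; have [a b _] := branch_ord_facts uN.
by have [/a->//|/b] := boolP (trivial_on (branch A v u) r); lia.
Qed.

Lemma rel_nbr u : u \in nbrs A v -> rel_at A r u.
Proof. by move=> /nbrsD1; rewrite in_setD1 => /andP[uv uA]; exact: relA. Qed.

(** The condition on the vertices [u_rho] in the formula for the torsion. *)
Definition admissible x := (r x != 1) || [exists w in nbrs A x, r w != 1].

(** If [r v != 1], the order is a sum of nonnegative contributions. If [r v =
    1], two branches are nontrivial, and together they already account for the
    whole order. *)
Lemma branch_ord_adm u : rel_at A r v -> vanord A r = 0 -> admissible v -> u \in nbrs A v ->
  ~~ trivial_on (branch A v u) r -> branch_ord A v u r = 0.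
Proof.
move=> relv o0 av uN nt; have [rv|rv] := eqVneq (r v) 1; last first.
  move: o0; rewrite (vanord_branch _ cA vA) (negbTE rv) add0r => /eqP.
  rewrite psumr_eq0 => [/allP /(_ u (mem_index_enum _))|w wN].
    by rewrite uN => /eqP.
  have [_ b _] := branch_ord_facts wN; apply: b; apply: contra rv => t; apply/eqP.
  exact: triv_branch_root vA wN (rel_nbr wN) t.
move: av; rewrite /admissible rv eqxx => /exists_inP[u0 u0N ru0].
have [u1 u1N /andP[u10 ru1]] := rel_second relv rv u0N ru0.
have [w wN /andP[wu ntw]] : exists2 w, w \in nbrs A v & (w != u) && ~~ trivial_on (branch A v w) r.
  have [e|ne] := eqVneq u0 u.
    by exists u1; rewrite // -e u10 nontriv_root.
  by exists u0; rewrite // ne nontriv_root.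
have [_ bw _] := branch_ord_facts wN; have {bw} := bw ntw.
have [_ bu _] := branch_ord_facts uN; have {bu} := bu nt.
by have := vanord_ge2 cA vA rv branch_ord_ge wN uN wu; lia.
Qed.

(** A trivial branch contributes [0] to the sum in [vanord_branch1]. *)
Lemma vanord_single u : r v = 1 -> u \in nbrs A v ->
  (forall w, w \in nbrs A v -> w != u -> trivial_on (branch A v w) r) ->
  vanord A r = branch_ord A v u r - 1.
Proof.
move=> rv uN tw; rewrite (vanord_branch1 cA vA rv) (bigD1 u) //= big1 => [|w].
  by rewrite addr0; lia.
move=> /andP[wN wu]; have [a _ _] := branch_ord_facts wN.
by rewrite a // tw.
Qed.

Lemma nonadm_nbr u : ~~ admissible v -> u \in nbrs A v -> r u = 1.
Proof.
rewrite /admissible negb_or => /andP[_ /exists_inPn h] /h.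
by rewrite negbK => /eqP.
Qed.

Lemma nonadm_root : ~~ admissible v -> r v = 1.
Proof. by rewrite /admissible negb_or negbK => /andP[/eqP]. Qed.

Lemma nonadm_two u w : ~~ admissible v -> u \in nbrs A v -> w \in nbrs A v ->
  u != w -> ~~ trivial_on (branch A v u) r -> ~~ trivial_on (branch A v w) r ->
  0 < vanord A r.
Proof.
move=> na uN wN uw ntu ntw; have rv := nonadm_root na.
have [_ _ cu] := branch_ord_facts uN; have {cu} := cu ntu rv (nonadm_nbr na uN).
have [_ _ cw] := branch_ord_facts wN; have {cw} := cw ntw rv (nonadm_nbr na wN).
by have := vanord_ge2 cA vA rv branch_ord_ge uN wN uw; lia.
Qed.

(** A pole of a nontrivial labelling is carried by a single branch; this is why
    the polar part of [H] splits into contributions of the branches. *)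
Lemma vanord_neg : ~~ trivial_on A r -> vanord A r < 0 ->
  r v = 1 /\ exists u, [/\ u \in nbrs A v, r u != 1 &
    forall w, w \in nbrs A v -> w != u -> trivial_on (branch A v w) r].
Proof.
move=> nt o; have [h1 h2 h3 h4] := ord_facts cA vA relA.
have rv : r v = 1 by apply: contraTeq o => rv; rewrite -leNgt; exact: h3.
split=> //; have [u uN ntu] := nontriv_branch cA vA rv nt.
have [_ bu cu] := branch_ord_facts uN; exists u; split=> //.
- apply: contraTneq o => ru; rewrite -leNgt.
  by have := cu ntu rv ru; have := vanord_ge1 cA vA rv branch_ord_ge uN; lia.
- move=> w wN wu; apply: contraTT o => ntw; rewrite -leNgt.
  have [_ bw _] := branch_ord_facts wN; have := bw ntw; have := bu ntu.
  by have := vanord_ge2 cA vA rv branch_ord_ge wN uN wu; lia.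
Qed.

End Classify.
End Orders.

(** * Leading coefficients at t = 1 *)

Section Leads.
Variables (C : numFieldType) (G : plumbing).
Implicit Types (A B : {set G}) (x y z u v w : G) (r : G -> C).
Hypothesis Gacyclic : acyclic_graph G.
Hypothesis Gneg : negative_definite G.

Definition lead_factor r w (a : nat) : C := if r w == 1 then a%:R else 1 - r w.
(** The leading coefficient at [t = 1], in powers of [1 - t], of the product
    described at [vanord]. *)
Definition lead A v r : C := \prod_(w in A) lead_factor r w (wt A w v) ^ dg A w.

Lemma lead_factor_neq0 r w a : (0 < a)%N -> lead_factor r w a != 0.
Proof.
rewrite /lead_factor => a0; have [_|rw] := eqVneq (r w) 1; first by rewrite pnatr_eq0 -lt0n.
by rewrite subr_eq0 eq_sym.
Qed.

Lemma natC_neq0 (n : nat) : (0 < n)%N -> (n%:R : C) != 0.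
Proof. by rewrite pnatr_eq0 lt0n. Qed.

Lemma dscC_neq0 A : ((dsc A)%:R : C) != 0.
Proof. by rewrite natC_neq0 ?dsc_gt0. Qed.

Lemma wtC_neq0 A x y : connected_set A -> x \in A -> y \in A -> ((wt A x y)%:R : C) != 0.
Proof. by move=> cA xA yA; rewrite natC_neq0 ?wt_gt0. Qed.

Lemma prod_expz (F : fieldType) (I : finType) (P : pred I) (c : F) (e : I -> int) : c != 0 ->
  \prod_(i | P i) c ^ e i = c ^ (\sum_(i | P i) e i).
Proof.
move=> c0; rewrite (big_morph (fun n => c ^ n) (id1 := 1) (op1 := *%R)) //.
by move=> m n; exact: expfzDr.
Qed.

Lemma prod_expz_if (F : fieldType) (I : finType) (P : pred I) (S : pred I) (c : F) (e : I -> int) :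
  c != 0 ->
  \prod_(i | P i) (if S i then c else 1) ^ e i =
  c ^ (\sum_(i | P i) if S i then e i else 0).
Proof.
move=> c0; rewrite -prod_expz //; apply: eq_bigr => i _.
by case: (S i); rewrite ?exp1rz ?expr0z.
Qed.

Lemma lead_factor_scale r w (a b : nat) (k : C) : a%:R = b%:R * k ->
  lead_factor r w a = lead_factor r w b * (if r w == 1 then k else 1).
Proof. by rewrite /lead_factor => ->; case: ifP; rewrite ?mulr1. Qed.

(** The factor between the exponents of a branch computed in [A] with root [v]
    and those computed in the branch with its own root. *)
Definition branch_ratio A v u : C := (wt A v v)%:R / (dsc (branch A v u))%:R.

Section Rec.
Variables (A : {set G}) (v : G) (r : G -> C).
Hypotheses (cA : connected_set A) (vA : v \in A).

Lemma branch_ratio_neq0 u : branch_ratio A v u != 0.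
Proof. by rewrite mulf_neq0 ?invr_eq0 ?dscC_neq0 ?wtC_neq0. Qed.

Lemma wt_branch_ratio u w : u \in nbrs A v -> w \in branch A v u ->
  (wt A w v)%:R = (wt (branch A v u) w u)%:R * branch_ratio A v u.
Proof.
move=> uN wB; have := wt_branch Gacyclic Gneg cA vA uN wB.
move/(congr1 (fun n : nat => (n%:R : C))); rewrite !natrM /branch_ratio => E.
by apply: (mulIf (dscC_neq0 (branch A v u))); rewrite E -!mulrA mulVf ?dscC_neq0 ?mulr1.
Qed.

(** Between the branch and [A], the exponents are scaled by [branch_ratio],
    which the order counts, and the degree of the root changes by one. *)
Lemma lead_part u : u \in nbrs A v ->
  \prod_(w in branch A v u) lead_factor r w (wt A w v) ^ dg A w =
  lead (branch A v u) u r * branch_ratio A v u ^ vanord (branch A v u) r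
    * lead_factor r u (wt A u v).
Proof.
move=> uN; set B := branch A v u; have uB : u \in B := root_in_branch A v u.
have cB := conn_branch uN.
have -> : \prod_(w in B) lead_factor r w (wt A w v) ^ dg A w =
  (\prod_(w in B) (lead_factor r w (wt B w u) ^ dg B w
     * (if r w == 1 then branch_ratio A v u else 1) ^ dg B w))
  * \prod_(w in B) (if w == u then lead_factor r w (wt A w v) else 1).
  rewrite -big_split; apply: eq_bigr => w wB /=.
  rewrite (dg_branch Gacyclic vA uN wB) expfzDr; last first.
    have [wA _] := branch_mem uN wB.
    by rewrite lead_factor_neq0 // wt_gt0.
  rewrite -expfzMl -(lead_factor_scale _ _ (wt_branch_ratio uN wB)).
  by case: eqP => [->|_]; rewrite ?expr1z ?expr0z.
rewrite big_split /= prod_expz_if ?branch_ratio_neq0 //; congr (_ * _).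
rewrite (bigD1 u) //= eqxx big1 ?mulr1 // => w /andP[_ wu].
by rewrite (negbTE wu).
Qed.

Lemma lead_rec : lead A v r = lead_factor r v (wt A v v) ^ dg A v *
  \prod_(u in nbrs A v) (lead (branch A v u) u r
     * branch_ratio A v u ^ vanord (branch A v u) r * lead_factor r u (wt A u v)).
Proof.
rewrite /lead (big_branch Gacyclic _ _ cA vA) /=; congr (_ * _).
by apply: eq_bigr => u; exact: lead_part.
Qed.

Lemma prod_branch_ratio : \prod_(u in nbrs A v) (branch_ratio A v u)^-1 =
  (wt A v v)%:R * (wt A v v)%:R ^- #|nbrs A v|.
Proof.
rewrite /branch_ratio; under eq_bigr do rewrite invf_div.
rewrite big_split /= prodr_const -natr_prod -wt_root // exprVn //.
Qed.

End Rec.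

Lemma vanord_triv A v r : connected_set A -> v \in A -> trivial_on A r -> vanord A r = -2.
Proof.
move=> cA vA t; have rl w : w \in A -> w != v -> rel_at A r w.
  move=> wA _; rewrite /rel_at (trivP _ _ t _ wA) exp1rz mul1r big1 // => u.
  by case/nbrsP => uA _; exact: (trivP _ _ t).
by have [h _ _ _] := ord_facts Gacyclic cA vA rl; exact: h.
Qed.

(** By [wt_root] and [prod_branch_ratio], the recursion telescopes. *)
Lemma lead_triv A v r : connected_set A -> v \in A -> trivial_on A r ->
  lead A v r = (wt A v v)%:R^-1.
Proof.
move=> cA vA; move: A v cA vA; apply: rooted_ind => A v cA vA IH t.
rewrite lead_rec // /lead_factor ((trivP _ _ t) v vA) eqxx.
under eq_bigr => u uN.
  have tB : trivial_on (branch A v u) r.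
    by apply/trivP => w wB; have [wA _] := branch_mem uN wB; exact: (trivP _ _ t).
  have uB := root_in_branch A v u; have cB := conn_branch uN.
  rewrite IH // (vanord_triv cB uB tB) (trivP _ _ tB _ uB) eqxx (wt_branch_ratio cA vA uN uB).
  rewrite (_ : _ * _ * _ = (branch_ratio A v u)^-1); first over.
  have w0 := wtC_neq0 cB uB uB.
  rewrite -exprnN; field; by rewrite w0 branch_ratio_neq0.
rewrite prod_branch_ratio // /dg; have W0 := wtC_neq0 cA vA vA.
rewrite expfzDr // -exprnN -exprnP; field.
by rewrite W0 expf_neq0.
Qed.

(** The trivial branches telescope with the factor at [v] as in [lead_triv]; the
    determinant of the remaining branch is what is missing. *)
Lemma lead_single A v u r : connected_set A -> v \in A -> r v = 1 -> u \in nbrs A v ->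
  (forall w, w \in nbrs A v -> w != u -> trivial_on (branch A v w) r) ->
  vanord (branch A v u) r = 0 ->
  lead A v r = lead (branch A v u) u r * lead_factor r u (wt A u v)
                 / (dsc (branch A v u))%:R.
Proof.
move=> cA vA rv uN tw o0; rewrite lead_rec // {1}/lead_factor rv eqxx (bigD1 u) //=.
rewrite o0 expr0z mulr1.
under [X in _ * (_ * X)]eq_bigr => w /andP[wN wu].
  have tB := tw w wN wu.
  have wB := root_in_branch A v w; have cB := conn_branch wN.
  rewrite lead_triv // (vanord_triv cB wB tB) /lead_factor (trivP _ _ tB _ wB) eqxx (wt_branch_ratio cA vA wN wB).
  rewrite (_ : _ * _ * _ = (branch_ratio A v w)^-1); first over.
  have w0 := wtC_neq0 cB wB wB.
  rewrite -exprnN; field; by rewrite w0 branch_ratio_neq0.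
have := prod_branch_ratio cA vA; rewrite (bigD1 u) //=.
set K := \prod_(i | _) _; set k := branch_ratio A v u.
have k0 : k != 0 by exact: branch_ratio_neq0.
move=> KE; rewrite (canRL (mulVKf k0) KE).
have W0 := wtC_neq0 cA vA vA; have d0 := dscC_neq0 (branch A v u).
rewrite /k /branch_ratio /dg expfzDr // -exprnN -exprnP; field.
by rewrite W0 d0 expf_neq0.
Qed.

Lemma branch_ratio_reroot A v u w : connected_set A -> v \in A -> u \in nbrs A v ->
  w \in nbrs (branch A v u) u ->
  branch_ratio A u w = branch_ratio (branch A v u) u w
    * ((wt A u u)%:R / (wt (branch A v u) u u)%:R).
Proof.
move=> cA vA uN wN; have uB := root_in_branch A v u; have cB := conn_branch uN.
rewrite /branch_ratio branch_branch //.
have w0 := wtC_neq0 cB uB uB; have d0 := dscC_neq0 (branch A u w).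
by field; rewrite d0 w0.
Qed.

Lemma nbrs_back A v u w : v \in A -> u \in nbrs A v ->
  (w \in nbrs A u) && (w != v) = (w \in nbrs (branch A v u) u).
Proof.
move=> vA uN; rewrite (nbrs_branch uN (root_in_branch A v u)) in_setD1.
by rewrite andbC.
Qed.

(** The branches at [u] away from [v] are the same for [A] and for [branch A v
    u], with proportional exponents; since the order is [0], the proportionality
    factor only survives at [u] and combines with the trivial branch. *)
Lemma lead_shift A v u r : connected_set A -> v \in A -> u \in nbrs A v -> r u = 1 ->
  trivial_on (branch A u v) r -> vanord (branch A v u) r = 0 ->
  lead A u r = (dsc (branch A u v))%:R * lead (branch A v u) u r.
Proof.
move=> cA vA uN ru tB' o0; set B := branch A v u; set B' := branch A u v.
have uB : u \in B := root_in_branch A v u; have cB : connected_set B := conn_branch uN.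
have [uA _] := branch_mem uN uB; have vN := nbr_back vA uN.
have vB' : v \in B' := root_in_branch A u v; have cB' : connected_set B' := conn_branch vN.
rewrite (lead_rec r cA uA) (bigD1 v) //=.
rewrite (lead_triv cB' vB' tB') (vanord_triv cB' vB' tB').
rewrite [lead_factor r v _]/lead_factor (trivP _ _ tB' _ vB') eqxx (wt_branch_ratio cA uA vN vB').
rewrite (lead_rec r cB uB) [lead_factor r u _]/lead_factor [lead_factor r u (wt B _ _)]/lead_factor ru eqxx.
rewrite (dg_branch Gacyclic vA uN uB) eqxx.
set k : C := (wt A u u)%:R / (wt B u u)%:R.
have WB := wtC_neq0 cB uB uB; have WA := wtC_neq0 cA uA uA.
have k0 : k != 0 by rewrite mulf_neq0 ?invr_neq0.
rewrite (eq_bigl (fun w => w \in nbrs B u)); last first.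
  by move=> w; rewrite nbrs_back.
have E w : w \in nbrs B u -> lead (branch A u w) w r
   * branch_ratio A u w ^ vanord (branch A u w) r * lead_factor r w (wt A w u) =
   lead (branch B u w) w r * branch_ratio B u w ^ vanord (branch B u w) r
     * lead_factor r w (wt B w u) * k ^ branch_ord B u w r.
  move=> wN; have wNA : w \in nbrs A u by move: wN; rewrite -nbrs_back // => /andP[].
  have wb := root_in_branch A u w.
  have kr := branch_ratio_reroot cA vA uN wN; rewrite -/B -/k in kr.
  have kw : (wt A w u)%:R = (wt B w u)%:R * k :> C.
    by rewrite (wt_branch_ratio cA uA wNA wb) kr mulrA (wt_branch_ratio cB uB wN) // branch_branch.
  rewrite (lead_factor_scale _ _ kw) kr branch_branch // /branch_ord branch_branch // expfzMl expfzDr //.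
  by case: (r w == 1); rewrite ?expr1z ?expr0z; ring.
under eq_bigr => w wN do rewrite E //.
rewrite big_split /= prod_expz //.
have := vanord_branch Gacyclic r cB uB; rewrite o0 ru eqxx => oE.
have -> : \sum_(w in nbrs B u) branch_ord B u w r = - dg B u.
  by apply/eqP; rewrite -addr_eq0 addrC -[X in X == _]oE.
rewrite expfzDr // expr1z -exprnN -[k ^ - _]exprz_inv invf_div.
set P := \prod_(i in _) _.
have -> : ((wt B u u)%:R / (wt A u u)%:R) ^ dg B u =
   ((wt B u u)%:R ^ dg B u : C) / (wt A u u)%:R ^ dg B u.
  by rewrite expfzMl expfV.
have Wn := expfz_neq0 (dg B u) WA.
have wB' := wtC_neq0 cB' vB' vB'; have d' := dscC_neq0 B'.
have dB := dscC_neq0 B.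
by rewrite /branch_ratio -/B'; field; rewrite wB' Wn WA d'.
Qed.

End Leads.

(** * Dependence of the limits on the vertex *)

Section Limits.
Variables (C : numFieldType) (G : plumbing).
Implicit Types (A B : {set G}) (x y z u v w : G) (r : G -> C).
Hypothesis Gacyclic : acyclic_graph G.
Hypothesis Gneg : negative_definite G.

(** [u] separates the branch from [v], so at [u] the Schur complement reduces to
    its rank-one term. *)
Lemma wt_sep A v u w : connected_set A -> v \in A -> u \in nbrs A v ->
  w \in branch A v u -> (wt A w v * wt A u u = wt A w u * wt A u v)%N.
Proof.
move=> cA vA uN wB; have [wA wv] := branch_mem uN wB.
have [uA uv] := branch_mem uN (root_in_branch A v u).
apply/eqP; rewrite -(eqr_nat rat) !natrM !wtE //; apply/eqP.
rewrite [in LHS](green_schur Gacyclic Gneg w v cA uA) big1 => [|y yN].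
  by rewrite add0r; field; rewrite gt_eqF ?green_gt0.
have vN := nbr_back vA uN.
have [vy|vy] := boolP (v \in branch A u y); last by rewrite green_offr.
have := branch_root_uniq Gacyclic yN vN vy => <-.
by rewrite green_offl // branch_back // in_setD wB.
Qed.

(** By [wt_sep] the exponents for the roots [v] and [u] are proportional, and
    the order [0] makes the factor cancel. *)
Lemma lead_side A v u r : connected_set A -> v \in A -> u \in nbrs A v ->
  branch_ord A v u r = 0 ->
  \prod_(w in branch A v u) lead_factor r w (wt A w v) ^ dg A w =
  \prod_(w in branch A v u) lead_factor r w (wt A w u) ^ dg A w.
Proof.
move=> cA vA uN o0; have [uA uv] := branch_mem uN (root_in_branch A v u).
pose q : C := (wt A u v)%:R / (wt A u u)%:R.
have wuu := wtC_neq0 C Gacyclic Gneg cA uA uA.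
have wuv := wtC_neq0 C Gacyclic Gneg cA uA vA.
have q0 : q != 0 by rewrite mulf_neq0 ?invr_neq0.
have E w : w \in branch A v u -> lead_factor r w (wt A w v) ^ dg A w =
    lead_factor r w (wt A w u) ^ dg A w * (if r w == 1 then q else 1) ^ dg A w.
  move=> wB; rewrite -expfzMl -(@lead_factor_scale _ _ r w (wt A w v)) // /q mulrA.
  by apply: (mulIf wuu); rewrite divfK // -!natrM (wt_sep cA vA uN wB).
rewrite (eq_bigr _ E) big_split /= prod_expz_if //.
by rewrite -(branch_ordE Gacyclic r vA uN) o0 expr0z mulr1.
Qed.

Lemma split_branch (R : Type) (idx : R) (op : Monoid.com_law idx) A v u
    (F : G -> R) : connected_set A -> v \in A -> u \in nbrs A v ->
  \big[op/idx]_(w in A) F w = op (\big[op/idx]_(w in branch A v u) F w)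
    (\big[op/idx]_(w in branch A u v) F w).
Proof.
move=> cA vA uN; rewrite (bigID (mem (branch A v u))) /=; congr (op _ _).
  apply: eq_bigl => w; apply: andb_idl => wB; by have [] := branch_mem uN wB.
by apply: eq_bigl => w; rewrite (branch_back Gacyclic cA vA uN) in_setD andbC.
Qed.

(** If the whole and one side of an edge have order [0], so has the other side.
    *)
Lemma lead_step A v u r : connected_set A -> v \in A -> u \in nbrs A v ->
  vanord A r = 0 -> branch_ord A v u r = 0 -> lead A u r = lead A v r.
Proof.
move=> cA vA uN o0 ou; have uA := (nbrsP _ _ _ uN).1; have vN := nbr_back vA uN.
have ov : branch_ord A u v r = 0.
  move: o0; rewrite /vanord (split_branch _ _ cA vA uN) /=.
  by rewrite -!(branch_ordE Gacyclic) // ou add0r.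
rewrite /lead !(split_branch _ _ cA vA uN) /=.
by rewrite (lead_side cA vA uN ou) (lead_side cA uA vN ov).
Qed.

Section Rels.
Variables (A : {set G}) (r : G -> C).
Hypotheses (cA : connected_set A) (relA : forall w, w \in A -> rel_at A r w).

Lemma adm_branch v u x : v \in A -> u \in nbrs A v -> x \in branch A v u ->
  r v = 1 -> admissible A r x = admissible (branch A v u) r x.
Proof.
move=> vA uN xB rv; rewrite /admissible (nbrs_branch uN xB); congr (_ || _).
apply/exists_inP/exists_inP => -[w wN rw]; exists w => //.
  by rewrite in_setD1 wN andbT; apply: contraNneq rw => ->; rewrite rv.
by move: wN; rewrite in_setD1 => /andP[].
Qed.

(** The relation at the root makes [r] trivial also at [v], the only neighbour
    outside the branch. *)
Lemma triv_nonadm v u x : v \in A -> u \in nbrs A v -> x \in branch A v u ->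
  trivial_on (branch A v u) r -> ~~ admissible A r x.
Proof.
move=> vA uN xB t; have uA := (nbrsP _ _ _ uN).1.
have rv := triv_branch_root Gacyclic vA uN (relA uA) t.
rewrite (adm_branch vA uN xB rv) /admissible negb_or negbK (trivP _ _ t _ xB) eqxx /=.
by apply/exists_inPn => w /nbrsP[wB _]; rewrite (trivP _ _ t _ wB) eqxx.
Qed.

(** Walking from one admissible vertex to the other, [branch_ord_adm] supplies
    the hypotheses of [lead_step] for each edge, and each vertex met on the way
    is again admissible. *)
Lemma lead_adm v x : v \in A -> x \in A -> vanord A r = 0 ->
  admissible A r v -> admissible A r x -> lead A x r = lead A v r.
Proof.
move=> + xA o0 + ax; have [->//|] := eqVneq x v.
suff H n u w : (#|branch A w u| < n)%N -> w \in A -> u \in nbrs A w ->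
    x \in branch A w u -> admissible A r w -> lead A x r = lead A w r.
  move=> xv vA av; have [u uN xu] := branch_exists cA vA xA xv.
  exact: (H _ u v (ltnSn _)).
elim: n u w => // n IH u w; rewrite ltnS => le wA uN xu aw.
have uA := (nbrsP _ _ _ uN).1; have uB := root_in_branch A w u.
have relw y : y \in A -> y != w -> rel_at A r y by move=> yA _; exact: relA.
have relu y : y \in A -> y != u -> rel_at A r y by move=> yA _; exact: relA.
have nt : ~~ trivial_on (branch A w u) r.
  by apply: contraL ax => t; exact: triv_nonadm wA uN xu t.
have ou := branch_ord_adm Gacyclic cA wA relw (relA wA) o0 aw uN nt.
have au : admissible A r u.
  have [ru|ru] := eqVneq (r u) 1; last by rewrite /admissible ru.
  have [rw|rw] := eqVneq (r w) 1; last first.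
    by apply/orP; right; apply/exists_inP; exists w => //; exact: nbr_back.
  have [_ _ c] := branch_ord_facts Gacyclic wA relw uN.
  by have := c nt rw ru; rewrite ou.
rewrite -(lead_step cA wA uN o0 ou).
have [->//|xu'] := eqVneq x u.
have [y yN xy] := branch_exists (conn_branch uN) uB xu xu'.
have yNA : y \in nbrs A u by move: yN; rewrite nbrs_branch // in_setD1 => /andP[].
rewrite branch_branch // in xy.
apply: (IH y u) => //; apply: leq_trans le.
by rewrite -(branch_branch Gacyclic uN yN) branch_proper.
Qed.

End Rels.

(** For a character carried by one branch, the limit for [A] at an admissible
    vertex is the limit at [v] plus the suitably normalised limit for the
    branch. [lead_single], [lead_shift] and [disc_split] give this at the root
    [u]. If [u] is not admissible, the situation recurs at a neighbour of [u],
    both in [A] and in the branch, and the two instances combine. *)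
Lemma lead_limit A v u x r : connected_set A -> v \in A ->
  (forall w, w \in A -> rel_at A r w) -> u \in nbrs A v -> r u = 1 ->
  trivial_on (branch A u v) r -> vanord (branch A v u) r = 0 ->
  x \in branch A v u -> admissible A r x ->
  (dsc (branch A v u))%:R * lead A x r =
  (dsc (branch A v u))%:R * lead A v r + (dsc A)%:R * lead (branch A v u) x r.
Proof.
suff H n : forall A v u, (#|branch A v u| < n)%N -> connected_set A -> v \in A ->
  (forall w, w \in A -> rel_at A r w) -> u \in nbrs A v -> r u = 1 ->
  trivial_on (branch A u v) r -> vanord (branch A v u) r = 0 ->
  x \in branch A v u -> admissible A r x ->
  (dsc (branch A v u))%:R * lead A x r =
  (dsc (branch A v u))%:R * lead A v r + (dsc A)%:R * lead (branch A v u) x r.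
  exact: (H _ A v u (ltnSn _)).
elim: n => // n IH {}A {}v {}u; rewrite ltnS => le cA vA relA uN ru tB' oB xB ax.
set B := branch A v u; set B' := branch A u v.
have uB : u \in B := root_in_branch A v u; have cB : connected_set B := conn_branch uN.
have [uA uv] := branch_mem uN uB; have vN := nbr_back vA uN.
have vB' : v \in B' := root_in_branch A u v; have cB' : connected_set B' := conn_branch vN.
have rv : r v = 1 := trivP _ _ tB' _ vB'.
have oA : vanord A r = 0.
  rewrite /vanord (split_branch _ _ cA vA uN) /= -!(branch_ordE Gacyclic) // /branch_ord.
  by rewrite oB ru (vanord_triv Gacyclic cB' vB' tB') rv eqxx.
have relB w : w \in B -> rel_at B r w.
  move=> wB; have [wA _] := branch_mem uN wB.
  by apply/(rel_at_branch Gacyclic vA uN wB) => //; exact: relA.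
have relu y : y \in A -> y != u -> rel_at A r y by move=> yA _; exact: relA.
have dB := dscC_neq0 C Gneg B.
have oth w : w \in nbrs A v -> w != u -> trivial_on (branch A v w) r.
  move=> wN wu; apply/trivP => z zw; apply: (trivP _ _ tB').
  have [zA _] := branch_mem wN zw; rewrite /B' branch_back // in_setD zA andbT.
  by apply: contra wu => zB; apply/eqP; exact: branch_uniq uN wN zB zw.
have Lv := lead_single Gacyclic Gneg cA vA rv uN oth oB.
have Lu := lead_shift Gacyclic Gneg cA vA uN ru tB' oB.
rewrite /lead_factor ru eqxx in Lv; rewrite -/B -/B' in Lv Lu *.
have spl := dsc_split Gacyclic Gneg cA vA uN; rewrite -/B -/B' in spl.
have {}spl : (dsc B)%:R * (dsc B')%:R = (dsc A)%:R + (wt A u v)%:R :> C.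
  by rewrite -natrM spl natrD.
(* The comparison at the root [u], admissible or not. *)
have step : (dsc B)%:R * lead A u r =
            (dsc B)%:R * lead A v r + (dsc A)%:R * lead B u r.
  rewrite Lv Lu mulrA spl; by field.
have axB : admissible B r x by rewrite -(adm_branch vA uN xB rv).
have [au|nau] := boolP (admissible A r u).
  rewrite (lead_adm cA relA uA (branch_mem uN xB).1 oA au ax).
  by rewrite (lead_adm cB relB uB xB oB) // -(adm_branch vA uN uB rv).
(* Here [u] is not admissible: exactly one branch at [u] is nontrivial, and the
   induction hypothesis is applied to it inside [A] and inside [B]. *)
have xu : x != u by apply: contraNneq nau => <-.
have [y yN xy] := branch_exists cB uB xB xu.
have yNA : y \in nbrs A u by move: yN; rewrite nbrs_branch // in_setD1 => /andP[].
rewrite branch_branch // in xy.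
have yE := root_in_branch A u y.
have ntE : ~~ trivial_on (branch A u y) r.
  by apply: contraL ax => t; exact: (triv_nonadm relA uA yNA xy t).
have ry := nonadm_nbr nau yNA.
have othu w : w \in nbrs A u -> w != y -> trivial_on (branch A u w) r.
  move=> wN wy; apply: contraTT isT => ntw.
  have := nonadm_two Gacyclic cA uA relu nau wN yNA wy ntw ntE.
  by rewrite oA ltxx.
have oE : vanord (branch A u y) r = 0.
  have := vanord_single Gacyclic cA uA relu ru yNA othu; rewrite oA /branch_ord ry eqxx.
  by rewrite addrK => <-.
have tE : trivial_on (branch A y u) r.
  apply/trivP => z; rewrite branch_back // in_setD => /andP[zE zA].
  have [->//|zu] := eqVneq z u.
  have [w wN zw] := branch_exists cA uA zA zu.
  have wy : w != y by apply: contraNneq zE => <-.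
  exact: (trivP _ _ (othu w wN wy)).
have leE : (#|branch A u y| < n)%N.
  apply: leq_trans le; rewrite -(branch_branch Gacyclic uN yN).
  exact: branch_proper.
have I1 := IH A u y leE cA uA relA yNA ry tE oE xy ax.
have EB := branch_branch Gacyclic uN yN.
have I2 := IH B u y; rewrite EB in I2.
have {}I2 := I2 leE cB uB relB yN ry.
have tEB : trivial_on (branch B y u) r.
  apply/trivP => z; rewrite branch_back // in_setD EB => /andP[zE zB].
  apply: (trivP _ _ tE); rewrite branch_back // in_setD zE.
  by case: (branch_mem uN zB).
have {}I2 := I2 tEB oE xy axB.
have dE := dscC_neq0 C Gneg (branch A u y).
apply: (mulfI dE).
rewrite mulrCA I1 mulrDr mulrCA step.
have -> : lead B u r = ((dsc (branch A u y))%:R * lead B x r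
   - (dsc B)%:R * lead (branch A u y) x r) / (dsc (branch A u y))%:R.
  by rewrite I2 addrK mulrC mulKf.
by field.
Qed.

End Limits.

(** * Second order expansions *)

Section Jets.
Variables (K : fieldType) (O : K -> Prop) (ep : K).
Hypothesis O1 : O 1.
Hypothesis OD : forall x y, O x -> O y -> O (x + y).
Hypothesis OM : forall x y, O x -> O y -> O (x * y).
Hypothesis ON : forall x, O x -> O (- x).
Hypothesis Oep : O ep.
Hypothesis ep0 : ep != 0.
Hypothesis Oinv : forall h, O h -> 1 + ep * h != 0 /\ O (1 + ep * h)^-1.
Hypothesis K0 : forall n, (n.+1)%:R != 0 :> K.
Hypothesis Onat : forall n, O (n.+1%:R)^-1.

Lemma O_nat n : O n%:R.
Proof.
elim: n => [|n IH]; last by rewrite -natr1; exact: OD.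
by rewrite mulr0n -(subrr 1); apply: OD => //; exact: ON.
Qed.

Lemma O_exp x n : O x -> O (x ^+ n).
Proof. by move=> Ox; elim: n => [|n IH]; rewrite ?exprS //; exact: OM. Qed.

Lemma O_int (z : int) : O z%:~R.
Proof. by case: z => n; [exact: O_nat | rewrite NegzE intrN; apply: ON; exact: O_nat]. Qed.

Ltac Osub := repeat first
  [ assumption | exact: O1 | exact: Oep | exact: O_nat | exact: O_int | exact: Onat
  | apply: OD | apply: ON | apply: O_exp | apply: OM ].

(** Here [O] is the local ring at a point and [ep] a uniformizer: up to [ep^3],
    [f] is [m exp (b ep + d ep^2)]. Recording the logarithm makes [b] and [d]
    additive in products. *)
Definition jet f m b d : Prop :=
  [/\ O m, O b, O d & exists2 h, O h &
   f = m * (1 + b * ep + (d + b ^+ 2 / 2) * ep ^+ 2) + ep ^+ 3 * h].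

Lemma jet_eq f m b d m' b' d' : jet f m b d -> m = m' -> b = b' -> d = d' ->
  jet f m' b' d'.
Proof. by move=> + <- <- <-. Qed.

Lemma jetM f g m b d m' b' d' : jet f m b d -> jet g m' b' d' ->
  jet (f * g) (m * m') (b + b') (d + d').
Proof.
case=> Om Ob Od [h Oh fE] [Om' Ob' Od' [h' Oh' gE]]; split; Osub.
pose q := d + b ^+ 2 / 2; pose q' := d' + b' ^+ 2 / 2.
(* The terms of degree at least three in the product of the expansions. *)
exists (m * m' * (b * q' + b' * q + q * q' * ep)
  + m * (1 + b * ep + q * ep ^+ 2) * h' + m' * (1 + b' * ep + q' * ep ^+ 2) * h
  + ep ^+ 3 * h * h'); first by rewrite /q /q'; Osub.
rewrite fE gE /q /q'; field; exact: (K0 1).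
Qed.

Lemma jetV f m b d : m != 0 -> O m^-1 -> jet f m b d ->
  jet f^-1 m^-1 (- b) (- d).
Proof.
move=> m0 Om' jf; have [Om Ob Od [h Oh fE]] := jf.
set g := m^-1 * (1 + (- b) * ep + ((- d) + (- b) ^+ 2 / 2) * ep ^+ 2).
have jg : jet g m^-1 (- b) (- d).
  split; Osub; exists 0; last by rewrite mulr0 addr0.
  exact: (O_nat 0).
have [_ _ _ [h' Oh' E]] := jetM jf jg.
have {}E : f * g = 1 + ep ^+ 3 * h'.
  rewrite E divff // !subrr; by field; exact: (K0 1).
(* [f] is [m] times a unit of the form handled by the hypothesis on [O]. *)
have fu : f = m * (1 + ep * (b + (d + b ^+ 2 / 2) * ep + ep ^+ 2 * h / m)).
  by rewrite fE; field; rewrite m0 (K0 1).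
have [u0 Ou] : 1 + ep * (b + (d + b ^+ 2 / 2) * ep + ep ^+ 2 * h / m) != 0
    /\ O (1 + ep * (b + (d + b ^+ 2 / 2) * ep + ep ^+ 2 * h / m))^-1.
  by apply: Oinv; Osub.
have f0 : f != 0 by rewrite fu mulf_neq0.
have Of : O f^-1 by rewrite fu invfM; Osub.
split; Osub; exists (- (f^-1 * h')); first by Osub.
rewrite -/g mulrN mulrCA; apply: (mulfI f0); rewrite divff // mulrBr E.
by field.
Qed.

Lemma jet1 : jet 1 1 0 0.
Proof.
have OO := O_nat 0; split=> //; exists 0 => //.
by rewrite expr0n /=; ring.
Qed.

Lemma jetX f m b d n : jet f m b d -> jet (f ^+ n) (m ^+ n) (n%:R * b) (n%:R * d).
Proof.
move=> jf; elim: n => [|n IH]; first by rewrite !expr0 !mul0r; exact: jet1.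
rewrite !exprS -natr1; apply: jet_eq (jetM jf IH) _ _ _ => //; ring.
Qed.

Lemma jetXz f m b d (e : int) : m != 0 -> O m^-1 -> jet f m b d ->
  jet (f ^ e) (m ^ e) (e%:~R * b) (e%:~R * d).
Proof.
move=> m0 Om jf; case: e => n; first exact: jetX.
rewrite NegzE -!exprnN !intrN !mulNr; apply: jetV (jetX _ jf).
  by rewrite expf_neq0.
by rewrite -exprVn; Osub.
Qed.

Lemma jet_prod (I : finType) (P : pred I) (f m b d : I -> K) :
  (forall i, P i -> jet (f i) (m i) (b i) (d i)) ->
  jet (\prod_(i | P i) f i) (\prod_(i | P i) m i) (\sum_(i | P i) b i)
      (\sum_(i | P i) d i).
Proof.
move=> H; elim: (index_enum I) => [|i s IH]; first by rewrite !big_nil; exact: jet1.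
rewrite !big_cons; case: ifP => // Pi; exact: jetM (H i Pi) IH.
Qed.

Let y := 1 - ep.

Lemma jet_y n : jet (y ^+ n) 1 (- n%:R) (- (n%:R / 2)).
Proof.
have OO := O_nat 0; have j : jet y 1 (-1) (- 2^-1).
  have := Onat 1; split; Osub; exists 0 => //.
  by rewrite /y; field; exact: (K0 1).
apply: jet_eq (jetX n j) _ _ _; rewrite ?expr1n //; ring.
Qed.

(** The quotient of [1 - y^a] by [1 - y], see [geoE]. *)
Definition geo a := \sum_(k < a) y ^+ k.

Lemma geoE a : 1 - y ^+ a = ep * geo a.
Proof.
by rewrite -[1](expr1n _ a) subrXX /y opprB addrC subrK; congr (_ * _);
   apply: eq_bigr => i _; rewrite expr1n mul1r.
Qed.

(** Sum the expansions of [(1 - ep)^k] over [k < a]; the second logarithmic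
    coefficient is then [(a - 1) (a - 2) / 6 - (a - 1)^2 / 8]. *)
Lemma jet_geo a : (0 < a)%N -> jet (geo a) a%:R (- ((a%:R - 1) / 2))
  ((a%:R - 1) * (a%:R - 5) / 24).
Proof.
have O2 := Onat 1; have O24 := Onat 23; have O6 := Onat 5.
have OO := O_nat 0.
move=> a0; split; Osub.
have [h Oh ->] : exists2 h, O h & geo a = a%:R - a%:R * (a%:R - 1) / 2 * ep
    + a%:R * (a%:R - 1) * (a%:R - 2) / 6 * ep ^+ 2 + ep ^+ 3 * h.
  elim: a {a0} => [|a [h Oh IH]].
    by exists 0 => //; rewrite /geo big_ord0; ring.
  rewrite /geo big_ord_recr /= -/(geo a) IH.
  have [_ _ _ [h' Oh' ->]] := jet_y a.
  exists (h + h'); first by Osub.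
  by rewrite -natr1; field; rewrite (K0 1) (K0 5).
by exists h => //; field; rewrite (K0 1) (K0 5) (K0 23).
Qed.

(** The contribution of the trivial character. The subtracted fraction has the
    same double pole as the product, and the constant term left is read off the
    logarithmic expansions: the squares of the exponents come from the second
    coefficients in [jet_geo], the square of [al + d - 2 n] from the [b^2 / 2]
    in [jet]. *)
Lemma jet_constant_term (I : finType) (P : pred I) (a : I -> nat) (e : I -> int)
    (A d n : nat) :
  (forall i, P i -> 0 < a i)%N -> (0 < d)%N -> (0 < A)%N ->
  \sum_(i | P i) e i = -2 ->
  \prod_(i | P i) ((a i)%:R : K) ^ e i = A%:R^-1 ->
  let al : K := \sum_(i | P i) (e i)%:~R * (a i)%:R in
  let be : K := \sum_(i | P i) (e i)%:~R * (a i)%:R ^+ 2 in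
  exists2 h, O h &
   d%:R^-1 * \prod_(i | P i) (1 - y ^+ a i) ^ e i
   - A%:R^-1 * (y ^+ n / (1 - y ^+ d) * (n%:R - al / 2 + d%:R * y ^+ d / (1 - y ^+ d)))
   = (d%:R * A%:R)^-1 * ((be - d%:R ^+ 2) / 24 + (al + d%:R - 2 * n%:R) ^+ 2 / 8)
     + ep * h.
Proof.
have O2 := Onat 1; have O24 := Onat 23; have O6 := Onat 5.
move=> apos dpos Apos se pa al be.
have natK (k : nat) : (0 < k)%N -> (k%:R : K) != 0 by case: k => // k _; exact: K0.
have natV (k : nat) : (0 < k)%N -> O (k%:R)^-1 by case: k => // k _; exact: Onat.
have d0 := natK d dpos; have A0 := natK A Apos; have Od := natV d dpos; have OA := natV A Apos.
have n2 : (2 : K) != 0 := K0 1.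
have n8 : (8 : K) != 0 := K0 7.
have n24 : (24 : K) != 0 := K0 23.
pose M := \prod_(i | P i) geo (a i) ^ e i.
have jM : jet M A%:R^-1 (- ((al + 2) / 2)) ((be - 6 * al - 10) / 24).
  apply: jet_eq (jet_prod (fun i Pi => jetXz (e i) (natK _ (apos i Pi))
     (natV _ (apos i Pi)) (jet_geo (apos i Pi)))) _ _ _ => //.
    have -> : \sum_(i | P i) (e i)%:~R * (- (((a i)%:R - 1) / 2)) =
      \sum_(i | P i) (- (((e i)%:~R * (a i)%:R) / 2) + (e i)%:~R / 2 : K).
      by apply: eq_bigr => i _; ring.
    rewrite big_split /= sumrN -!mulr_suml -/al -(rmorph_sum (intr : int -> K)) /= se.
    by field.
  have -> : \sum_(i | P i) (e i)%:~R * (((a i)%:R - 1) * ((a i)%:R - 5) / 24) =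
    \sum_(i | P i) ((e i)%:~R * (a i)%:R ^+ 2 / 24
       + ((e i)%:~R * (a i)%:R * (- (6 / 24)) + (e i)%:~R * (5 / 24)) : K).
    by apply: eq_bigr => i _; field.
  rewrite !big_split /= -!mulr_suml -/al -/be -(rmorph_sum (intr : int -> K)) /= se.
  by field.
have PE : \prod_(i | P i) (1 - y ^+ a i) ^ e i = ep ^- 2 * M.
  under eq_bigr do rewrite geoE expfzMl.
  rewrite big_split /=; congr (_ * _).
  rewrite -(big_morph (fun n => ep ^ n) (fun m n => expfzDr m n ep0) (expr0z ep)).
  by rewrite se.
have Oal : O al by apply: big_ind => [|x x'|i _]; [exact: (O_nat 0) | exact: OD | Osub].
have jV := jetV d0 Od (jet_geo dpos).
have jG := jetM (jet_y n) jV; have jT := jetM (jet_y d) jV.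
have [_ _ _ [h1 Oh1 ME]] := jM.
have [_ _ _ [h2 Oh2 GE]] := jG.
have [_ _ _ [h3 Oh3 TE]] := jetM jG jT.
(* A value [0] would contradict the unit property, since [geo d] is [d] times a
   unit. *)
have geo0 : geo d != 0.
  apply/negP => /eqP g0; have := jet_geo dpos; rewrite g0 => -[_ _ _ [h Oh]].
  set b := - _; set c := _ / 24 => E.
  have [] := Oinv (_ : O (b + (c + b ^+ 2 / 2) * ep + ep ^+ 2 * h / d%:R)).
    by rewrite /b /c; Osub.
  case/eqP; apply: (mulfI d0); rewrite mulr0 E; by field; rewrite d0 n2.
rewrite PE geoE.
have -> : y ^+ n / (ep * geo d) * (n%:R - al / 2 + d%:R * y ^+ d / (ep * geo d))
  = ep ^- 2 * (ep * (n%:R - al / 2) * (y ^+ n / geo d)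
      + d%:R * ((y ^+ n / geo d) * (y ^+ d / geo d))).
  by field; rewrite ep0 geo0 n2.
rewrite ME TE GE.
pose q : K := (- (n%:R / 2) + - ((d%:R - 1) * (d%:R - 5) / 24))
   + (- n%:R + - (- ((d%:R - 1) / 2))) ^+ 2 / 2.
(* [q] is the coefficient of [ep^2] in the expansion of [d y^n / geo d]. *)
exists (d%:R^-1 * h1 - A%:R^-1 * ((n%:R - al / 2) * (d%:R^-1 * q + ep * h2) + d%:R * h3)).
  by rewrite /q; Osub.
rewrite /q; field; by rewrite d0 A0 ep0 n2 n8 n24.
Qed.

End Jets.

(** * Values and polynomial parts of rational functions *)

Section Regular.
Variable C : numClosedFieldType.
Variables (K : fieldType) (pf : {rmorphism {poly C} -> K}).
Hypothesis pf_inj : injective pf.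
Implicit Types (c a b : C) (f g h : K) (p q n : {poly C}).

Definition konst a : K := pf a%:P.
Definition tvar : K := pf 'X.

Lemma pf_eq0 p : (pf p == 0) = (p == 0).
Proof. by rewrite -(rmorph0 pf) (inj_eq pf_inj). Qed.

Lemma konst_is_zmod : zmod_morphism konst.
Proof. by move=> a b; rewrite /konst polyCB rmorphB. Qed.
Lemma konst_is_monoid : monoid_morphism konst.
Proof. by split=> [|a b]; rewrite /konst ?polyCM ?rmorph1 ?rmorphM. Qed.
HB.instance Definition _ := GRing.isZmodMorphism.Build C K konst konst_is_zmod.
HB.instance Definition _ := GRing.isMonoidMorphism.Build C K konst konst_is_monoid.

(** [K] stands for the field of rational functions, and [pf] for the inclusion
    of the polynomials. *)
Definition val_at c f a : Prop := exists p q,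
  [/\ q.[c] != 0, f = pf p / pf q & p.[c] = a * q.[c]].
Definition regular c f : Prop := exists a, val_at c f a.

Lemma horner_neq0 c q : q.[c] != 0 -> pf q != 0.
Proof.
by rewrite pf_eq0; apply: contra_neq => ->; rewrite horner0.
Qed.

Lemma val_poly c p : val_at c (pf p) p.[c].
Proof.
exists p, 1; rewrite hornerC oner_neq0 mulr1; split=> //.
by rewrite rmorph1 divr1.
Qed.

Lemma val_konst c a : val_at c (konst a) a.
Proof. by have := val_poly c a%:P; rewrite hornerC. Qed.

Lemma val_tvar c : val_at c tvar c.
Proof. by have := val_poly c 'X; rewrite hornerX. Qed.

Lemma val_atD c f g a b : val_at c f a -> val_at c g b -> val_at c (f + g) (a + b).
Proof.
case=> p [q [q0 -> pE]] [p' [q' [q0' -> pE']]].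
exists (p * q' + p' * q), (q * q'); split; first by rewrite hornerM mulf_neq0.
  rewrite rmorphD !rmorphM; field.
  by rewrite !(horner_neq0 (c := c)).
by rewrite hornerD !hornerM pE pE'; ring.
Qed.

Lemma val_atM c f g a b : val_at c f a -> val_at c g b -> val_at c (f * g) (a * b).
Proof.
case=> p [q [q0 -> pE]] [p' [q' [q0' -> pE']]].
exists (p * p'), (q * q'); split; first by rewrite hornerM mulf_neq0.
  rewrite !rmorphM; field.
  by rewrite !(horner_neq0 (c := c)).
by rewrite !hornerM pE pE'; ring.
Qed.

Lemma val_atN c f a : val_at c f a -> val_at c (- f) (- a).
Proof.
move=> /(val_atM (val_konst c (- 1))); rewrite /konst polyCN rmorphN !mulN1r.
by rewrite rmorph1 ?mulN1r.
Qed.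

Lemma val_atB c f g a b : val_at c f a -> val_at c g b -> val_at c (f - g) (a - b).
Proof. by move=> vf vg; apply: val_atD vf (val_atN vg). Qed.

Lemma val_atV c f a : a != 0 -> val_at c f a -> val_at c f^-1 a^-1.
Proof.
move=> a0 [p [q [q0 -> pE]]]; exists q, p; split.
- by rewrite pE mulf_neq0.
- by rewrite invf_div.
- by rewrite pE mulKf.
Qed.

Lemma val_at1 c : val_at c 1 1.
Proof. by have := val_konst c 1; rewrite rmorph1. Qed.

Lemma val_neq0 c f a : a != 0 -> val_at c f a -> f != 0.
Proof.
move=> a0 [p [q [q0 -> pE]]]; rewrite mulf_neq0 ?invr_eq0 ?(horner_neq0 q0) //.
by apply: (@horner_neq0 c); rewrite pE mulf_neq0.
Qed.

Lemma val_atX c f a k : val_at c f a -> val_at c (f ^+ k) (a ^+ k).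
Proof.
move=> vf; elim: k => [|k IH]; first by rewrite !expr0; exact: val_at1.
by rewrite !exprS; exact: val_atM.
Qed.

Lemma val_atXz c f a (k : int) : a != 0 -> val_at c f a -> val_at c (f ^ k) (a ^ k).
Proof.
move=> a0 vf; case: k => k; first exact: val_atX.
by rewrite NegzE -!exprnN; apply: val_atV (val_atX _ vf); rewrite expf_neq0.
Qed.

Lemma val_prod (I : finType) (P : pred I) c (f : I -> K) (a : I -> C) :
  (forall i, P i -> val_at c (f i) (a i)) ->
  val_at c (\prod_(i | P i) f i) (\prod_(i | P i) a i).
Proof. by move=> H; apply: big_rec2 => [|i b g Pi]; [exact: val_at1 | apply: val_atM; exact: H]. Qed.

Lemma val_sum (I : Type) (s : seq I) (P : pred I) c (f : I -> K) (a : I -> C) :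
  (forall i, P i -> val_at c (f i) (a i)) ->
  val_at c (\sum_(i <- s | P i) f i) (\sum_(i <- s | P i) a i).
Proof.
move=> H; apply: big_rec2 => [|i b g Pi]; last by apply: val_atD; exact: H.
by have := val_konst c 0; rewrite rmorph0.
Qed.

Lemma val_at_inj c f a b : val_at c f a -> val_at c f b -> a = b.
Proof.
case=> p [q [q0 -> pE]] [p' [q' [q0' E pE']]].
have {}E : p * q' = p' * q.
  apply: pf_inj; rewrite !rmorphM.
  apply: (mulIf (invr_neq0 (horner_neq0 q0))); rewrite mulrAC E.
  by field; rewrite !(horner_neq0 (c := c)).
have := congr1 (horner^~ c) E; rewrite /= !hornerM pE pE' => {}E.
apply: (mulIf q0); apply: (mulIf q0'); rewrite E; ring.
Qed.

Lemma regularD c f g : regular c f -> regular c g -> regular c (f + g).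
Proof. by move=> [a va] [b vb]; exists (a + b); exact: val_atD. Qed.
Lemma regularM c f g : regular c f -> regular c g -> regular c (f * g).
Proof. by move=> [a va] [b vb]; exists (a * b); exact: val_atM. Qed.
Lemma regularN c f : regular c f -> regular c (- f).
Proof. by move=> [a va]; exists (- a); exact: val_atN. Qed.
Lemma regularB c f g : regular c f -> regular c g -> regular c (f - g).
Proof. by move=> rf rg; apply: regularD rf (regularN rg). Qed.
Lemma regular_konst c a : regular c (konst a).
Proof. by exists a; exact: val_konst. Qed.
Lemma regular1 c : regular c 1.
Proof. by exists 1; exact: val_at1. Qed.
Lemma regular0 c : regular c 0.
Proof. by have := regular_konst c 0; rewrite rmorph0. Qed.
Lemma regular_sum (I : Type) (s : seq I) (P : pred I) c (f : I -> K) :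
  (forall i, P i -> regular c (f i)) -> regular c (\sum_(i <- s | P i) f i).
Proof.
move=> H; apply: big_ind => [|x y|]; [exact: regular0 | exact: regularD | exact: H].
Qed.

(** The local coordinate at [c], normalised by [t = c (1 - eps c)]. *)
Definition eps c : K := 1 - konst c^-1 * tvar.

Lemma val_eps c : c != 0 -> val_at c (eps c) 0.
Proof.
move=> c0; have := val_atB (val_at1 c) (val_atM (val_konst c c^-1) (val_tvar c)).
by rewrite mulVf // subrr.
Qed.

Lemma eps_neq0 c : eps c != 0.
Proof.
rewrite /eps /konst /tvar -rmorphM -(rmorph1 pf).
rewrite -rmorphN -rmorphD pf_eq0; apply/negP => /eqP.
move/(congr1 (fun p : {poly C} => p`_0)).
by rewrite coefB coef1 mul_polyC coefZ coefX mulr0 subr0 coef0 => /eqP; rewrite oner_eq0.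
Qed.

Lemma val_eps_div c f : c != 0 -> val_at c f 0 ->
  exists2 h, regular c h & f = eps c * h.
Proof.
move=> c0 [p [q [q0 -> pE]]]; rewrite mul0r in pE.
have /factor_theorem[m pm] : root p c by apply/rootP.
exists (pf (- c *: m) / pf q).
  exists ((- c *: m).[c] / q.[c]), (- c *: m), q; split=> //.
  by rewrite divfK.
rewrite mulrA; congr (_ / _).
rewrite /eps /konst /tvar -rmorphM -(rmorph1 pf).
rewrite -rmorphN -rmorphD -rmorphM; congr (pf _); rewrite pm.
rewrite -!mul_polyC; apply/eqP; rewrite -subr_eq0; apply/eqP.
transitivity (m * ('X - c%:P + (1 - c^-1%:P * 'X) * c%:P)).
  by rewrite polyCN; ring.
suff -> : 'X - c%:P + (1 - c^-1%:P * 'X) * c%:P = 0 by rewrite mulr0.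
rewrite mulrBl mul1r mulrAC -polyCM mulVf // mul1r; ring.
Qed.

Lemma eps_unit c h : c != 0 -> regular c h ->
  1 + eps c * h != 0 /\ regular c (1 + eps c * h)^-1.
Proof.
move=> c0 [a va]; have := val_atD (val_at1 c) (val_atM (val_eps c0) va).
rewrite mul0r addr0 => v1; split; first exact: val_neq0 (oner_neq0 _) v1.
by exists 1^-1; exact: val_atV (oner_neq0 _) v1.
Qed.

(** In lowest terms, a root of the denominator is a pole. *)
Lemma regular_everywhere f : (forall c, regular c f) -> exists p, f = pf p.
Proof.
move=> H; have [_ [p0 [q0 [q00 fE _]]]] := H 0.
have [p [q [cop q1 {}fE]]] : exists p q, [/\ coprimep p q, q != 0 &
    f = pf p / pf q].
  have q0n : q0 != 0 by rewrite -pf_eq0; exact: (@horner_neq0 0).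
  have gn : gcdp p0 q0 != 0 by rewrite gcdp_eq0 negb_and q0n orbT.
  have dp := divpK (dvdp_gcdl p0 q0); have dq := divpK (dvdp_gcdr p0 q0).
  exists (p0 %/ gcdp p0 q0), (q0 %/ gcdp p0 q0).
  have q1 : q0 %/ gcdp p0 q0 != 0.
    by apply: contraNneq q0n => e; rewrite -dq e mul0r.
  split=> //; first by rewrite coprimep_div_gcd // q0n orbT.
  have -> : pf (p0 %/ gcdp p0 q0) = pf p0 / pf (gcdp p0 q0).
    by apply: (canRL (mulfK _)); rewrite ?pf_eq0 // -rmorphM dp.
  have -> : pf (q0 %/ gcdp p0 q0) = pf q0 / pf (gcdp p0 q0).
    by apply: (canRL (mulfK _)); rewrite ?pf_eq0 // -rmorphM dq.
  by rewrite fE; field; rewrite !pf_eq0 gn q0n.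
have sq : size q == 1%N.
  apply: contraT => /closed_rootP[c /rootP qc].
  have [_ [p' [q' [q'c E _]]]] := H c.
  have q'0 := horner_neq0 q'c.
  have E' : p * q' = p' * q.
    apply: pf_inj; rewrite !rmorphM.
    have qn : pf q != 0 by rewrite pf_eq0.
    apply: (mulIf (invr_neq0 qn)); rewrite mulrAC -fE E.
    by field; rewrite qn q'0.
  have := congr1 (horner^~ c) E'; rewrite /= !hornerM qc mulr0 => /eqP.
  rewrite mulf_eq0 (negbTE q'c) orbF => pc.
  have : root (gcdp p q) c by rewrite root_gcd; apply/andP; split=> //; exact/rootP.
  move: cop; rewrite /coprimep => /size_poly1P[k k0 ->].
  by rewrite rootC (negbTE k0).
case/size_poly1P: sq => k k0 qE; exists (k^-1 *: p).
rewrite fE qE -mul_polyC rmorphM mulrC; congr (_ * _).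
by rewrite -/(konst k) -/(konst k^-1) fmorphV.
Qed.

Definition negdeg f : Prop := exists p q,
  [/\ q != 0, (size p < size q)%N & f = pf p / pf q].

Lemma negdeg0 : negdeg 0.
Proof.
exists 0, 1; rewrite oner_neq0 size_poly0 size_poly1; split=> //.
by rewrite rmorph0 mul0r.
Qed.

Lemma negdegD f g : negdeg f -> negdeg g -> negdeg (f + g).
Proof.
case=> p [q [q0 sq ->]] [p' [q' [q0' sq' ->]]].
exists (p * q' + p' * q), (q * q'); split; first by rewrite mulf_neq0.
  rewrite size_mul // (leq_ltn_trans (size_polyD _ _)) // gtn_max.
  rewrite !(leq_ltn_trans (size_polyMleq _ _)) //.
    by move: q0 sq'; rewrite -size_poly_gt0; move: (size q) (size p') (size q') => x y z; lia.
  by move: q0' sq; rewrite -size_poly_gt0; move: (size q) (size p) (size q') => x y z; lia.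
rewrite rmorphD !rmorphM; field.
by rewrite !pf_eq0 q0 q0'.
Qed.

Lemma negdegZ a f : negdeg f -> negdeg (konst a * f).
Proof.
case=> p [q [q0 sq ->]]; exists (a *: p), q; split=> //.
  exact: leq_ltn_trans (size_scale_leq _ _) sq.
by rewrite -mul_polyC rmorphM mulrA.
Qed.

Lemma negdeg_sum (I : Type) (s : seq I) (P : pred I) (f : I -> K) :
  (forall i, P i -> negdeg (f i)) -> negdeg (\sum_(i <- s | P i) f i).
Proof.
move=> H; apply: big_ind => [|x y|]; [exact: negdeg0 | exact: negdegD | exact: H].
Qed.

Lemma negdeg_poly p : negdeg (pf p) -> p = 0.
Proof.
case=> n [q [q0 sq E]]; apply/eqP; apply: contraTT sq => p0.
have {}E : p * q = n.
  apply: pf_inj; rewrite rmorphM E divfK // pf_eq0 //.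
rewrite -leqNgt -E size_mul //; move: p0; rewrite -size_poly_gt0.
move: (size p) (size q) => x y; lia.
Qed.

Lemma negdeg_frac (b : C) (n d : nat) : b != 0 -> (n < d)%N ->
  negdeg (tvar ^+ n / (1 - konst b * tvar ^+ d)).
Proof.
move=> b0 nd; have d0 : (0 < d)%N by exact: leq_ltn_trans nd.
have sb : size (1 - b *: 'X^d : {poly C}) = d.+1.
  rewrite addrC size_polyDl size_polyN size_scale // size_polyXn //.
  by rewrite size_poly1.
exists 'X^n, (1 - b *: 'X^d); split; rewrite ?size_polyXn ?sb //.
  by rewrite -size_poly_gt0 sb.
rewrite rmorphD rmorphN -mul_polyC rmorphM !rmorphXn.
by rewrite rmorph1.
Qed.

(** The shape of [double_part], whose poles are double. *)
Lemma negdeg_frac2 (k m : C) (n d : nat) : (n < d)%N ->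
  negdeg (tvar ^+ n / (1 - tvar ^+ d) * (konst k + konst m * tvar ^+ d / (1 - tvar ^+ d))).
Proof.
move=> nd; have d0 : (0 < d)%N by exact: leq_ltn_trans nd.
have sb : size (1 - 'X^d : {poly C}) = d.+1.
  by rewrite addrC size_polyDl size_polyN size_polyXn // size_poly1.
have b0 : (1 - 'X^d : {poly C}) != 0 by rewrite -size_poly_gt0 sb.
have bE : pf (1 - 'X^d) = 1 - tvar ^+ d.
  rewrite rmorphD rmorphN !rmorphXn.
  by rewrite rmorph1.
exists ('X^n * (k *: (1 - 'X^d) + m *: 'X^d)), ((1 - 'X^d) * (1 - 'X^d)); split.
- by rewrite mulf_neq0.
- rewrite (size_mul b0 b0) sb; apply: leq_ltn_trans (size_polyMleq _ _) _.
  have : (size (k *: (1 - 'X^d) + m *: 'X^d)%R <= d.+1)%N.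
    rewrite (leq_trans (size_polyD _ _)) // geq_max !(leq_trans (size_scale_leq _ _)) ?sb //.
    by rewrite size_polyXn.
  rewrite size_polyXn; move: (size _) => x; lia.
- rewrite !rmorphM bE rmorphD -!mul_polyC !rmorphM bE !rmorphXn.
  rewrite -/(konst k) -/(konst m) -/tvar; field; by rewrite -bE pf_eq0.
Qed.

End Regular.

Lemma tofrac_inj (C : numClosedFieldType) : injective (@tofrac {poly C}).
Proof. by move=> p q /eqP; rewrite tofrac_eq => /eqP. Qed.

(** A polynomial of negative degree is [0], so the polynomial part is unique. *)
Lemma polpart_eq (C : numClosedFieldType) (f : ratfun C) p :
  negdeg (@tofrac {poly C}) (f - poly_frac p) -> polpart f = p.
Proof.
move=> H; have ex : is_polpart f p by exact: H.
have H' : is_polpart f (polpart f).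
  by apply: (xgetPex 0 (P := [set p | is_polpart f p]%classic)); exists p.
apply/eqP; rewrite -subr_eq0; apply/eqP.
apply: (@negdeg_poly C _ (@tofrac {poly C}) (@tofrac_inj C)).
rewrite rmorphB.
rewrite (_ : _ - _ = (f - poly_frac p) + konst (@tofrac {poly C}) (-1) * (f - poly_frac (polpart f))).
  apply: negdegD => //; first exact: tofrac_inj.
  exact: negdegZ.
by rewrite rmorphN1 mulN1r opprB [RHS]addrC addrA subrK.
Qed.

(** * Labellings as a finite list *)

Section Harm.
Variable G : plumbing.
Implicit Types (A B : {set G}) (x y z u v w : G).
Hypothesis Gacyclic : acyclic_graph G.
Hypothesis Gneg : negative_definite G.

(** A column of the adjugate matrix. Consequently, multiplying a labelling by
    the powers [c^(a_wv)] only affects the relation at [v]. *)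
Lemma wt_harm A v w : connected_set A -> v \in A -> w \in A ->
  euler w * (wt A w v)%:Z + \sum_(u in nbrs A w) (wt A u v)%:Z =
  - ((dsc A)%:Z * (w == v)%:Z).
Proof.
move=> cA vA wA; apply: (@intr_inj rat).
have off z : z \notin A -> green A z v = 0 by exact: green_offl.
have := greenE Gneg wA vA; rewrite (ninter_sum_nbrs wA off) => E.
rewrite rmorphD rmorphN !rmorphM rmorph_sum /= -!pmulrn wtE // dscE // -E mulrBr.
rewrite opprB mulr_sumr addrC; congr (_ + _).
  by apply: eq_bigr => u /nbrsP[uA _]; rewrite -pmulrn wtE.
by rewrite /ninter /inter eqxx; ring.
Qed.

End Harm.

Section Labs.
Variables (C : numClosedFieldType) (G : plumbing).
Implicit Types (A B : {set G}) (x y z u v w : G) (r : {ffun G -> C}).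
Hypothesis Gacyclic : acyclic_graph G.
Hypothesis Gneg : negative_definite G.

(** The values [r w = rho [E^*_w]] of a character of the discriminant group of
    the subgraph [A], extended by [1]. *)
Definition labelling A r : bool := [&& [forall w, (w \notin A) ==> (r w == 1)],
  [forall w, r w != 0] &
  [forall w in A, r w ^ euler w * \prod_(u in nbrs A w) r u == 1]].

Lemma labellingP A r : reflect [/\ forall w, w \notin A -> r w = 1,
   forall w, r w != 0 & forall w, w \in A -> rel_at A r w] (labelling A r).
Proof.
apply: (iffP and3P) => -[h1 h2 h3]; split.
- by move=> w wA; have /forallP/(_ w) := h1; rewrite wA => /eqP.
- exact/forallP.
- by move=> w wA; have /forall_inP/(_ w wA)/eqP := h3.
- by apply/forallP => w; apply/implyP => /h1 ->.
- exact/forallP.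
- by apply/forall_inP => w /h3/eqP.
Qed.

(** Raising the relations to the powers [wt A x w] and multiplying them leaves
    only [r w], by [wt_harm]. *)
Lemma lab_root A r w : connected_set A -> labelling A r -> r w ^+ dsc A = 1.
Proof.
move=> cA /labellingP[roff r0 rrel]; have [wA|/roff ->] := boolP (w \in A); last by rewrite expr1n.
have : \prod_(x in A) (r x ^ euler x * \prod_(u in nbrs A x) r u) ^ (wt A x w)%:Z = 1.
  by rewrite big1 // => x xA; rewrite rrel // exp1rz.
under eq_bigr => x xA do rewrite expfzMl.
rewrite big_split /=.
have -> : \prod_(x in A) (\prod_(u in nbrs A x) r u) ^ (wt A x w)%:Z =
  \prod_(u in A) \prod_(x in nbrs A u) r u ^ (wt A x w)%:Z.
  under eq_bigr => x xA do rewrite -exprnP -prodrXl.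
  rewrite (exchange_big_dep (mem A)) /=; last by move=> x u _ /nbrsP[].
  apply: eq_bigr => u uA; apply: eq_bigl => x; rewrite !inE uA /=.
  by rewrite adj_sym andbC.
rewrite -big_split /= => E.
apply: invr_inj; rewrite invr1 exprnN -[RHS]E (bigD1 w) //=.
rewrite prod_expz // exprz_exp -expfzDr // wt_harm // eqxx mulr1 big1 ?mulr1 //.
move=> x /andP[xA xw].
by rewrite prod_expz // exprz_exp -expfzDr // wt_harm // (negbTE xw) mulr0 oppr0.
Qed.

Definition unity_roots A : seq C :=
  projT1 (closed_field_poly_normal ('X^(dsc A) - 1)).

Lemma mem_unity_roots A a : a ^+ dsc A = 1 -> a \in unity_roots A.
Proof.
rewrite /unity_roots; case: closed_field_poly_normal => s /= E aE.
have : root ('X^(dsc A) - 1) a by rewrite /root !hornerE aE subrr.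
have p0 : 'X^(dsc A) - 1 != 0 :> {poly C}.
  by rewrite -size_poly_gt0 size_XnsubC // dsc_gt0.
by rewrite E rootZ ?lead_coef_eq0 // root_prod_XsubC.
Qed.

(** By [lab_root] the values of a labelling are roots of unity of order [dsc A],
    so a search among finitely many functions finds them all. *)
Definition labellings A : seq {ffun G -> C} :=
  undup [seq r <- [seq [ffun w => val (f w)] | f : {ffun G -> seq_sub (unity_roots A)}]
        | labelling A r].

Lemma labellings_uniq A : uniq (labellings A). Proof. exact: undup_uniq. Qed.

Lemma mem_labellings A r : connected_set A -> (r \in labellings A) = labelling A r.
Proof.
move=> cA; rewrite mem_undup mem_filter andb_idr // => rl.
have rw w : r w \in unity_roots A by apply: mem_unity_roots; exact: lab_root.
apply/mapP; exists [ffun w => SeqSub (rw w)]; first by rewrite mem_enum.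
by apply/ffunP => w; rewrite !ffunE.
Qed.

End Labs.

(** * Expansion of P at a point *)

Section Expansion.
Variables (C : numClosedFieldType) (K : fieldType).
Variables (pf : {rmorphism {poly C} -> K}) (pf_inj : injective pf).
Variable G : plumbing.
Implicit Types (A B : {set G}) (x y z u v w : G) (c a b : C) (r : G -> C).
Hypothesis Gacyclic : acyclic_graph G.
Hypothesis Gneg : negative_definite G.

Local Notation konst := (konst pf).
Local Notation tvar := (tvar pf).
Local Notation eps := (eps pf).
Local Notation val_at := (val_at pf).
Local Notation regular := (regular pf).

Definition Peval A v r (s : K) : K :=
  \prod_(w in A) (1 - konst (r w) * s ^+ wt A w v) ^ dg A w.

Lemma eps_y c : 1 - eps c = konst c^-1 * tvar.
Proof. by rewrite /eps opprB addrC subrK. Qed.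

Lemma val_y c : c != 0 -> val_at c (1 - eps c) 1.
Proof.
by move=> c0; have := val_atB pf_inj (val_at1 pf c) (val_eps pf_inj c0); rewrite subr0.
Qed.

Lemma konst_neq0 a : a != 0 -> konst a != 0.
Proof. by move=> a0; rewrite (fmorph_eq0 konst). Qed.

(** The behaviour at [t = c] is that of a twisted labelling at [t = 1]. *)
Lemma Peval_scale A v r c : c != 0 ->
  Peval A v r tvar = Peval A v (fun w => r w * c ^+ wt A w v) (1 - eps c).
Proof.
move=> c0; apply: eq_bigr => w _; congr ((1 - _) ^ _).
rewrite eps_y exprMn mulrA; congr (_ * _).
by rewrite -rmorphXn -rmorphM -mulrA exprVn mulfV ?mulr1 // expf_neq0.
Qed.

(** What is left of [Peval] once the powers of [eps c] are taken out. *)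
Definition Punit A v r c : K :=
  \prod_(w in A) (if r w == 1 then geo (eps c) (wt A w v)
                  else 1 - konst (r w) * (1 - eps c) ^+ wt A w v) ^ dg A w.

Lemma Peval_factor A v r c :
  Peval A v r (1 - eps c) = eps c ^ vanord A r * Punit A v r c.
Proof.
rewrite /vanord -prod_expz ?eps_neq0 // -big_split /=; apply: eq_bigr => w wA.
case: eqP => [->|_]; last by rewrite expr0z mul1r.
by rewrite rmorph1 mul1r geoE expfzMl.
Qed.

Lemma val_geo c (a : nat) : c != 0 -> val_at c (geo (eps c) a) a%:R.
Proof.
move=> c0; rewrite -[X in X%:R]card_ord -sumr_const /geo.
apply: (val_sum pf_inj) => i _; have := val_atX pf_inj i (val_y c0).
by rewrite expr1n.
Qed.

Lemma val_Punit A v r c : c != 0 -> connected_set A -> v \in A ->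
  val_at c (Punit A v r c) (lead A v r).
Proof.
move=> c0 cA vA; apply: (val_prod pf_inj) => w wA; apply: (val_atXz pf_inj).
  by apply: lead_factor_neq0; exact: wt_gt0.
rewrite /lead_factor; case: eqP => _; first exact: val_geo.
apply: (val_atB pf_inj) (val_at1 _ _) _; rewrite -[X in val_at _ _ X]mulr1.
apply: (val_atM pf_inj) (val_konst _ _ _) _; have := val_atX pf_inj (wt A w v) (val_y c0).
by rewrite expr1n.
Qed.

Lemma val_Peval A v r c : c != 0 -> connected_set A -> v \in A -> 0 <= vanord A r ->
  val_at c (Peval A v r (1 - eps c)) (if vanord A r == 0 then lead A v r else 0).
Proof.
move=> c0 cA vA; have := val_Punit r c0 cA vA; rewrite Peval_factor.
case: (vanord A r) => // -[|k] vU _; first by rewrite expr0z mul1r eqxx.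
rewrite /= -(mul0r (lead A v r)).
apply: (val_atM pf_inj) vU; by have := val_atX pf_inj k.+1 (val_eps pf_inj c0); rewrite expr0n.
Qed.

Lemma Peval_pole A v r c : c != 0 -> connected_set A -> v \in A -> vanord A r = -1 ->
  regular c (Peval A v r (1 - eps c) - konst (lead A v r) / eps c).
Proof.
move=> c0 cA vA o1; rewrite Peval_factor o1.
have := val_atB pf_inj (val_Punit r c0 cA vA) (val_konst pf c (lead A v r)); rewrite subrr.
case/(val_eps_div c0) => h rh /(canRL (subrK _)) ->.
rewrite exprN1 mulrDr mulKf ?eps_neq0 // (mulrC (eps c)^-1) addrK; exact: rh.
Qed.

Lemma K_char0 k : (k.+1)%:R != 0 :> K.
Proof. by rewrite -(rmorph_nat konst) konst_neq0 // pnatr_eq0. Qed.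

Lemma regular_natV c k : regular c (k.+1%:R)^-1.
Proof. by rewrite -(rmorph_nat konst) -fmorphV; exact: regular_konst. Qed.

Section Double.
Variables (A : {set G}) (v : G).
Hypotheses (cA : connected_set A) (vA : v \in A).
Variable n : nat.

Definition alphaK : K := \sum_(w in A) (dg A w)%:~R * (wt A w v)%:R.
Definition alphaC : C := \sum_(w in A) (dg A w)%:~R * (wt A w v)%:R.
Definition betaC : C := \sum_(w in A) (dg A w)%:~R * (wt A w v)%:R ^+ 2.

(** The fraction of negative degree that carries the poles due to the trivial
    labelling and to its twists. *)
Definition double_part (s : K) : K := (wt A v v)%:R^-1 *
  (s ^+ n / (1 - s ^+ dsc A) *
    (n%:R - alphaK / 2 + (dsc A)%:R * s ^+ dsc A / (1 - s ^+ dsc A))).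

(** The value at [1] of the contribution of the trivial character, once
    [double_part] is removed. *)
Definition double_value : C := ((dsc A)%:R * (wt A v v)%:R)^-1 *
  ((betaC - (dsc A)%:R ^+ 2) / 24 + (alphaC + (dsc A)%:R - 2 * n%:R) ^+ 2 / 8).

Lemma konst_alphaC : konst alphaC = alphaK.
Proof.
by rewrite rmorph_sum; apply: eq_bigr => w _; rewrite rmorphM rmorph_int rmorph_nat.
Qed.

(** [jet_constant_term] in the local ring at [c]. *)
Lemma val_double c r : c != 0 -> trivial_on A r ->
  val_at c (konst (dsc A)%:R^-1 * Peval A v r (1 - eps c) - double_part (1 - eps c)) double_value.
Proof.
move=> c0 tA.
have lE : \prod_(w in A) ((wt A w v)%:R : C) ^ dg A w = (wt A v v)%:R^-1.
  rewrite -(lead_triv Gacyclic Gneg cA vA tA); apply: eq_bigr => w wA.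
  by rewrite /lead_factor (trivP _ _ tA _ wA) eqxx.
have oE : \sum_(w in A) dg A w = -2.
  rewrite -(vanord_triv Gacyclic cA vA tA); apply: eq_bigr => w wA.
  by rewrite (trivP _ _ tA _ wA) eqxx.
have pE : \prod_(w in A) ((wt A w v)%:R : K) ^ dg A w = (wt A v v)%:R^-1.
  have := congr1 konst lE; rewrite rmorph_prod fmorphV rmorph_nat => <-.
  by apply: eq_bigr => w _; rewrite fmorphXz rmorph_nat.
have [h Oh E] := jet_constant_term (regular1 pf c) (@regularD _ _ _ pf_inj c)
  (@regularM _ _ _ pf_inj c) (@regularN _ _ _ pf_inj c) (ex_intro _ 0 (val_eps pf_inj c0))
  (eps_neq0 pf_inj c) (fun h => @eps_unit _ _ _ pf_inj c h c0) K_char0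
  (regular_natV c) n (fun w wA => wt_gt0 Gacyclic Gneg cA wA vA)
  (dsc_gt0 Gneg A) (wt_gt0 Gacyclic Gneg cA vA vA) oE pE.
have PE : Peval A v r (1 - eps c) =
    \prod_(w in A) (1 - (1 - eps c) ^+ wt A w v) ^ dg A w.
  by apply: eq_bigr => w wA; rewrite (trivP _ _ tA _ wA) rmorph1 mul1r.
rewrite PE fmorphV rmorph_nat E.
have [b vb] := Oh; rewrite -[double_value]addr0 -[X in double_value + X](mul0r b).
apply: (val_atD pf_inj); last by apply: (val_atM pf_inj) vb; exact: val_eps.
rewrite -[X in val_at c X](_ : konst double_value = _); first exact: val_konst.
have bE : konst betaC = \sum_(w in A) (dg A w)%:~R * (wt A w v)%:R ^+ 2.
  rewrite rmorph_sum; apply: eq_bigr => w _.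
  by rewrite rmorphM rmorphXn rmorph_int rmorph_nat.
rewrite -/alphaK -konst_alphaC -bE /double_value; move: alphaC betaC => a b'.
rewrite rmorphM fmorphV (rmorphM _ _%:R) !rmorph_nat; congr (_ * _).
rewrite [LHS]rmorphD; congr (_ + _).
  by rewrite rmorphM fmorphV rmorph_nat rmorphB rmorphXn rmorph_nat.
rewrite rmorphM fmorphV rmorph_nat rmorphXn rmorphB (rmorphM _ 2) !rmorph_nat.
by rewrite (rmorphD _ a) rmorph_nat.
Qed.

Lemma double_part_scale c : c != 0 -> c ^+ dsc A = 1 ->
  double_part tvar = konst (c ^+ n) * double_part (1 - eps c).
Proof.
move=> c0 cd.
have ttE k : tvar ^+ k = konst (c ^+ k) * (1 - eps c) ^+ k.
  rewrite eps_y exprMn mulrA -[konst c^-1 ^+ k]rmorphXn -[konst _ * konst _]rmorphM exprVn mulfV ?expf_neq0 //.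
  by rewrite rmorph1 mul1r.
by rewrite /double_part !ttE cd rmorph1 mul1r -!mulrA mulrCA.
Qed.

End Double.
End Expansion.

(** * The polynomial part of H *)

Section Main.
Variables (C : numClosedFieldType) (K : fieldType).
Variables (pf : {rmorphism {poly C} -> K}) (pf_inj : injective pf).
Variable G : plumbing.
Implicit Types (A B : {set G}) (x y z u v w : G) (c a b : C) (r : {ffun G -> C}).
Hypothesis Gacyclic : acyclic_graph G.
Hypothesis Gneg : negative_definite G.

Local Notation konst := (konst pf).
Local Notation tvar := (tvar pf).
Local Notation eps := (eps pf).
Local Notation val_at := (val_at pf).
Local Notation regular := (regular pf).

Let T : {set G} := [set: G].
Hypothesis cT : connected_set T.
Variables (v : G) (l : G -> int) (n : nat).
Let d := dsc T.
Hypothesis nE : n%:Z = \sum_w l w * (wt T w v)%:Z.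
Hypothesis nd : (n < d)%N.

Let vT : v \in T. Proof. exact: in_setT. Qed.
Let br u := branch T v u.

(** The value of the character at the class of [l]. *)
Definition lab_value (r : G -> C) : C := \prod_w r w ^ l w.
(** The limit at [t = 1] of the product described at [vanord], for nonnegative
    order; see [cvg_limit_at1]. *)
Definition limit_at1 A x (r : G -> C) : C := if vanord A r == 0 then lead A x r else 0.
(** By [lead_single], the coefficient of the simple pole at [t = 1] for [r],
    viewed as a labelling of the whole tree. *)
Definition branch_residue u r : C := (1 - r u) * limit_at1 (br u) u r / (dsc (br u))%:R.
(** The function [H_(sigma, v)], summed over labellings; see [Hrat_Hlab]. *)
Definition Hlab : K := konst d%:R^-1 *
  \sum_(r <- labellings C T) konst (lab_value r)^-1 * Peval pf T v r tvar.
(** The poles are the [c] with [r u c^d = 1], for which [r] is the twist by [c]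
    of a labelling of the whole tree. *)
Definition branch_pole u r : K :=
  konst ((lab_value r)^-1 * branch_residue u r) * (tvar ^+ n / (1 - konst (r u) * tvar ^+ d)).
(** By [regular_diff] it has the poles of [Hlab], and by [negdeg_principal_part]
    it has negative degree, so it is the rest of [Hlab] modulo polynomials. *)
Definition principal_part : K := double_part T v n tvar +
  \sum_(u in nbrs T v) \sum_(r <- labellings C (br u) | r u != 1) branch_pole u r.

(** The labelling that governs the behaviour of [Peval] at [t = c], by
    [Peval_scale]. All relations survive except the one at [v]. *)
Definition twist c r : {ffun G -> C} := [ffun w => r w * c ^+ wt T w v].

Lemma twistK c : c != 0 -> cancel (twist c) (twist c^-1).
Proof.
move=> c0 r; apply/ffunP => w; rewrite !ffunE -mulrA -exprMn mulfV //.
by rewrite expr1n mulr1.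
Qed.

Lemma twistVK c : c != 0 -> cancel (twist c^-1) (twist c).
Proof. by move=> c0 r; have := twistK (invr_neq0 c0) r; rewrite invrK. Qed.

Lemma twist1 r : twist 1 r = r.
Proof. by apply/ffunP => w; rewrite ffunE expr1n mulr1. Qed.

Lemma twist_rel c r w : c != 0 ->
  twist c r w ^ euler w * \prod_(u in nbrs T w) twist c r u =
  r w ^ euler w * (\prod_(u in nbrs T w) r u) * c ^ (- (d%:Z * (w == v)%:Z)).
Proof.
move=> c0; rewrite -(wt_harm Gacyclic Gneg cT vT (in_setT w)) expfzDr //.
rewrite ffunE expfzMl exprnP exprz_exp [_ * euler w]mulrC -prod_expz //.
under eq_bigr do rewrite ffunE exprnP.
by rewrite big_split /= mulrACA.
Qed.

Lemma lab_value_chi c r : c != 0 -> lab_value (twist c r) = lab_value r * c ^+ n.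
Proof.
move=> c0; rewrite exprnP nE -prod_expz // -big_split /=; apply: eq_bigr => w _.
by rewrite ffunE expfzMl exprnP exprz_exp [_ * l w]mulrC.
Qed.

Lemma lab_value_neq0 r : (forall w, r w != 0) -> lab_value r != 0.
Proof. by move=> r0; apply/prodf_neq0 => w _; rewrite expfz_neq0. Qed.

Lemma lab_br_v u r : u \in nbrs T v -> labelling (br u) r -> r v = 1.
Proof.
move=> uN /labellingP[roff _ _]; apply: roff; apply/negP => /(branch_mem uN)[_].
by rewrite eqxx.
Qed.

(** Off the branch only neighbours equal to [1] are seen, the branch being
    attached to the rest at [v]. *)
Lemma lab_br_rel u r w : u \in nbrs T v -> labelling (br u) r -> w != v ->
  rel_at T r w.
Proof.
move=> uN lr wv; have rv := lab_br_v uN lr; have [roff r0 rrel] := labellingP _ _ lr.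
have [wB|wB] := boolP (w \in br u).
  by apply/(rel_at_branch Gacyclic vT uN wB) => //; exact: rrel.
rewrite /rel_at roff // exp1rz mul1r big1 // => y /nbrsP[_ wy]; apply: roff.
apply: contra wB => yB; apply: branch_closed uN yB (in_setT _) wv _.
by rewrite adj_sym.
Qed.

Lemma lab_br_prod u r : u \in nbrs T v -> labelling (br u) r ->
  r v ^ euler v * \prod_(w in nbrs T v) r w = r u.
Proof.
move=> uN lr; rewrite (lab_br_v uN lr) exp1rz mul1r (bigD1 u) //= big1 ?mulr1 //.
move=> w /andP[wN wu]; have [roff _ _] := labellingP _ _ lr; apply: roff.
by apply: contra wu => wB; apply/eqP; exact: branch_root_uniq uN wN wB.
Qed.

Section AtPoint.
Variable c : C.
Hypothesis c0 : c != 0.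

Lemma twist_neq0 r w : labelling T r -> twist c r w != 0.
Proof. by case/labellingP => _ r0 _; rewrite ffunE mulf_neq0 // expf_neq0. Qed.

Lemma rel_at_twist r w : labelling T r -> w != v -> rel_at T (twist c r) w.
Proof.
case/labellingP => _ _ rr wv; rewrite /rel_at twist_rel // (negbTE wv) mulr0 oppr0.
by rewrite expr0z mulr1; exact: rr (in_setT w).
Qed.

Lemma twist_root r : labelling T r ->
  twist c r v ^ euler v * (\prod_(w in nbrs T v) twist c r w) * c ^+ d = 1.
Proof.
case/labellingP => _ _ rr; rewrite twist_rel // (rr v (in_setT v)) eqxx mulr1 mul1r.
by rewrite -exprnN mulVf // expf_neq0.
Qed.

(** Twisting back by [c] restores the relation at [v] exactly when [r u * c ^+ d
    = 1]. *)
Lemma twist_perm u (F : {ffun G -> C} -> K) : u \in nbrs T v ->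
  \sum_(r <- labellings C T | labelling (br u) (twist c r) && (twist c r u != 1)) F (twist c r)
  = \sum_(r <- labellings C (br u) | (r u != 1) && (r u * c ^+ d == 1)) F r.
Proof.
move=> uN; rewrite -big_filter -[RHS]big_filter -(big_map (twist c) xpredT F).
apply: perm_big; apply: uniq_perm.
- by rewrite map_inj_uniq ?filter_uniq ?labellings_uniq //; exact: can_inj (twistK c0).
- by rewrite filter_uniq ?labellings_uniq.
have cB : connected_set (br u) := conn_branch uN.
move=> x; rewrite mem_filter (mem_labellings Gacyclic Gneg x cB).
apply/mapP/andP => [[r + ->]|[/andP[xu xc] lx]].
  rewrite mem_filter (mem_labellings Gacyclic Gneg r cT) => /andP[/andP[lB ru] lr].
  by rewrite lB ru -(lab_br_prod uN lB) twist_root ?eqxx.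
exists (twist c^-1 x); last by rewrite twistVK.
rewrite mem_filter twistVK // lx xu (mem_labellings Gacyclic Gneg _ cT) /=.
have [xoff x0 xr] := labellingP _ _ lx.
apply/labellingP; split=> [w|w|w _]; first by rewrite in_setT.
  by rewrite ffunE mulf_neq0 // expf_neq0 // invr_neq0.
rewrite /rel_at twist_rel ?invr_neq0 //; have [->|wv] := eqVneq w v.
  by rewrite (lab_br_prod uN lx) mulr1 -exprnN exprVn invrK; exact/eqP.
rewrite mulr0 oppr0 expr0z mulr1; exact: lab_br_rel uN lx wv.
Qed.

Definition Hterm r : K := konst (d%:R^-1 * (lab_value r)^-1) * Peval pf T v r tvar.

Lemma Hterm_twist r : Hterm r = konst (d%:R^-1 * (lab_value r)^-1) * Peval pf T v (twist c r) (1 - eps c).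
Proof.
rewrite /Hterm (Peval_scale _ _ _ _ c0); congr (_ * _); apply: eq_bigr => w _.
by rewrite ffunE.
Qed.

Lemma val_triv r : labelling T r -> trivial_on T (twist c r) ->
  val_at c (Hterm r - double_part T v n tvar) (c ^+ n * double_value C T v n).
Proof.
move=> lr tr; have := twist_root lr; rewrite big1; last first.
  by move=> w _; exact: (trivP _ _ tr _ (in_setT w)).
rewrite (trivP _ _ tr _ vT) exp1rz !mul1r => cd.
have : lab_value (twist c r) = 1.
  by rewrite /lab_value big1 // => w _; rewrite (trivP _ _ tr _ (in_setT w)) exp1rz.
rewrite lab_value_chi // => /(canRL (mulfK (expf_neq0 n c0))); rewrite mul1r => evE.
rewrite Hterm_twist (double_part_scale _ _ n c0 cd) evE invrK (mulrC d%:R^-1) rmorphM -mulrA.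
rewrite -mulrBr; apply: (val_atM pf_inj); first exact: val_konst.
exact: val_double.
Qed.

(** Both functions have at most a simple pole at [c], and their residues agree
    by [lead_single]. *)
Lemma regular_special u r : labelling T r -> u \in nbrs T v ->
  labelling (br u) (twist c r) -> twist c r u != 1 ->
  regular c (Hterm r - branch_pole u (twist c r)).
Proof.
move=> lr uN lB xu; have := twist_root lr; rewrite (lab_br_prod uN lB) => xc.
have x0 w := twist_neq0 w lr.
have evC := lab_value_chi r c0.
move: (twist c r) (Hterm_twist r) xu lB xc x0 evC => x TE xu lB xc x0 evC.
have xv := lab_br_v uN lB.
have relx w : w \in T -> w != v -> rel_at T x w by move=> _; exact: (lab_br_rel uN lB).
have tw w : w \in nbrs T v -> w != u -> trivial_on (branch T v w) x.
  move=> wN wu; apply/trivP => z zw; have [xoff _ _] := labellingP _ _ lB; apply: xoff.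
  by apply: contra wu => zB; apply/eqP; exact: branch_uniq uN wN zB zw.
have oT := vanord_single Gacyclic cT vT relx xv uN tw.
rewrite /branch_ord (negbTE xu) addr0 in oT.
have cB : connected_set (br u) := conn_branch uN.
have uB : u \in br u := root_in_branch T v u.
have rB : regular c (Peval pf T v x (1 - eps c) - konst (branch_residue u x) / eps c).
  have [xoff _ xrel] := labellingP _ _ lB.
  have oB : 0 <= vanord (br u) x.
    have [_ _ h _] := ord_facts Gacyclic cB uB (fun w wB _ => xrel w wB).
    by apply: h => //; exact: nontriv_root.
  rewrite /branch_residue /limit_at1; case: eqP => [ o0|/eqP o0].
    have o1 : vanord T x = -1 by rewrite oT o0.
    have := Peval_pole pf_inj Gacyclic Gneg c0 cT vT o1.
    rewrite (lead_single Gacyclic Gneg cT vT xv uN tw o0).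
    by rewrite /lead_factor (negbTE xu) [_ * (1 - _)]mulrC.
  rewrite mulr0 mul0r rmorph0 mul0r subr0.
  have oT0 : 0 <= vanord T x.
    by rewrite oT; move: o0 oB; rewrite -/(br u); move: (vanord (br u) x) => k; lia.
  by exists (if vanord T x == 0 then lead T v x else 0); exact: val_Peval.
(* With [t = c (1 - eps)] and [x_u c^d = 1], the fraction in [branch_pole]
   becomes a power of [c] times [(1 - eps)^n / (eps * geo d)]. *)
have gd : geo (eps c) d != 0.
  apply: (val_neq0 pf_inj _ (val_geo pf_inj d c0)).
  exact: (dscC_neq0 C Gneg T).
have [h rh hE] : exists2 h, regular c h &
    konst d%:R^-1 - (1 - eps c) ^+ n / geo (eps c) d = eps c * h.
  apply: (val_eps_div c0); rewrite -(subrr d%:R^-1).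
  apply: (val_atB pf_inj); first exact: val_konst.
  rewrite -[X in val_at _ _ X]mul1r; apply: (val_atM pf_inj).
    by have := val_atX pf_inj n (val_y pf_inj c0); rewrite expr1n.
  by apply: val_atV (val_geo pf_inj d c0); exact: (dscC_neq0 C Gneg T).
have NE : branch_pole u x = konst ((lab_value r)^-1 * branch_residue u x) * ((1 - eps c) ^+ n / geo (eps c) d) / eps c.
  have ttE k : tvar ^+ k = konst (c ^+ k) * (1 - eps c) ^+ k.
    rewrite eps_y exprMn mulrA -[konst c^-1 ^+ k]rmorphXn -[konst _ * konst _]rmorphM.
    by rewrite exprVn mulfV ?expf_neq0 // rmorph1 mul1r.
  rewrite /branch_pole !ttE [konst (x u) * _]mulrA -[konst _ * konst _]rmorphM xc rmorph1 mul1r.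
  rewrite geoE invfM evC invfM.
  rewrite -[(lab_value r)^-1 / _ * _]mulrAC rmorphM -!mulrA; congr (_ * _).
  rewrite [LHS]mulrA -[konst _ * konst (c ^+ n)]rmorphM mulVf ?expf_neq0 //.
  by rewrite rmorph1 mul1r; congr (_ * _); rewrite mulrC.
rewrite TE NE.
have -> : konst (d%:R^-1 / lab_value r) * Peval pf T v x (1 - eps c) -
   konst ((lab_value r)^-1 * branch_residue u x) * ((1 - eps c) ^+ n / geo (eps c) d) / eps c =
   konst (d%:R^-1 / lab_value r) * (Peval pf T v x (1 - eps c) - konst (branch_residue u x) / eps c)
   + konst ((lab_value r)^-1 * branch_residue u x) * h.
  have -> : h = (konst d%:R^-1 - (1 - eps c) ^+ n / geo (eps c) d) / eps c.
    by rewrite hE mulrC mulKf // eps_neq0.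
  rewrite !rmorphM /= mulrBr mulrBl mulrBr addrA; congr (_ - _); last by rewrite !mulrA.
  rewrite -[LHS]addr0 -addrA; congr (_ + _); rewrite addrC.
  apply/eqP; rewrite eq_sym subr_eq0; apply/eqP; rewrite !mulrA; congr (_ / _).
  by rewrite mulrC !mulrA.
apply: (regularD pf_inj); apply: (regularM pf_inj) => //; exact: regular_konst.
Qed.

(** By [vanord_neg], a negative order would make the twisted labelling one of a
    branch, with a value different from [1] at the root. *)
Lemma val_generic r : labelling T r -> ~~ trivial_on T (twist c r) ->
  (forall u, u \in nbrs T v -> labelling (br u) (twist c r) -> twist c r u = 1) ->
  val_at c (Hterm r) (d%:R^-1 * (lab_value r)^-1 * limit_at1 T v (twist c r)).
Proof.
move=> lr nt ns; have relx w : w \in T -> w != v -> rel_at T (twist c r) w.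
  by move=> _; exact: rel_at_twist.
have o0 : 0 <= vanord T (twist c r).
  rewrite leNgt; apply/negP => o0.
  have [xv [u [uN xu tw]]] := vanord_neg Gacyclic cT vT relx nt o0.
  move/eqP: xu; apply; apply: ns => //; apply/labellingP; split=> [w wB|w|w wB].
  - have [->//|wv] := eqVneq w v.
    have [y yN wy] := branch_exists cT vT (in_setT w) wv.
    have yu : y != u by apply: contraNneq wB => <-.
    exact: (trivP _ _ (tw y yN yu)).
  - exact: twist_neq0.
  - apply/(rel_at_branch Gacyclic vT uN wB) => //; apply: relx (in_setT w) _.
    by have [] := branch_mem uN wB.
rewrite Hterm_twist; apply: (val_atM pf_inj); first exact: val_konst.
exact: val_Peval.
Qed.

(** The terms of [principal_part] that compensate the pole of [Hterm r] at [c].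
    *)
Definition local_part r : K := (if trivial_on T (twist c r) then double_part T v n tvar else 0) +
  \sum_(u in nbrs T v)
    (if labelling (br u) (twist c r) && (twist c r u != 1) then branch_pole u (twist c r) else 0).

Lemma regular_local_part r : labelling T r -> regular c (Hterm r - local_part r).
Proof.
move=> lr; rewrite /local_part; have [tr|nt] := boolP (trivial_on T (twist c r)).
  rewrite big1 ?addr0 => [|u uN]; first by eexists; exact: val_triv.
  by rewrite (trivP _ _ tr _ (in_setT u)) eqxx andbF.
rewrite add0r.
have [/exists_inP[u uN /andP[lB xu]]|/exists_inPn ns] :=
  boolP [exists u in nbrs T v, labelling (br u) (twist c r) && (twist c r u != 1)].
  rewrite (bigD1 u) //= lB xu big1 ?addr0 => [|w /andP[wN wu]].
    exact: regular_special.
  case: ifP => // /andP[/labellingP[woff _ _] _]; case/eqP: xu; apply: woff.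
  by apply: contra wu => uB; apply/eqP/esym; exact: branch_root_uniq wN uN uB.
rewrite big1 ?subr0 => [|u uN]; last by rewrite (negbTE (ns u uN)).
eexists; apply: val_generic => // u uN lB; apply/eqP; apply: contraNT (ns u uN) => xu.
by rewrite lB.
Qed.

End AtPoint.

Lemma HlabE : Hlab = \sum_(r <- labellings C T) Hterm r.
Proof.
by rewrite /Hlab mulr_sumr; apply: eq_bigr => r _; rewrite mulrA /Hterm rmorphM.
Qed.

Lemma val_frac c b : b * c ^+ d != 1 ->
  val_at c (tvar ^+ n / (1 - konst b * tvar ^+ d)) (c ^+ n / (1 - b * c ^+ d)).
Proof.
move=> bc; apply: (val_atM pf_inj); first by apply: (val_atX pf_inj); exact: val_tvar.
apply: val_atV; first by rewrite subr_eq0 eq_sym.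
apply: (val_atB pf_inj); first exact: val_at1.
apply: (val_atM pf_inj); first exact: val_konst.
by apply: (val_atX pf_inj); exact: val_tvar.
Qed.

Lemma regular_branch_pole c u r : r u * c ^+ d != 1 -> regular c (branch_pole u r).
Proof.
move=> h; apply: (regularM pf_inj); first exact: regular_konst.
by eexists; exact: val_frac.
Qed.

Lemma double_partE : double_part T v n tvar = konst (wt T v v)%:R^-1 *
  (tvar ^+ n / (1 - tvar ^+ d) *
    (konst (n%:R - alphaC C T v / 2) + konst d%:R * tvar ^+ d / (1 - tvar ^+ d))).
Proof.
rewrite /double_part fmorphV rmorph_nat rmorphB rmorphM fmorphV !rmorph_nat.
by rewrite -(konst_alphaC pf).
Qed.

Lemma regular_double_part c : c ^+ d != 1 -> regular c (double_part T v n tvar).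
Proof.
move=> h; rewrite double_partE.
have h1 : 1 * c ^+ d != 1 by rewrite mul1r.
have [a va] : regular c (tvar ^+ n / (1 - tvar ^+ d)).
  by eexists; have := val_frac h1; rewrite rmorph1 mul1r; apply.
have [b vb] : regular c (1 - tvar ^+ d)^-1.
  exists (1 - c ^+ d)^-1; apply: val_atV; first by rewrite subr_eq0 eq_sym.
  apply: (val_atB pf_inj); first exact: val_at1.
  by apply: (val_atX pf_inj); exact: val_tvar.
apply: (regularM pf_inj); first exact: regular_konst.
apply: (regularM pf_inj); first by exists a.
apply: (regularD pf_inj); first exact: regular_konst.
apply: (regularM pf_inj); last by exists b.
apply: (regularM pf_inj); first exact: regular_konst.
by eexists; apply: (val_atX pf_inj); exact: val_tvar.
Qed.

(** The terms of [principal_part] that are singular at [c] are matched with the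
    terms of [Hlab] that they compensate; all others are regular at [c]. *)
Lemma regular_diff c : c != 0 -> regular c (Hlab - principal_part).
Proof.
move=> c0.
have -> : Hlab - principal_part = \sum_(r <- labellings C T) (Hterm r - local_part c r)
   - ((double_part T v n tvar - \sum_(r <- labellings C T | trivial_on T (twist c r)) double_part T v n tvar)
      + \sum_(u in nbrs T v)
          \sum_(r <- labellings C (br u) | (r u != 1) && (r u * c ^+ d != 1)) branch_pole u r).
  rewrite HlabE /principal_part [in RHS]big_split /= sumrN /local_part [in RHS]big_split /=.
  rewrite -big_mkcond exchange_big /=.
  have -> : \sum_(u in nbrs T v) \sum_(r <- labellings C T)
      (if labelling (br u) (twist c r) && (twist c r u != 1) then branch_pole u (twist c r) else 0)
    = \sum_(u in nbrs T v) \sum_(r <- labellings C (br u) | (r u != 1) && (r u * c ^+ d == 1)) branch_pole u r.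
    by apply: eq_bigr => u uN; rewrite -big_mkcond /= twist_perm.
  have -> : \sum_(u in nbrs T v) \sum_(r <- labellings C (br u) | r u != 1) branch_pole u r =
    \sum_(u in nbrs T v) \sum_(r <- labellings C (br u) | (r u != 1) && (r u * c ^+ d == 1)) branch_pole u r
    + \sum_(u in nbrs T v) \sum_(r <- labellings C (br u) | (r u != 1) && (r u * c ^+ d != 1)) branch_pole u r.
    rewrite -big_split; apply: eq_bigr => u uN /=.
    by rewrite (bigID (fun r : {ffun G -> C} => r u * c ^+ d == 1)).
  have alg (a1 a2 a3 a4 a5 : K) :
      a1 - (a2 + (a3 + a4)) = a1 - (a5 + a3) - (a2 - a5 + a4) by ring.
  exact: alg.
apply: (regularB pf_inj).
  rewrite big_seq; apply: (regular_sum pf_inj) => r.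
  by rewrite (mem_labellings Gacyclic Gneg _ cT); exact: regular_local_part.
apply: (regularD pf_inj); last first.
  apply: (regular_sum pf_inj) => u _; apply: (regular_sum pf_inj) => r /andP[_].
  exact: regular_branch_pole.
(* [double_part] is singular at [c] when [c^d = 1]; then exactly one labelling
   becomes trivial when twisted by [c]. *)
have [cd|cd] := eqVneq (c ^+ d) 1; last first.
  rewrite big_seq_cond big1 ?subr0; first exact: regular_double_part.
  move=> r /andP[]; rewrite (mem_labellings Gacyclic Gneg _ cT) => lr tr.
  have := twist_root c0 lr; rewrite big1; last first.
    by move=> w _; exact: (trivP _ _ tr _ (in_setT w)).
  by rewrite (trivP _ _ tr _ vT) exp1rz !mul1r => /eqP; rewrite (negbTE cd).
pose r0 : {ffun G -> C} := twist c^-1 [ffun=> 1].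
have lr0 : labelling T r0.
  apply/labellingP; split=> [w|w|w _]; first by rewrite in_setT.
    by rewrite !ffunE mul1r expf_neq0 // invr_neq0.
  rewrite /rel_at twist_rel ?invr_neq0 // ffunE exp1rz big1 => [|u _]; last by rewrite ffunE.
  have [_|_] := eqVneq w v; last by rewrite mulr0 oppr0 expr0z !mul1r.
  by rewrite !mul1r mulr1 -exprnN exprVn invrK cd.
have triv_r0 r : trivial_on T (twist c r) -> r = r0.
  move=> /trivP tr; rewrite -[r](twistK c0); congr twist; apply/ffunP => w.
  by rewrite (tr w (in_setT w)) ffunE.
rewrite big_mkcond (bigD1_seq r0) ?labellings_uniq ?(mem_labellings Gacyclic Gneg _ cT) //=.
rewrite big1 ?addr0 => [|r rr0]; last by case: ifP => // /triv_r0 e; rewrite e eqxx in rr0.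
rewrite ifT ?subrr; first exact: regular0.
by apply/trivP => w _; rewrite twistVK // ffunE.
Qed.

(** At [0] every factor of [P] takes the value [1], and no twist is needed. *)
Lemma regular_diff0 : regular 0 (Hlab - principal_part).
Proof.
have dn0 : d != 0%N by rewrite -lt0n dsc_gt0.
have e0 b : b * 0 ^+ d != 1 by rewrite expr0n (negbTE dn0) mulr0 eq_sym oner_neq0.
apply: (regularB pf_inj).
  rewrite HlabE; apply: (regular_sum pf_inj) => r _.
  apply: (regularM pf_inj); first exact: regular_konst.
  eexists; apply: (val_prod pf_inj) => w _; apply: (val_atXz pf_inj).
    exact: oner_neq0.
  have a0 := wt_gt0 Gacyclic Gneg cT (in_setT w) vT.
  have := val_atB pf_inj (val_at1 pf 0) (val_atM pf_inj (val_konst pf 0 (r w))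
     (val_atX pf_inj (wt T w v) (val_tvar pf 0))).
  by rewrite expr0n; case: (wt T w v) a0 => // k _; rewrite mulr0 subr0.
apply: (regularD pf_inj); first by apply: regular_double_part; have := e0 1; rewrite mul1r.
apply: (regular_sum pf_inj) => u _; apply: (regular_sum pf_inj) => r _.
exact: regular_branch_pole.
Qed.

Lemma negdeg_principal_part : negdeg pf principal_part.
Proof.
apply: (negdegD pf_inj).
  by rewrite double_partE; apply: negdegZ; exact: negdeg_frac2.
apply: (negdeg_sum pf_inj) => u uN; rewrite big_seq_cond.
apply: (negdeg_sum pf_inj) => r /andP[].
rewrite (mem_labellings Gacyclic Gneg _ (conn_branch uN)) => /labellingP[_ r0 _] _.
by apply: negdegZ; exact: negdeg_frac.
Qed.

(** The summands come from the trivial character, from the other characters of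
    the whole group, and from the poles of the branches. *)
Definition regular_value : C := double_value C T v n
  + \sum_(r <- labellings C T | r != [ffun=> 1]) d%:R^-1 * (lab_value r)^-1 * limit_at1 T v r
  - \sum_(u in nbrs T v) \sum_(r <- labellings C (br u) | r u != 1)
      (lab_value r)^-1 * branch_residue u r / (1 - r u).

Lemma lab_one A : labelling A ([ffun=> 1] : {ffun G -> C}).
Proof.
apply/labellingP; split=> [w _|w|w _]; rewrite ?ffunE ?oner_neq0 //.
by rewrite /rel_at ffunE exp1rz mul1r big1 // => u _; rewrite ffunE.
Qed.

Lemma val_diff1 : val_at 1 (Hlab - principal_part) regular_value.
Proof.
have o1 : (1 : C) != 0 by exact: oner_neq0.
have l1 : [ffun=> 1] \in labellings C T by rewrite (mem_labellings Gacyclic Gneg _ cT) lab_one.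
rewrite HlabE /principal_part (bigD1_seq _ l1) ?labellings_uniq //= opprD addrACA addrA.
rewrite /regular_value; apply: (val_atB pf_inj); last first.
  apply: (val_sum pf_inj) => u uN; apply: (val_sum pf_inj) => r ru.
  apply: (val_atM pf_inj); first exact: val_konst.
  have h : r u * 1 ^+ d != 1 by rewrite expr1n mulr1.
  by have := val_frac h; rewrite !expr1n mulr1 mul1r.
apply: (val_atD pf_inj).
  have tr : trivial_on T (twist 1 [ffun=> 1]) by apply/trivP => w _; rewrite twist1 ffunE.
  by have := val_triv o1 (lab_one T) tr; rewrite expr1n mul1r.
rewrite big_seq_cond [X in val_at _ _ X]big_seq_cond.
apply: (val_sum pf_inj) => r /andP[]; rewrite (mem_labellings Gacyclic Gneg _ cT) => lr r1.
have := @val_generic 1 o1 r lr; rewrite twist1; apply.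
  apply: contra r1 => /trivP tr; by apply/eqP/ffunP => w; rewrite (tr w (in_setT w)) ffunE.
move=> u uN lB; have := twist_root o1 lr; rewrite twist1 expr1n mulr1.
by rewrite (lab_br_prod uN lB).
Qed.

(** The difference is regular everywhere, hence a polynomial, whose value at [1]
    is found term by term. *)
Lemma polynomial_part : exists p, Hlab = pf p + principal_part /\ p.[1] = regular_value.
Proof.
have [p pE] : exists p, Hlab - principal_part = pf p.
  apply: (regular_everywhere pf_inj) => c; have [->|c0] := eqVneq c 0.
    exact: regular_diff0.
  exact: regular_diff.
exists p; rewrite -pE subrK; split=> //.
by apply: (val_at_inj pf_inj (val_poly pf 1 p)); rewrite -pE; exact: val_diff1.
Qed.

End Main.

(** * Subgraphs as graphs *)

Section Whole.
Variable P : plumbing.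
Implicit Types (x y z u v w : P).
Hypothesis Pneg : negative_definite P.
Let T : {set P} := [set: P].

Lemma ninter_mxT : ninter_mx T = map_mx intr (- inter_mx P).
Proof.
by apply/matrixP => i j; rewrite !mxE !in_setT /= /ninter rmorphN.
Qed.

Lemma dG_disc : (dG P)%:~R = disc T.
Proof. by rewrite /disc ninter_mxT det_map_mx. Qed.

Lemma inv_green u w :
  invmx (map_mx intr (inter_mx P)) (enum_rank u) (enum_rank w) = - green T u w.
Proof.
have -> : map_mx intr (inter_mx P) = -1 *: ninter_mx T.
  by rewrite ninter_mxT map_mxN scaleN1r opprK.
rewrite invmxZ; last by rewrite unitmxZ ?unitrN1 ?ninter_mx_unit.
by rewrite mxE invrN1 mulN1r /green !in_setT.
Qed.

Lemma formQ_green (a b : dual_lat P) : formQ a b =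
  - \sum_u \sum_w (a u)%:~R * (b w)%:~R * green T u w.
Proof.
rewrite -sumrN; apply: eq_bigr => u _; rewrite -sumrN; apply: eq_bigr => w _.
by rewrite inv_green mulrN.
Qed.

Lemma formQ_Estarr (a : dual_lat P) w :
  formQ a (Estar w) = - \sum_u (a u)%:~R * green T u w.
Proof.
rewrite formQ_green; congr (- _); apply: eq_bigr => u _.
rewrite (bigD1 w) //= ffunE eqxx mulr1 big1 ?addr0 // => z zw.
by rewrite ffunE (negbTE zw) mulr0 mul0r.
Qed.

Lemma formQ_Estar u w : formQ (Estar u) (Estar w) = - green T u w.
Proof.
rewrite formQ_Estarr (bigD1 u) //= ffunE eqxx mul1r big1 ?addr0 // => z zu.
by rewrite ffunE (negbTE zu) mul0r.
Qed.

Lemma acoefE u w : acyclic_graph P -> connected_set T -> acoef u w = (wt T u w)%:Z.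
Proof.
move=> acy cT; rewrite /acoef formQ_Estar dG_disc mulrN opprK.
by rewrite -(wtE acy Pneg cT) ?in_setT // pmulrn intrKfloor.
Qed.

Lemma degE w : deg w = #|nbrs T w|.
Proof. by apply: eq_card => u; rewrite !inE. Qed.

Lemma conn_setT : connected_graph P -> connected_set T.
Proof.
move=> h x y _ _; apply: connect_sub (h x y) => {}x {}y xy.
by apply: connect1; rewrite /adj_in !in_setT.
Qed.

End Whole.

Section Induced.
Variables (G : plumbing) (A : {set G}).
Hypothesis Gneg : negative_definite G.
Let P := induced_graph A.
Implicit Types (x y u v w : P) (S : {set P}).

Lemma sum_induced (R : nmodType) (F : G -> R) :
  (forall z : G, z \notin A -> F z = 0) -> \sum_(x : P) F (val x) = \sum_z F z.
Proof.
move=> F0; rewrite [RHS](bigID (mem A)) /= [X in _ = _ + X]big1 ?addr0 //.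
by symmetry; exact: big_sub.
Qed.

Lemma inter_induced x y : inter x y = inter (val x) (val y).
Proof. by rewrite /inter -val_eqE. Qed.

Lemma negative_induced : negative_definite P.
Proof.
move=> f f0; pose g : lat G := [ffun z => if insub z is Some x then f x else 0].
have gE x : g (val x) = f x by rewrite ffunE valK.
have gN (z : G) : z \notin A -> g z = 0 by move=> zA; rewrite ffunE insubN.
have g0 : g != 0.
  by apply: contra_neq f0 => g0; apply/ffunP => x; rewrite -gE g0 !ffunE.
have := Gneg g0; suff -> : formL g g = formL f f by [].
rewrite /formL -sum_induced; last by move=> z /gN ->; rewrite big1 // => w _; rewrite !mul0r.
apply: eq_bigr => x _; rewrite -sum_induced; last by move=> z /gN ->; rewrite mulr0 mul0r.
by apply: eq_bigr => y _; rewrite !gE inter_induced.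
Qed.

Lemma acyclic_induced : acyclic_graph G -> acyclic_graph P.
Proof.
move=> acy c cs; have := acy (map val c); rewrite size_map => /(_ cs).
apply: contra; rewrite /ucycleb map_inj_uniq ?cycle_map //; exact: val_inj.
Qed.

Lemma conn_induced : connected_set A -> connected_set [set: P].
Proof.
move=> cA x y _ _; have := cA _ _ (valP x) (valP y).
suff H (z : G) (zA : z \in A) : connect (adj_in A) (val x) z ->
    connect (adj_in [set: P]) x (Sub z zA).
  by move/(H _ (valP y)); rewrite (_ : Sub _ _ = y) //; apply: val_inj; rewrite SubK.
case/connectP => p + zE; move: zA; rewrite {}zE.
elim/last_ind: p => [xA _|p w IH].
  by rewrite (_ : Sub _ _ = x) ?connect0 //; apply: val_inj; rewrite SubK.
rewrite rcons_path last_rcons => wA /andP[pp /and3P[lA _ lw]].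
apply: connect_trans (IH lA pp) (connect1 _).
by rewrite /adj_in !in_setT /= /induced_adj !SubK.
Qed.

Definition lift_set S : {set G} := [set val x | x in S].

Lemma mem_lift_set S x : (val x \in lift_set S) = (x \in S).
Proof. by rewrite mem_imset //; exact: val_inj. Qed.

Lemma lift_set_sub S (z : G) : z \in lift_set S -> z \in A.
Proof. by case/imsetP => x _ ->; exact: valP. Qed.

(** Both sides solve the same equations in the induced graph. *)
Lemma green_lift_set S x y : green S x y = green (lift_set S) (val x) (val y).
Proof.
have [yS|yS] := boolP (y \in S); last by rewrite !green_offr ?mem_lift_set.
move: x; apply: (@green_uniq _ negative_induced S) => x xS.
  by rewrite !green_offl ?mem_lift_set.
rewrite (greenE negative_induced) //.
transitivity (\sum_(z : P) ninter (val x) (val z) * green (lift_set S) (val z) (val y)).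
  rewrite (@sum_induced _ (fun z : G => ninter (val x) z * green (lift_set S) z (val y))).
    by rewrite (greenE Gneg) ?mem_lift_set // val_eqE.
  move=> z zA; rewrite green_offl ?mulr0 //; apply: contra zA; exact: lift_set_sub.
by apply: eq_bigr => z _; rewrite /ninter inter_induced.
Qed.

(** By [disc_green], determinants are built from values of [green]. *)
Lemma disc_lift_set S : disc S = disc (lift_set S).
Proof.
elim: {S}_.+1 {-2}S (ltnSn #|S|) => // k IH S Sk.
have [->|[x xS]] := set_0Vmem S; first by rewrite /lift_set imset0 !disc0.
have xI : val x \in lift_set S by rewrite mem_lift_set.
apply: (mulIf (lt0r_neq0 (green_gt0 negative_induced xS))).
rewrite (disc_green negative_induced) // IH; last first.
  by move: Sk; rewrite (cardsD1 x) xS add1n ltnS.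
rewrite green_lift_set (disc_green Gneg) //; congr disc; apply/setP => z.
rewrite in_setD1; apply/imsetP/andP => [[y + ->]|[zx /imsetP[y yS zE]]].
  by rewrite in_setD1 mem_lift_set val_eqE => /andP.
by exists y; rewrite // in_setD1 yS andbT -val_eqE -zE.
Qed.

Lemma lift_set_setT : lift_set [set: P] = A.
Proof.
apply/setP => z; apply/idP/idP => [/lift_set_sub//|zA].
by apply/imsetP; exists (Sub z zA); rewrite ?in_setT ?SubK.
Qed.

Lemma wt_induced x y : wt [set: P] x y = wt A (val x) (val y).
Proof. by rewrite /wt disc_lift_set green_lift_set lift_set_setT. Qed.

Lemma dsc_induced : dsc [set: P] = dsc A.
Proof. by rewrite /dsc disc_lift_set lift_set_setT. Qed.

Lemma nbrs_induced x : lift_set (nbrs [set: P] x) = nbrs A (val x).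
Proof.
apply/setP => z; apply/idP/nbrsP => [/imsetP[y /nbrsP[_ xy] ->]|[zA xz]].
  by split; [exact: valP | exact: xy].
apply/imsetP; exists (Sub z zA); rewrite ?SubK //; apply/nbrsP.
by split; rewrite ?in_setT //= /induced_adj SubK.
Qed.

Lemma dg_induced x : dg [set: P] x = dg A (val x).
Proof. by rewrite /dg -nbrs_induced card_imset //; exact: val_inj. Qed.

Section Labels.
Variable C : numFieldType.
Variables (r : G -> C).

Lemma prod_nbrs_induced x (F : G -> C) :
  \prod_(u in nbrs [set: P] x) F (val u) = \prod_(u in nbrs A (val x)) F u.
Proof. by rewrite -nbrs_induced big_imset //; exact: in2W val_inj. Qed.

Lemma rel_at_induced x :
  rel_at [set: P] (fun y => r (val y)) x <-> rel_at A r (val x).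
Proof. by rewrite /rel_at (prod_nbrs_induced x r). Qed.

Lemma vanord_induced : vanord [set: P] (fun y => r (val y)) = vanord A r.
Proof.
rewrite /vanord [RHS]big_sub; apply: eq_big => x; first by rewrite in_setT.
by rewrite dg_induced.
Qed.

Lemma lead_induced x : lead [set: P] x (fun y => r (val y)) = lead A (val x) r.
Proof.
rewrite /lead [RHS]big_sub; apply: eq_big => y; first by rewrite in_setT.
by rewrite dg_induced wt_induced.
Qed.

Lemma adm_induced x : admissible [set: P] (fun y => r (val y)) x = admissible A r (val x).
Proof.
rewrite /admissible -nbrs_induced; congr (_ || _); apply/exists_inP/exists_inP.
  by case=> y yN ry; exists (val y) => //; exact: imset_f.
by case=> z /imsetP[y yN ->] ry; exists y.
Qed.

End Labels.
End Induced.

(** * Limits of P at t = 1 *)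

Section Limit.
Variable C : numFieldType.
Local Open Scope classical_set_scope.

Lemma cvg_expn (T : Type) (F : set_system T) (FF : Filter F) (f : T -> C) (a : C) n :
  f x @[x --> F] --> a -> (f x ^+ n) @[x --> F] --> a ^+ n.
Proof.
move=> fa; elim: n => [|n IH].
  by under eq_fun do rewrite expr0; rewrite expr0; exact: cvg_cst.
by under eq_fun do rewrite exprS; rewrite exprS; exact: cvgM.
Qed.

Lemma cvg_expz (T : Type) (F : set_system T) (FF : Filter F) (f : T -> C) (a : C) (e : int) :
  a != 0 -> f x @[x --> F] --> a -> (f x ^ e) @[x --> F] --> a ^ e.
Proof.
move=> a0 fa; case: e => n; first exact: cvg_expn.
rewrite NegzE -exprnN; under eq_fun do rewrite -exprnN.
by apply: cvgV; [rewrite expf_neq0 | exact: cvg_expn].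
Qed.

Lemma cvg_bigprod (T : Type) (F : set_system T) (FF : Filter F) (I : finType)
    (P : pred I) (f : I -> T -> C) (a : I -> C) :
  (forall i, P i -> f i x @[x --> F] --> a i) ->
  (\prod_(i | P i) f i x) @[x --> F] --> \prod_(i | P i) a i.
Proof.
move=> H; elim: (index_enum I) => [|i s IH].
  by under eq_fun do rewrite big_nil; rewrite big_nil; exact: cvg_cst.
under eq_fun do rewrite big_cons; rewrite big_cons; case: ifP => // Pi.
by apply: cvgM => //; exact: H.
Qed.

Lemma cvg_bigsum (T : Type) (F : set_system T) (FF : Filter F) n
    (f : 'I_n -> T -> C) (a : 'I_n -> C) :
  (forall i, f i x @[x --> F] --> a i) ->
  (\sum_(i < n) f i x) @[x --> F] --> \sum_(i < n) a i.
Proof.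
move=> H; elim: (index_enum _) => [|i s IH].
  by under eq_fun do rewrite big_nil; rewrite big_nil; exact: cvg_cst.
under eq_fun do rewrite big_cons; rewrite big_cons.
by apply: cvgD => //; exact: H.
Qed.

Lemma cvg_id1 : (t @[t --> (1 : C)^']) --> (1 : C).
Proof. by apply: cvg_within_filter; exact: cvg_id. Qed.

Variable G : plumbing.
Hypothesis Gacyclic : acyclic_graph G.
Hypothesis Gneg : negative_definite G.

(** Once the powers of [1 - t] are factored out, the product is continuous at
    [1]. *)
Lemma cvg_limit_at1 (A : {set G}) v (r : G -> C) : connected_set A -> v \in A -> 0 <= vanord A r ->
  (\prod_(w in A) (1 - r w * t ^+ wt A w v) ^ dg A w) @[t --> (1 : C)^'] -->
  (if vanord A r == 0 then lead A v r else 0).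
Proof.
move=> cA vA o0.
pose g (t : C) := (1 - t) ^ vanord A r * \prod_(w in A)
  (if r w == 1 then \sum_(k < wt A w v) t ^+ k else 1 - r w * t ^+ wt A w v) ^ dg A w.
have eg : \forall t \near (1 : C)^',
    g t = \prod_(w in A) (1 - r w * t ^+ wt A w v) ^ dg A w.
  near=> t; have t1 : t != 1 by near: t; exact: nbhs_dnbhs_neq.
  have e0 : 1 - t != 0 by rewrite subr_eq0 eq_sym.
  rewrite /g /vanord -prod_expz // -big_split /=; apply: eq_bigr => w wA.
  case: eqP => [->|_]; last by rewrite expr0z mul1r.
  rewrite mul1r -expfzMl; congr (_ ^ _).
  by rewrite -[X in _ = X - _](expr1n _ (wt A w v)) subrXX; congr (_ * _);
    apply: eq_bigr => i _; rewrite expr1n mul1r.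
apply: cvg_trans; first exact: (near_eq_cvg eg).
have -> : (if vanord A r == 0 then lead A v r else 0) =
  (if vanord A r == 0 then 1 else 0) * lead A v r.
  by case: ifP; rewrite ?mul1r ?mul0r.
apply: cvgM.
  case: (vanord A r) o0 => // -[|k] _ /=.
    by under eq_fun do rewrite expr0z; exact: cvg_cst.
  have h : (1 - t) ^+ k.+1 @[t --> (1 : C)^'] --> (1 - 1 : C) ^+ k.+1.
    by apply: cvg_expn; apply: cvgB; [exact: cvg_cst | exact: cvg_id1].
  by rewrite subrr expr0n in h; exact: h.
apply: cvg_bigprod => w wA; apply: cvg_expz.
  by apply: lead_factor_neq0; exact: wt_gt0.
rewrite /lead_factor; case: ifP => _.
  rewrite -[X in X%:R]card_ord -sumr_const; apply: cvg_bigsum => i.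
  by rewrite -[X in _ --> X](expr1n _ i); apply: cvg_expn; exact: cvg_id1.
apply: cvgB; first exact: cvg_cst.
rewrite -[X in _ --> X]mulr1; apply: cvgM; first exact: cvg_cst.
by rewrite -[X in _ --> X](expr1n _ (wt A w v)); apply: cvg_expn; exact: cvg_id1.
Unshelve. all: by end_near.
Qed.

End Limit.

(** * Characters and labellings *)

Section Chars.
Variables (C : numClosedFieldType) (P : plumbing).
Implicit Types (x y z u v w : P) (r : {ffun P -> C}) (rho : Hgrp P -> C).
Hypothesis Pacyclic : acyclic_graph P.
Hypothesis Pneg : negative_definite P.
Let T : {set P} := [set: P].
Hypothesis cT : connected_set T.

Lemma lab_valueD r (a b : dual_lat P) : (forall w, r w != 0) ->
  lab_value (a + b) r = lab_value a r * lab_value b r.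
Proof.
move=> r0; rewrite /lab_value -big_split; apply: eq_bigr => w _.
by rewrite ffunE expfzDr.
Qed.

Lemma lab_value_Estar r w : lab_value (Estar w) r = r w.
Proof.
rewrite /lab_value (bigD1 w) //= ffunE eqxx expr1z big1 ?mulr1 // => u uw.
by rewrite ffunE (negbTE uw) expr0z.
Qed.

Lemma lab_value_inter r u : \prod_w r w ^ inter u w =
  r u ^ euler u * \prod_(w in nbrs T u) r w.
Proof.
rewrite (bigD1 u) //= {1}/inter eqxx; congr (_ * _).
rewrite (bigID (mem (nbrs T u))) /= [X in _ * X]big1 ?mulr1 => [|w /andP[wu wN]].
  apply: eq_big => [w|w /andP[wu wN]].
    by apply: andb_idl => /nbrsD1; rewrite in_setD1 => /andP[].
  have [_ uw] := nbrsP _ _ _ wN.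
  by rewrite /inter eq_sym (negbTE wu) uw expr1z.
rewrite /inter eq_sym (negbTE wu); case: (boolP (adj u w)) => // uw.
by case/negP: wN; apply/nbrsP; rewrite in_setT.
Qed.

(** The relations express triviality on the generators [E_u] of [L]. *)
Lemma lab_value_dual_of r (c : lat P) : labelling T r -> lab_value (dual_of c) r = 1.
Proof.
case/labellingP => _ r0 rr; rewrite /lab_value.
transitivity (\prod_u (\prod_w r w ^ inter u w) ^ c u).
  have -> : \prod_u (\prod_w r w ^ inter u w) ^ c u =
            \prod_u \prod_w r w ^ (c u * inter u w).
    apply: eq_bigr => u _.
    rewrite (big_morph (fun x : C => x ^ c u) (id1 := 1) (op1 := *%R)) ?exp1rz //.
      by apply: eq_bigr => w _; rewrite exprz_exp mulrC.
    by move=> x y; rewrite expfzMl.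
  rewrite exchange_big; apply: eq_bigr => w _.
  by rewrite prod_expz // ffunE.
rewrite big1 // => u _; rewrite lab_value_inter.
by have := rr u (in_setT u); rewrite /rel_at => ->; rewrite exp1rz.
Qed.

Lemma cls_eq (a b : dual_lat P) : cls a = cls b -> exists c, a = b + dual_of c.
Proof.
move=> /eqP; rewrite -Quotient.idealrBE => /asboolP[c E].
by exists c; rewrite -E addrC subrK.
Qed.

Definition char_of r : Hgrp P -> C := fun h => lab_value (repr h) r.

Lemma char_ofE r a : labelling T r -> char_of r (cls a) = lab_value a r.
Proof.
move=> lr; have [_ r0 _] := labellingP _ _ lr; rewrite /char_of.
have [c ->] : exists c, repr (cls a) = a + dual_of c.
  by apply: cls_eq; rewrite /cls reprK.
by rewrite lab_valueD // lab_value_dual_of // mulr1.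
Qed.

Lemma clsD (a b : dual_lat P) : cls (a + b) = cls a + cls b.
Proof. exact: raddfD. Qed.

Lemma char_of_Hhat r : labelling T r -> Hhat (char_of r).
Proof.
move=> lr; have [_ r0 _] := labellingP _ _ lr; split.
  rewrite -[0](raddf0 (\pi_(Hgrp P)%qT)) -/(cls _) char_ofE //.
  by rewrite /lab_value big1 // => w _; rewrite ffunE expr0z.
move=> h k; rewrite -[h]reprK -[k]reprK -/(cls _) -/(cls _) -clsD !char_ofE //.
exact: lab_valueD.
Qed.

Definition lab_of rho : {ffun P -> C} := [ffun w => rho (cls (Estar w))].

Section OneChar.
Variable rho : Hgrp P -> C.
Hypothesis hrho : Hhat rho.

Lemma Hhat_neq0 h : rho h != 0.
Proof.
case: hrho => h0 hD; apply/eqP => e; have := hD h (- h).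
by rewrite subrr h0 e mul0r => /eqP; rewrite oner_eq0.
Qed.

Lemma HhatN h : rho (- h) = (rho h)^-1.
Proof.
case: hrho => h0 hD; apply: (mulfI (Hhat_neq0 h)).
by rewrite -hD subrr h0 divff // Hhat_neq0.
Qed.

Lemma Hhat_int (z : int) h : rho (h *~ z) = rho h ^ z.
Proof.
case: hrho => h0 hD.
have N n : rho (h *+ n) = rho h ^+ n.
  by elim: n => [|n IH]; rewrite ?mulr0n ?expr0 // mulrS exprS hD IH.
by case: z => n; [exact: N | rewrite NegzE mulrNz -pmulrn HhatN N].
Qed.

Lemma ffun_mulz (f : dual_lat P) (z : int) u : (f *~ z) u = f u *~ z.
Proof.
case: z => n; first by rewrite -!pmulrn ffunMnE.
by rewrite NegzE !mulrNz ffunE -!pmulrn ffunMnE.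
Qed.

Lemma dual_sum (a : dual_lat P) : a = \sum_w Estar w *~ a w.
Proof.
apply/ffunP => u; rewrite sum_ffunE (bigD1 u) //= big1 => [|w wu].
  by rewrite addr0 ffun_mulz ffunE eqxx intz.
by rewrite ffun_mulz ffunE eq_sym (negbTE wu) mul0rz.
Qed.

(** The [E^*_w] generate [L']. *)
Lemma Hhat_lab_value a : rho (cls a) = lab_value a (lab_of rho).
Proof.
case: hrho => h0 hD.
rewrite {1}[a]dual_sum /lab_value /cls raddf_sum /=.
rewrite (big_morph rho hD h0); apply: eq_bigr => w _.
by rewrite raddfMz Hhat_int ffunE.
Qed.

Lemma lab_of_lab : labelling T (lab_of rho).
Proof.
apply/labellingP; split=> [w|w|w _]; rewrite ?in_setT // ?ffunE ?Hhat_neq0 //.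
pose c : lat P := [ffun u => (u == w)%:Z].
have : rho (cls (dual_of c)) = 1.
  rewrite (_ : cls _ = 0); first by case: hrho.
  apply/eqP; rewrite -(raddf0 (\pi_(Hgrp P)%qT)) -Quotient.idealrBE subr0.
  by apply/asboolP; exists c.
rewrite Hhat_lab_value /lab_value => E; rewrite /rel_at -lab_value_inter -[RHS]E; apply: eq_bigr => z _.
rewrite [dual_of c z]ffunE (bigD1 w) //= [c w]ffunE eqxx mul1r big1 ?addr0 // => y yw.
by rewrite [c y]ffunE (negbTE yw) mul0r.
Qed.

Lemma lab_ofK : char_of (lab_of rho) = rho.
Proof.
by apply/funext => h; rewrite -[h]reprK -/(cls _) char_ofE ?lab_of_lab // Hhat_lab_value.
Qed.

End OneChar.

Lemma char_ofK r : labelling T r -> lab_of (char_of r) = r.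
Proof.
by move=> lr; apply/ffunP => w; rewrite ffunE char_ofE // lab_value_Estar.
Qed.

Lemma sum_chars (V : nmodType) (A : set (Hgrp P -> C)) (s : seq {ffun P -> C})
    (F : (Hgrp P -> C) -> V) : uniq s ->
  (forall r, r \in s -> labelling T r /\ A (char_of r)) ->
  (forall rho, A rho -> Hhat rho /\ lab_of rho \in s) ->
  \sum_(rho \in A) F rho = \sum_(r <- s) F (char_of r).
Proof.
move=> us sA As; rewrite (fsbigE [seq char_of r | r <- s]).
- rewrite big_map big_seq_cond [RHS]big_seq_cond; apply: eq_bigl => r.
  rewrite andbT; apply: andb_idr => /sA[_ h]; exact: mem_set.
- rewrite map_inj_in_uniq // => r1 r2 /sA[l1 _] /sA[l2 _] e.
  by rewrite -(char_ofK l1) e char_ofK.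
- by move=> rho /= /mapP[r /sA[_ h] ->].
- move=> rho /As[h1 h2] /negP[]; apply/mapP; exists (lab_of rho) => //.
  by rewrite lab_ofK.
Qed.

Lemma sum_Hhat (V : nmodType) (F : (Hgrp P -> C) -> V) :
  \sum_(rho \in @Hhat C P) F rho = \sum_(r <- labellings C T) F (char_of r).
Proof.
apply: sum_chars; first exact: labellings_uniq.
  by move=> r; rewrite (mem_labellings Pacyclic Pneg) // => lr; split=> //; exact: char_of_Hhat.
by move=> rho hr; rewrite (mem_labellings Pacyclic Pneg) //; split=> //; exact: lab_of_lab.
Qed.

Lemma char_of_one : char_of [ffun=> 1] = fun=> 1.
Proof.
by apply/funext => h; rewrite /char_of /lab_value big1 // => w _; rewrite ffunE exp1rz.
Qed.

Lemma sum_Hhat1 (V : nmodType) (F : (Hgrp P -> C) -> V) :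
  \sum_(rho \in (@Hhat C P `\ (fun=> 1))%classic) F rho =
  \sum_(r <- labellings C T | r != [ffun=> 1]) F (char_of r).
Proof.
rewrite -[RHS]big_filter; apply: sum_chars.
- by rewrite filter_uniq ?labellings_uniq.
- move=> r; rewrite mem_filter (mem_labellings Pacyclic Pneg) // => /andP[r1 lr].
  split=> //; split; first exact: char_of_Hhat.
  by move=> e; case/eqP: r1; rewrite -(char_ofK lr) e -char_of_one char_ofK ?lab_one.
- move=> rho [hr r1]; split=> //; rewrite mem_filter (mem_labellings Pacyclic Pneg) //.
  rewrite lab_of_lab // andbT; apply/eqP => e; apply: r1.
  by rewrite /= -(lab_ofK hr) e char_of_one.
Qed.

Lemma torsion_vertexE r u : labelling T r ->
  torsion_vertex (char_of r) u = admissible T r u.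
Proof.
move=> lr; rewrite /torsion_vertex /admissible char_ofE // lab_value_Estar; congr (_ || _).
apply/existsP/exists_inP => -[w].
  by rewrite char_ofE // lab_value_Estar => /andP[uw rw]; exists w => //; apply/nbrsP; rewrite in_setT.
by case/nbrsP => _ uw rw; exists w; rewrite char_ofE // lab_value_Estar uw.
Qed.

Lemma PfunE (K : fieldType) (iota : C -> K) r u (t : K) : labelling T r ->
  Defs.Pfun iota (char_of r) u t =
  \prod_(w in T) (1 - iota (r w) * t ^+ wt T w u) ^ dg T w.
Proof.
move=> lr; rewrite /Defs.Pfun; apply: eq_big => [w|w _]; first by rewrite in_setT.
rewrite char_ofE // lab_value_Estar acoefE // -wt_sym ?degE //.
Qed.

(** The torsion is defined with an arbitrary admissible vertex, so [L] has to
    give the limit at each of them. *)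
Definition computes_limits (L : {ffun P -> C} -> C) : Prop :=
  forall r u, labelling T r -> r != [ffun=> 1] -> admissible T r u -> L r = limit_at1 T u r.

Lemma torsionE (a : dual_lat P) (L : {ffun P -> C} -> C) : computes_limits L ->
  torsion C (cls a : spincM P) = (dsc T)%:R^-1 *
    \sum_(r <- labellings C T | r != [ffun=> 1]) (lab_value a r)^-1 * L r.
Proof.
move=> HL; rewrite /torsion; congr (_ * _).
  congr (_^-1); rewrite -(ratr_int C) dG_disc -(dscE Pneg).
  exact: ratr_nat.
rewrite sum_Hhat1 big_seq_cond [RHS]big_seq_cond; apply: eq_bigr => r /andP[].
rewrite (mem_labellings Pacyclic Pneg) // => lr r1.
rewrite /spincM_diff char_ofE //; congr (_ * _); rewrite /torsion_term.
case: pickP => [u|none]; last first.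
  case/eqP: r1; apply/ffunP => w; rewrite ffunE; apply/eqP.
  have := none w; rewrite torsion_vertexE // /admissible => /negbT.
  by rewrite negb_or negbK => /andP[].
rewrite torsion_vertexE // => au; rewrite (HL r u lr r1 au).
apply: cvg_lim; first exact: norm_hausdorff.
have nt : ~~ trivial_on T r.
  by apply: contra r1 => /trivP tr; apply/eqP/ffunP => w; rewrite (tr w (in_setT w)) ffunE.
have [_ _ lrel] := labellingP _ _ lr.
have o0 : 0 <= vanord T r.
  have [_ _ _ h] := ord_facts Pacyclic cT (in_setT u) (fun w wT _ => lrel w wT).
  by apply: h => //; exact: lrel (in_setT u).
under eq_fun do rewrite PfunE //.
exact: cvg_limit_at1.
Qed.

End Chars.

(** * The torsion when a vertex is deleted *)

Section LimValue.
Variables (C : numClosedFieldType) (G : plumbing).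
Implicit Types (A B : {set G}) (x y z u v w : G) (r : {ffun G -> C}).
Hypothesis Gacyclic : acyclic_graph G.
Hypothesis Gneg : negative_definite G.

(** The choice of the admissible vertex does not matter, see [adm_limitE]. *)
Definition adm_limit A (r : G -> C) : C :=
  if [pick x in A | admissible A r x] is Some x then limit_at1 A x r else 0.

Lemma adm_limitE A r u : connected_set A -> labelling A r -> u \in A -> admissible A r u ->
  adm_limit A r = limit_at1 A u r.
Proof.
move=> cA /labellingP[_ _ lr] uA au; rewrite /adm_limit.
case: pickP => [x /andP[xA ax]|/(_ u)]; last by rewrite uA au.
rewrite /limit_at1; case: eqP => // o0.
exact: (lead_adm Gacyclic Gneg cA lr uA xA o0 au ax).
Qed.

Lemma lab_adm A r : labelling A r -> r != [ffun=> 1] -> exists2 x, x \in A & admissible A r x.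
Proof.
case/labellingP => roff _ _ r1; apply: contrapT => h; case/eqP: r1.
apply/ffunP => w; rewrite ffunE; apply/eqP; apply: contrapT => /negP rw; apply: h.
exists w; last by rewrite /admissible rw.
by apply: contraT => /roff/eqP; rewrite (negbTE rw).
Qed.

Lemma lab_nontriv A r : labelling A r -> r != [ffun=> 1] -> ~~ trivial_on A r.
Proof.
case/labellingP => roff _ _; apply: contra => /trivP tr; apply/eqP/ffunP => w.
by rewrite ffunE; have [/tr|/roff] := boolP (w \in A).
Qed.

Section Induced.
Variables (A : {set G}).
Hypothesis cA : connected_set A.
Let P := induced_graph A.

(** Transports the labellings of the induced graph, so that all limits are
    computed in the ambient graph. *)
Definition extend1 (r : {ffun P -> C}) : {ffun G -> C} :=
  [ffun z => if insub z is Some x then r x else 1].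

Lemma extend1_val (r : {ffun P -> C}) (x : P) : extend1 r (val x) = r x.
Proof. by rewrite ffunE valK. Qed.

Lemma extend1_off (r : {ffun P -> C}) z : z \notin A -> extend1 r z = 1.
Proof. by move=> zA; rewrite ffunE insubN. Qed.

Lemma extend1_fun (r : {ffun P -> C}) : (fun x : P => extend1 r (val x)) = r :> (P -> C).
Proof. by apply/funext => x; rewrite extend1_val. Qed.

Lemma extend1_inj : injective extend1.
Proof. by move=> r s e; apply/ffunP => x; rewrite -!extend1_val e. Qed.

Lemma extend1_lab (r : {ffun P -> C}) : labelling A (extend1 r) = labelling [set: P] r.
Proof.
apply/labellingP/labellingP => -[h1 h2 h3]; split.
- by move=> w; rewrite in_setT.
- by move=> w; rewrite -extend1_val.
- by move=> w _; have := h3 (val w) (valP w); move/(rel_at_induced (extend1 r) w); rewrite extend1_fun.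
- exact: extend1_off.
- move=> w; have [wA|wA] := boolP (w \in A); last by rewrite extend1_off ?oner_neq0.
  by rewrite -[w](SubK P wA) extend1_val.
- move=> w wA; rewrite -[w](SubK P wA); apply/(rel_at_induced (extend1 r)).
  rewrite extend1_fun; exact: h3 (in_setT _).
Qed.

Lemma sum_labellings_induced (V : nmodType) (F : {ffun G -> C} -> V) :
  \sum_(r <- labellings C [set: P] | r != [ffun=> 1]) F (extend1 r) =
  \sum_(r <- labellings C A | r != [ffun=> 1]) F r.
Proof.
have cP := conn_induced cA; have aP := acyclic_induced (A := A) Gacyclic.
have nP := negative_induced (A := A) Gneg.
rewrite -big_filter -[RHS]big_filter -(big_map extend1 xpredT F).
apply: perm_big; apply: uniq_perm.
- by rewrite map_inj_uniq ?filter_uniq ?labellings_uniq //; exact: extend1_inj.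
- by rewrite filter_uniq ?labellings_uniq.
have e1 : extend1 [ffun=> 1] = [ffun=> 1].
  by apply/ffunP => z; rewrite !ffunE; case: insubP => // x _ _; rewrite ffunE.
move=> r; apply/mapP/idP => [[s + ->]|].
  rewrite !mem_filter (mem_labellings aP nP _ cP) (mem_labellings Gacyclic Gneg _ cA) extend1_lab.
  case/andP=> s1 ->; rewrite andbT; apply: contra s1 => /eqP e.
  by apply/eqP; apply: extend1_inj; rewrite e1.
rewrite mem_filter (mem_labellings Gacyclic Gneg _ cA) => /andP[r1 lr].
have [roff _ _] := labellingP _ _ lr.
have E : r = extend1 [ffun x : P => r (val x)].
  apply/ffunP => z; have [zA|zA] := boolP (z \in A); last by rewrite extend1_off // roff.
  by rewrite -[z](SubK P zA) extend1_val ffunE.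
exists [ffun x : P => r (val x)] => //.
rewrite mem_filter (mem_labellings aP nP _ cP) -extend1_lab -E lr andbT.
by apply: contra r1 => /eqP e; rewrite E e e1.
Qed.

Lemma computes_limits_induced : computes_limits (fun r : {ffun P -> C} => adm_limit A (extend1 r)).
Proof.
move=> r u lr r1 au; have lA : labelling A (extend1 r) by rewrite extend1_lab.
rewrite (adm_limitE cA lA (valP u)); last by rewrite -adm_induced extend1_fun.
rewrite /limit_at1 -(vanord_induced A (extend1 r)) -(lead_induced Gneg (extend1 r) u).
by rewrite extend1_fun.
Qed.

Lemma lab_value_induced (a : G -> int) (r : {ffun P -> C}) :
  lab_value (fun x : P => a (val x)) r = lab_value a (extend1 r).
Proof.
rewrite /lab_value [RHS](bigID (mem A)) /= [X in _ = _ * X]big1 ?mulr1 => [|z zA]; last first.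
  by rewrite extend1_off // exp1rz.
rewrite [RHS]big_sub; apply: eq_bigr => x _; by rewrite extend1_val.
Qed.

Lemma torsion_induced (a : dual_lat G) :
  torsion C (cls (dual_res A a : dual_lat P) : spincM P) =
  (dsc A)%:R^-1 * \sum_(r <- labellings C A | r != [ffun=> 1]) (lab_value a r)^-1 * adm_limit A r.
Proof.
have cP := conn_induced cA; have aP := acyclic_induced (A := A) Gacyclic.
have nP := negative_induced (A := A) Gneg.
rewrite (torsionE aP nP cP _ computes_limits_induced) (dsc_induced A Gneg); congr (_ * _).
rewrite -(sum_labellings_induced (fun r => (lab_value a r)^-1 * adm_limit A r)).
apply: eq_bigr => r _; congr (_^-1 * _); rewrite -lab_value_induced.
by apply: eq_bigr => x _; rewrite ffunE.
Qed.

End Induced.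

Section Difference.
Let T : {set G} := [set: G].
Hypothesis cT : connected_set T.
Variables (v : G) (l : G -> int) (n : nat).
Let d := dsc T.
Let br u := branch T v u.

Lemma torsion_whole (a : dual_lat G) :
  torsion C (cls a : spincM G) =
  (dsc T)%:R^-1 * \sum_(r <- labellings C T | r != [ffun=> 1]) (lab_value a r)^-1 * adm_limit T r.
Proof.
apply: torsionE => // r u lr _ au; exact: adm_limitE.
Qed.

(** The term of [r] in the torsion of the branch. *)
Definition branch_term u r : C := (lab_value l r)^-1 * adm_limit (br u) r / (dsc (br u))%:R.

(** The relation at [v] is the only one missing, and it reads [r u = 1]. *)
Lemma lab_br_lab u r : u \in nbrs T v -> labelling (br u) r ->
  labelling T r = (r u == 1).
Proof.
move=> uN lr; have [roff r0 rr] := labellingP _ _ lr; have rv := lab_br_v uN lr.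
apply/labellingP/eqP => [[_ _ h]|ru].
  by rewrite -(lab_br_prod Gacyclic uN lr); exact: h (in_setT v).
split=> // [w|w _]; first by rewrite in_setT.
have [->|wv] := eqVneq w v; last exact: lab_br_rel uN lr wv.
by rewrite /rel_at (lab_br_prod Gacyclic uN lr).
Qed.

(** If [v] is admissible, the limits agree and [r] is carried by no branch.
    Otherwise [r] is [1] at [v] and around it; if the order is [0], then exactly
    one branch is nontrivial, and [lead_limit] applies to it. *)
Lemma lim_difference r : labelling T r -> r != [ffun=> 1] ->
  d%:R^-1 * (lab_value l r)^-1 * (adm_limit T r - limit_at1 T v r) =
  \sum_(u in nbrs T v) if labelling (br u) r then branch_term u r else 0.
Proof.
move=> lr r1; have nt := lab_nontriv lr r1; have [_ r0 rr] := labellingP _ _ lr.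
have vT : v \in T := in_setT v.
have relx w : w \in T -> w != v -> rel_at T r w by move=> wT _; exact: rr.
have br1 u : u \in nbrs T v -> labelling (br u) r -> r u = 1.
  by move=> uN lB; apply/eqP; rewrite -(lab_br_lab uN lB).
have offbr u w : u \in nbrs T v -> labelling (br u) r -> w \in nbrs T v -> w != u ->
    trivial_on (branch T v w) r.
  move=> uN lB wN wu; apply/trivP => z zw; have [roff _ _] := labellingP _ _ lB; apply: roff.
  by apply: contra wu => zB; apply/eqP; exact: (branch_uniq Gacyclic uN wN zB zw).
have [av|nav] := boolP (admissible T r v).
  rewrite (adm_limitE cT lr vT av) subrr mulr0 big1 // => u uN; case: ifP => // lB.
  move: av; rewrite /admissible (lab_br_v uN lB) eqxx => /exists_inP[w wN]; case/eqP.
  have [->|wu] := eqVneq w u; first exact: br1.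
  exact: (trivP _ _ (offbr u w uN lB wN wu) _ (root_in_branch T v w)).
have rv := nonadm_root nav.
have [u0 u0N nt0] := nontriv_branch cT vT rv nt.
have ru0 := nonadm_nbr nav u0N.
have [ o0|o0] := eqVneq (vanord T r) 0; last first.
  have limv0 : adm_limit T r = 0.
    rewrite /adm_limit; case: pickP => // x _; by rewrite /limit_at1 (negbTE o0).
  rewrite limv0 /limit_at1 (negbTE o0) subrr mulr0 big1 // => u uN; case: ifP => // lB.
  have oE := vanord_single Gacyclic cT vT relx rv uN (fun w wN wu => offbr u w uN lB wN wu).
  rewrite /branch_ord (br1 u uN lB) eqxx addrK in oE.
  rewrite /branch_term /adm_limit; case: pickP => [x _|_]; last by rewrite mulr0 mul0r.
  by rewrite /limit_at1 -oE (negbTE o0) mulr0 mul0r.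
have tw w : w \in nbrs T v -> w != u0 -> trivial_on (branch T v w) r.
  move=> wN wu; apply: contraTT isT => ntw.
  have := nonadm_two Gacyclic cT vT relx nav wN u0N wu ntw nt0.
  by rewrite o0 ltxx.
have lB0 : labelling (br u0) r.
  apply/labellingP; split=> // [w wB|w wB].
    have [->//|wv] := eqVneq w v.
    have [y yN wy] := branch_exists cT vT (in_setT w) wv.
    have yu : y != u0 by apply: contraNneq wB => <-.
    exact: (trivP _ _ (tw y yN yu)).
  by apply/(rel_at_branch Gacyclic vT u0N wB) => //; exact: rr (in_setT w).
rewrite (bigD1 u0) //= lB0 big1 ?addr0 => [|u /andP[uN uu0]]; last first.
  case: ifP => // lB; case/negP: nt0; apply: offbr lB u0N _ => //; by rewrite eq_sym.
have oB : vanord (br u0) r = 0.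
  have := vanord_single Gacyclic cT vT relx rv u0N tw.
  by rewrite o0 /branch_ord ru0 eqxx addrK => <-.
have [x xB ax] := lab_adm lB0 r1.
have axT : admissible T r x by rewrite (adm_branch vT u0N xB rv).
have tB' : trivial_on (branch T u0 v) r.
  apply/trivP => z; rewrite (branch_back Gacyclic cT vT u0N) in_setD => /andP[zB _].
  by have [roff _ _] := labellingP _ _ lB0; exact: roff.
have key := lead_limit Gacyclic Gneg cT vT rr u0N ru0 tB' oB xB axT.
rewrite /branch_term (adm_limitE (conn_branch u0N) lB0 xB ax) (adm_limitE cT lr (in_setT x) axT).
rewrite /limit_at1 o0 oB eqxx.
have dT := dscC_neq0 C Gneg T; have dB := dscC_neq0 C Gneg (br u0).
have evn : lab_value l r != 0 by exact: lab_value_neq0.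
have E : lead T x r - lead T v r = (dsc T)%:R * lead (br u0) x r / (dsc (br u0))%:R.
  apply: (mulfI dB); rewrite mulrBr key addrC addKr.
  by field.
by rewrite E /d; field; rewrite dT dB evn.
Qed.

Lemma sum_lab_br u (F : {ffun G -> C} -> C) : u \in nbrs T v ->
  \sum_(r <- labellings C T | (r != [ffun=> 1]) && labelling (br u) r) F r =
  \sum_(r <- labellings C (br u) | (r != [ffun=> 1]) && (r u == 1)) F r.
Proof.
move=> uN; rewrite -big_filter -[RHS]big_filter.
apply: perm_big; apply: uniq_perm; rewrite ?filter_uniq ?labellings_uniq // => r.
rewrite !mem_filter (mem_labellings Gacyclic Gneg _ cT) (mem_labellings Gacyclic Gneg _ (conn_branch uN)).
have E : labelling (br u) r && labelling T r = (r u == 1) && labelling (br u) r.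
  have [lB|_] := boolP (labelling (br u) r); last by rewrite andbF.
  by rewrite (lab_br_lab uN lB) andbT.
transitivity ((r != [ffun=> 1]) && (labelling (br u) r && labelling T r)).
  by case: (r != _).
by rewrite E; case: (r != _).
Qed.

(** The labellings of a branch with value [1] at the root are characters of the
    whole group, and enter through [lim_difference]; the others give the poles
    of the branches in [regular_value]. *)
Lemma torsion_difference :
  (dsc T)%:R^-1 * \sum_(r <- labellings C T | r != [ffun=> 1]) (lab_value l r)^-1 * adm_limit T r
  - \sum_(u in nbrs T v) (dsc (br u))%:R^-1 *
      \sum_(r <- labellings C (br u) | r != [ffun=> 1]) (lab_value l r)^-1 * adm_limit (br u) r
  = regular_value C v l n - double_value C T v n.
Proof.
rewrite /regular_value addrAC [X in _ = X + _ - _]addrC addrK.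
pose S := \sum_(r <- labellings C T | r != [ffun=> 1]) d%:R^-1 * (lab_value l r)^-1 * (adm_limit T r - limit_at1 T v r).
have S1 : (dsc T)%:R^-1 * \sum_(r <- labellings C T | r != [ffun=> 1]) (lab_value l r)^-1 * adm_limit T r =
    \sum_(r <- labellings C T | r != [ffun=> 1]) d%:R^-1 * (lab_value l r)^-1 * limit_at1 T v r + S.
  rewrite /S -big_split mulr_sumr; apply: eq_bigr => r _ /=.
  by rewrite -mulrDr [limit_at1 _ _ _ + _]addrC subrK mulrA.
have S2 : S = \sum_(u in nbrs T v) \sum_(r <- labellings C (br u) | (r != [ffun=> 1]) && (r u == 1)) branch_term u r.
  rewrite /S big_seq_cond.
  under eq_bigr => r /andP[].
    rewrite (mem_labellings Gacyclic Gneg _ cT) => lr r1.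
    rewrite (lim_difference lr r1); over.
  rewrite -big_seq_cond exchange_big /=; apply: eq_bigr => u uN.
  by rewrite -big_mkcondr /= sum_lab_br.
have S3 : \sum_(u in nbrs T v) (dsc (br u))%:R^-1 *
      \sum_(r <- labellings C (br u) | r != [ffun=> 1]) (lab_value l r)^-1 * adm_limit (br u) r =
   S + \sum_(u in nbrs T v) \sum_(r <- labellings C (br u) | r u != 1) (lab_value l r)^-1 * branch_residue v u r / (1 - r u).
  rewrite S2 -big_split; apply: eq_bigr => u uN /=.
  rewrite mulr_sumr (bigID (fun r : {ffun G -> C} => r u == 1)) /=; congr (_ + _).
    by apply: eq_bigr => r _; rewrite /branch_term mulrC.
  rewrite big_seq_cond [RHS]big_seq_cond; apply: eq_big => r.
    congr (_ && _); apply/andP/idP => [[]//|ru]; split=> //.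
    by apply: contra ru => /eqP ->; rewrite ffunE.
  case/andP; rewrite (mem_labellings Gacyclic Gneg _ (conn_branch uN)) => lB /andP[r1 ru].
  have uB : u \in br u := root_in_branch T v u.
  rewrite (adm_limitE (conn_branch uN) lB uB); last by rewrite /admissible ru.
  rewrite /branch_residue -/(br u); have dB := dscC_neq0 C Gneg (br u).
  have evn : lab_value l r != 0 by apply: lab_value_neq0; case/labellingP: lB.
  have u0 : 1 - r u != 0 by rewrite subr_eq0 eq_sym.
  by field; rewrite u0 dB evn.
rewrite S1 S3 opprD addrA addrK; congr (_ - _).
Qed.

End Difference.
End LimValue.

(** * Chern classes and the Casson-Walker invariant *)

Lemma c1E (P : plumbing) (s : spincX P) x : c1 s x = euler x + 2 + s x *+ 2.
Proof. by rewrite /c1 ffunE ffunMnE ffunE. Qed.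

Section Surgery.
Variable G : plumbing.
Implicit Types (A B : {set G}) (x y z u v w : G).
Hypothesis Gacyclic : acyclic_graph G.
Hypothesis Gneg : negative_definite G.
Let T : {set G} := [set: G].
Hypothesis cT : connected_set T.
Variable v : G.
Let br u := branch T v u.
Let vT : v \in T. Proof. exact: in_setT. Qed.

Lemma componentsE : components v = [set br u | u in nbrs T v].
Proof.
have cE x y : connect (del_adj v) x y = connect (adj_in (T :\ v)) x y.
  by apply: eq_connect => {}x {}y; rewrite /del_adj /adj_in !in_setD1 !in_setT !andbT.
apply/setP => B; apply/imsetP/imsetP => [[x + ->]|[u uN ->]].
  rewrite in_setC1 => xv; have [u uN xu] := branch_exists cT vT (in_setT x) xv.
  exists u => //; apply/setP => y; rewrite !inE cE.
  by apply/esym/same_connect; [exact: connect_in_sym | rewrite inE in xu].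
exists u; last by apply/setP => y; rewrite !inE cE.
by rewrite in_setC1; have /nbrsD1 := uN; rewrite in_setD1 => /andP[].
Qed.

(** By [branch_root_uniq], distinct neighbours of [v] have distinct branches. *)
Lemma sum_components (V : nmodType) (F : {set G} -> V) :
  \sum_(A in components v) F A = \sum_(u in nbrs T v) F (br u).
Proof.
rewrite componentsE big_imset // => u w uN wN /= e.
apply/esym; apply: (branch_root_uniq Gacyclic uN wN); rewrite -/(br u) e.
exact: root_in_branch.
Qed.

(** [green_schur], summed against [c] on both sides. *)
Lemma quad_difference (c : G -> rat) :
  \sum_x \sum_y c x * c y * green T x y =
  \sum_(u in nbrs T v) \sum_x \sum_y c x * c y * green (br u) x y
  + (\sum_w c w * green T w v) ^+ 2 / green T v v.
Proof.
rewrite [in RHS]exchange_big /=.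
have -> : \sum_x \sum_(u in nbrs T v) \sum_y c x * c y * green (br u) x y =
   \sum_x \sum_y c x * c y * \sum_(u in nbrs T v) green (br u) x y.
  apply: eq_bigr => x _; rewrite exchange_big; apply: eq_bigr => y _.
  by rewrite mulr_sumr.
rewrite expr2 -mulrA mulr_suml -big_split; apply: eq_bigr => x _ /=.
rewrite mulr_suml mulr_sumr -big_split; apply: eq_bigr => y _ /=.
rewrite (green_schur Gacyclic Gneg x y cT vT) (green_sym T v y); ring.
Qed.

Lemma formQ_induced (A : {set G}) (c : dual_lat G) (a : dual_lat (induced_graph A)) :
  (forall x : induced_graph A, a x = c (val x)) ->
  formQ a a = - \sum_x \sum_y (c x)%:~R * (c y)%:~R * green A x y.
Proof.
move=> ac; rewrite (formQ_green (negative_induced (A := A) Gneg)); congr (- _).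
rewrite -(sum_induced (A := A)); last first.
  by move=> z zA; rewrite big1 // => y _; rewrite green_offl ?mulr0.
apply: eq_bigr => x _; rewrite -(sum_induced (A := A)); last first.
  by move=> z zA; rewrite green_offr ?mulr0.
by apply: eq_bigr => y _; rewrite !ac (green_lift_set Gneg) lift_set_setT.
Qed.

(** Up to sign, this is the pairing of [E^*_v] with [\sum_w E_w = \sum_w (b_w +
    delta_w) E^*_w]. *)
Lemma green_total :
  \sum_w ((euler w)%:~R + (#|nbrs T w|)%:R) * green T w v = -1.
Proof.
have E : \sum_w (\sum_u ninter w u) * green T w v = 1.
  transitivity (\sum_u \sum_w ninter u w * green T w v).
    rewrite exchange_big; apply: eq_bigr => w _; rewrite mulr_suml.
    by apply: eq_bigr => u _; rewrite ninter_sym.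
  rewrite (bigD1 v) //= (greenE Gneg) // eqxx big1 ?addr0 // => u uv.
  by rewrite (greenE Gneg) ?in_setT // (negbTE uv).
rewrite -[in RHS]E -sumrN; apply: eq_bigr => w _.
have := @ninter_sum_nbrs G T w (fun=> 1) (in_setT w).
rewrite sumr_const mulr1 => F.
have {}F : \sum_u ninter w u = ninter w w - #|nbrs T w|%:R.
  by rewrite -F; [apply: eq_bigr => u _; rewrite mulr1 | move=> z; rewrite in_setT].
by rewrite F /ninter /inter eqxx; ring.
Qed.

Let d : rat := (dG G)%:~R.
Let a : rat := (acoef v v)%:~R.
Let al : rat := (alpha v)%:~R.
Let be : rat := (beta v)%:~R.
Let g := green T v v.

Let dE : d = disc T. Proof. exact: dG_disc. Qed.
Let aE : a = d * g.
Proof. by rewrite /a acoefE // -pmulrn wtE // dE. Qed.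
Let g0 : g != 0. Proof. by rewrite gt_eqF // green_gt0. Qed.
Let d0 : d != 0. Proof. by rewrite dE gt_eqF // disc_gt0. Qed.

Lemma alphaE : al = d * \sum_w (dg T w)%:~R * green T w v.
Proof.
rewrite /al /alpha rmorph_sum mulr_sumr; apply: eq_bigr => w _ /=.
rewrite intrM degE acoefE // -pmulrn wtE ?in_setT // (green_sym T v w) -dE.
by rewrite /dg; ring.
Qed.

Lemma betaE : be = d ^+ 2 * \sum_w (dg T w)%:~R * green T w v ^+ 2.
Proof.
rewrite /be /beta rmorph_sum mulr_sumr; apply: eq_bigr => w _ /=.
rewrite intrM rmorphXn degE acoefE //= -pmulrn wtE ?in_setT // (green_sym T v w) -dE.
by rewrite /dg; ring.
Qed.

Lemma card_difference :
  (#|G|)%:R - \sum_(u in nbrs T v) (#|induced_graph (br u)|)%:R = 1 :> rat.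
Proof.
have -> : (#|G|)%:R = \sum_(w in T) 1 :> rat by rewrite sumr_const cardsT.
rewrite (big_branch Gacyclic _ _ cT vT) /= -addrA [X in _ + X](_ : _ = 0) ?addr0 //.
apply/eqP; rewrite subr_eq0; apply/eqP; apply: eq_bigr => u _.
by rewrite sumr_const card_sig.
Qed.

(** The rank-one term of [quad_difference] at [c1]; the pairing of [c1] with
    [E^*_v] comes from [green_total] and the definition of [alpha]. *)
Lemma chern_difference (s : spincX G) (r : rat) : r = formQ s (Estar v) ->
  formQ (c1 s) (c1 s) + #|G|%:R
    - \sum_(A in components v)
        (formQ (c1 (spinc_res A s)) (c1 (spinc_res A s)) + #|induced_graph A|%:R)
  = 1 - (al + d + 2 * d * r) ^+ 2 / (d * a).
Proof.
move=> rE; rewrite sum_components big_split /= opprD addrACA card_difference.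
rewrite addrC; congr (_ + _).
have -> : \sum_(u in nbrs T v) formQ (c1 (spinc_res (br u) s)) (c1 (spinc_res (br u) s))
  = - \sum_(u in nbrs T v) \sum_x \sum_y (c1 s x)%:~R * (c1 s y)%:~R * green (br u) x y.
  rewrite -sumrN; apply: eq_bigr => u _; apply: formQ_induced => x.
  by rewrite !c1E /spinc_res /spincX_act /spincX_can addr0 ffunE.
rewrite opprK formQ_green // (quad_difference (fun x => (c1 s x)%:~R)).
rewrite opprD addrAC addNr add0r.
have -> : \sum_w (c1 s w)%:~R * green T w v = - (1 + al / d + 2 * r).
  rewrite rE formQ_Estarr // alphaE mulrC mulKf //.
  have -> : \sum_w (c1 s w)%:~R * green T w v =
     \sum_w (((euler w)%:~R + (#|nbrs T w|)%:R) * green T w v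
       + (- ((dg T w)%:~R * green T w v) + 2 * ((s w)%:~R * green T w v))).
    apply: eq_bigr => w _; rewrite c1E mulr2n /dg !intrD intrN -!pmulrn.
    by ring.
  rewrite big_split big_split /= sumrN -mulr_sumr green_total.
  by ring.
rewrite -/g aE; field; by rewrite d0 g0.
Qed.

(** The diagonal of [green_schur] produces [beta]. The roots of the branches
    lose one neighbour, and [green_inv] evaluates the resulting sum of the
    [green (br u) u u] as [- b_v - d / a_vv]. *)
Lemma casson_difference :
  24 * (casson_walker G / d)
    - \sum_(A in components v)
        24 * (casson_walker (induced_graph A) / (dG (induced_graph A))%:~R)
  = - 3 + (d ^+ 2 - be) / (d * a).
Proof.
have cw (P : plumbing) (acy : acyclic_graph P) (neg : negative_definite P)
    (cP : connected_set [set: P]) : 24 * (casson_walker P / (dG P)%:~R) =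
    - (\sum_(w : P) (euler w)%:~R + 3 * #|P|%:R
       + \sum_(w : P) (dg [set: P] w)%:~R * green [set: P] w w).
  have dP0 : (dG P)%:~R != 0 :> rat by rewrite dG_disc // gt_eqF // disc_gt0.
  rewrite /casson_walker; have -> : (\sum_(w : P) ((deg w)%:Z - 2) * acoef w w)%:~R =
    (dG P)%:~R * \sum_(w : P) (dg [set: P] w)%:~R * green [set: P] w w :> rat.
    rewrite rmorph_sum mulr_sumr; apply: eq_bigr => w _ /=.
    rewrite intrM degE acoefE // -pmulrn wtE ?in_setT // -dG_disc /dg.
    by ring.
  move: (dG P)%:~R dP0 => D D0; rewrite rmorph_sum natrM /=; by field.
rewrite sum_components cw //.
have -> : \sum_(u in nbrs T v) 24 * (casson_walker (induced_graph (br u)) /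
       (dG (induced_graph (br u)))%:~R) =
   - \sum_(u in nbrs T v) (\sum_(w in br u) (euler w)%:~R + 3 * #|induced_graph (br u)|%:R
       + \sum_(w in br u) (dg (br u) w)%:~R * green (br u) w w).
  rewrite -sumrN; apply: eq_bigr => u uN; rewrite cw.
  - congr (- (_ + _ + _)); first by rewrite [RHS]big_sub.
    rewrite [RHS]big_sub; apply: eq_bigr => w _.
    by rewrite dg_induced (green_lift_set Gneg) lift_set_setT.
  - exact: acyclic_induced.
  - exact: negative_induced.
  - apply: conn_induced; exact: conn_branch.
rewrite opprK !big_split /= -mulr_sumr.
have -> : #|G|%:R = 1 + \sum_(u in nbrs T v) (#|induced_graph (br u)|)%:R :> rat.
  by apply/eqP; rewrite -subr_eq; apply/eqP; exact: card_difference.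
have -> : \sum_(w : G) (euler w)%:~R = (euler v)%:~R
     + \sum_(u in nbrs T v) \sum_(w in br u) (euler w)%:~R :> rat.
  rewrite -(big_branch Gacyclic _ (fun w => (euler w)%:~R) cT vT) /=.
  by apply: eq_bigl => w; rewrite in_setT.
have -> : \sum_(w : G) (dg T w)%:~R * green T w w =
   \sum_(u in nbrs T v) \sum_(w in br u) (dg (br u) w)%:~R * green (br u) w w
   + \sum_(u in nbrs T v) green (br u) u u + be / (d * a).
  have -> : be / (d * a) = \sum_(w : G) (dg T w)%:~R * (green T w v ^+ 2 / g).
    rewrite betaE aE; under [RHS]eq_bigr do rewrite mulrA.
    rewrite -mulr_suml; field; by rewrite d0 g0.
  have S w : green T w w = \sum_(u in nbrs T v) green (br u) w w + green T w v ^+ 2 / g.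
    by rewrite (green_schur Gacyclic Gneg w w cT vT) (green_sym T v w) expr2.
  under eq_bigr do rewrite S mulrDr.
  rewrite big_split /=; congr (_ + _).
  rewrite -big_split; under eq_bigr do rewrite mulr_sumr.
  rewrite exchange_big; apply: eq_bigr => u uN /=.
  have uB : u \in br u := root_in_branch T v u.
  rewrite (bigID (mem (br u))) /= [X in _ + X]big1 ?addr0 => [|w wB]; last first.
    by rewrite green_offl ?mulr0.
  rewrite (bigD1 u) //= [in RHS](bigD1 u) //= (dg_branch Gacyclic vT uN uB) eqxx.
  rewrite intrD mulrDl mul1r addrAC; congr (_ + _ + _).
  apply: eq_bigr => w /andP[wB wu]; rewrite (dg_branch Gacyclic vT uN wB).
  by rewrite (negbTE wu) addr0.
have := green_inv Gacyclic Gneg cT vT; rewrite -/g => gE.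
have -> : \sum_(u in nbrs T v) green (br u) u u = - (euler v)%:~R - g^-1.
  by rewrite gE /ninter /inter eqxx; ring.
rewrite aE; set S1 := \sum_(u in _) _; set S2 := \sum_(u in _) _; set S3 := \sum_(u in _) _.
by field; rewrite d0 g0.
Qed.

End Surgery.

(** * The four formulas *)

Section TorsionSurgery.
Variables (C : numClosedFieldType) (G : plumbing).
Implicit Types (x y z u v w : G).
Hypothesis Gacyclic : acyclic_graph G.
Hypothesis Gneg : negative_definite G.
Let T : {set G} := [set: G].
Hypothesis cT : connected_set T.
Variables (v : G) (l : dual_lat G) (r : rat).
Hypotheses (rE : r = formQ l (Estar v)) (r_gt : -1 < r) (r_le : r <= 0).

Let d : rat := (dG G)%:~R.
Let a : rat := (acoef v v)%:~R.
Let al : rat := (alpha v)%:~R.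
Let be : rat := (beta v)%:~R.
Let vT : v \in T. Proof. exact: in_setT. Qed.

(** The bounds on [r] give [0 <= n < d] for the exponent [n = - d r], so that
    [principal_part] has negative degree. *)
Lemma degree_exists : exists n : nat,
  [/\ n%:Z = \sum_w l w * (wt T w v)%:Z, (n < dsc T)%N & n%:R = - (d * r)].
Proof.
pose N := \sum_w l w * (wt T w v)%:Z.
have NE : N%:~R = - (d * r) :> rat.
  rewrite rE formQ_Estarr // mulrN opprK /N rmorph_sum mulr_sumr.
  apply: eq_bigr => w _ /=; rewrite intrM -pmulrn wtE ?in_setT // /d dG_disc -/T.
  by ring.
have d0 : 0 < d by rewrite /d dG_disc disc_gt0.
have N0 : 0 <= N by rewrite -(ler0z rat) NE -mulrN mulr_ge0 ?oppr_ge0 // ltW.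
have Nabs : (`|N|%N)%:Z = N by rewrite gez0_abs.
have nQ : (`|N|%N)%:R = - (d * r) :> rat by rewrite -NE -[in RHS]Nabs -pmulrn.
exists `|N|%N; split=> //.
rewrite -(ltr_nat rat) nQ dscE // -dG_disc -/d -mulrN gtr_pMr //.
by rewrite ltrNl.
Qed.

Lemma Hrat_Hlab : Hrat C (cls l : spincM G) v = Hlab (@tofrac {poly C}) v l.
Proof.
rewrite /Hrat /Hlab; congr (_ * _).
  congr (tofrac ((_^-1)%:P)); rewrite -(ratr_int C) dG_disc -(dscE Gneg).
  exact: ratr_nat.
rewrite (sum_Hhat Gacyclic Gneg cT) big_seq [RHS]big_seq; apply: eq_bigr => s.
rewrite (mem_labellings Gacyclic Gneg _ cT) => ls.
rewrite /spincM_diff char_ofE //; congr (_ * _).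
by rewrite /Prat (PfunE Gacyclic Gneg cT).
Qed.

(** The difference of the torsions is [regular_value] without [double_value];
    for [n = - d r] the latter is the sum of the two explicit terms. *)
Lemma torsion_surgery :
  torsion C (cls l : spincM G)
  - \sum_(A in components v) torsion C (spinc_bdry (spinc_res A (l : spincX G)))
  = (Hpol C (cls l) v).[1]
    + ratr ((d ^+ 2 - be) / (24 * d * a))
    - ratr ((al + d + 2 * d * r) ^+ 2 / (8 * d * a)).
Proof.
have [n [nE nd nQ]] := degree_exists.
have [p [HE pE]] := polynomial_part (@tofrac_inj C) Gacyclic Gneg cT nE nd.
have -> : Hpol C (cls l) v = p.
  rewrite /Hpol Hrat_Hlab; apply: polpart_eq; rewrite HE addrC addKr.
  exact: (negdeg_principal_part (@tofrac_inj C) Gacyclic Gneg v l nd).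
rewrite pE (sum_components Gacyclic cT).
have -> : \sum_(u in nbrs T v)
    torsion C (spinc_bdry (spinc_res (branch T v u) (l : spincX G))) =
  \sum_(u in nbrs T v) (dsc (branch T v u))%:R^-1 *
      \sum_(s <- labellings C (branch T v u) | s != [ffun=> 1]) (lab_value l s)^-1 * adm_limit (branch T v u) s.
  apply: eq_bigr => u uN; rewrite /spinc_res /spincX_act /spincX_can addr0.
  exact: (torsion_induced C Gacyclic Gneg (conn_branch uN) l).
rewrite (torsion_whole C Gacyclic Gneg cT) (torsion_difference C Gacyclic Gneg cT v l n).
rewrite -[RHS]addrA; congr (_ + _).
have wT w : (acoef v w)%:~R = (wt T w v)%:R :> C.
  by rewrite acoefE // wt_sym -pmulrn.
have alE : alphaC C T v = ratr al.
  rewrite ratr_int /alpha rmorph_sum; apply: eq_big => w; first by rewrite in_setT.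
  by move=> _; rewrite /= intrM wT /dg degE.
have beE : betaC C T v = ratr be.
  rewrite ratr_int /beta rmorph_sum; apply: eq_big => w; first by rewrite in_setT.
  by move=> _; rewrite /= intrM rmorphXn /= wT /dg degE.
have dE : (dsc T)%:R = ratr d :> C by rewrite -[RHS]/(ratr d) /d dG_disc -dscE // ratr_nat.
have aE : (wt T v v)%:R = ratr a :> C by rewrite ratr_int wT.
have nC : n%:R = ratr (- (d * r)) :> C by rewrite -nQ ratr_nat.
have d0 : d != 0 by rewrite /d dG_disc gt_eqF // disc_gt0.
have a0 : a != 0.
  by rewrite /a acoefE // -pmulrn pnatr_eq0 -lt0n wt_gt0.
rewrite /double_value alE beE dE aE nC; move: d0 a0; move: d a al be => d' a' al' be' d0 a0.
have fd0 : ratr d' != 0 :> C by rewrite fmorph_eq0.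
have fa0 : ratr a' != 0 :> C by rewrite fmorph_eq0.
rewrite !fmorph_div (rmorphB _ (d' ^+ 2)) !rmorphXn.
rewrite (rmorphM _ (24 * d')) (rmorphM _ 24) (rmorphM _ (8 * d')) (rmorphM _ 8).
rewrite (rmorphD _ (al' + d')) (rmorphD _ al') (rmorphM _ (2 * d')) (rmorphM _ 2).
rewrite rmorphN (rmorphM _ d' r) !rmorph_nat; field.
by rewrite fd0 fa0.
Qed.

End TorsionSurgery.

Theorem proposition5p0p1 (R : realType) (G : plumbing) (v : G)
  (Gconn : connected_graph G) (Gacyclic : acyclic_graph G)
  (Gneg : negative_definite G)
  (sigma : spincM G) (l : dual_lat G) (sigmat : spincX G)
  (sigmatE : sigmat = spincX_act l (spincX_can G))
  (sigmat_ext : spinc_bdry sigmat = sigma)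
  (r : rat) (rE : r = formQ l (Estar v)) (r_gt : -1 < r) (r_le : r <= 0) :
  let C : numClosedFieldType := R[i] in
  let d : rat := (dG G)%:~R in
  let a : rat := (acoef v v)%:~R in
  let al : rat := (alpha v)%:~R in
  let be : rat := (beta v)%:~R in
  let sigmati (A : {set G}) : spincX (induced_graph A) := spinc_res A sigmat in
  let sigmai (A : {set G}) : spincM (induced_graph A) := spinc_bdry (sigmati A) in
  [/\ formQ (c1 sigmat) (c1 sigmat) + #|G|%:R
        - \sum_(A in components v)
            (formQ (c1 (sigmati A)) (c1 (sigmati A)) + #|induced_graph A|%:R)
      = 1 - (al + d + 2 * d * r) ^+ 2 / (d * a),
      sw C sigma - \sum_(A in components v) sw C (sigmai A)
      = - (Hpol C sigma v).[1] - 8^-1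
        + ratr ((al + d + 2 * d * r) ^+ 2 / (8 * d * a)),
      24 * (casson_walker G / d)
        - \sum_(A in components v)
            24 * (casson_walker (induced_graph A) / (dG (induced_graph A))%:~R)
      = - 3 + (d ^+ 2 - be) / (d * a)
    & torsion C sigma - \sum_(A in components v) torsion C (sigmai A)
      = (Hpol C sigma v).[1]
        + ratr ((d ^+ 2 - be) / (24 * d * a))
        - ratr ((al + d + 2 * d * r) ^+ 2 / (8 * d * a))].
Proof.
move=> C d a al be sigmati sigmai.
have cT := conn_setT Gconn.
have sl : sigmat = l by rewrite sigmatE /spincX_act /spincX_can addr0.
have tors : torsion C sigma - \sum_(A in components v) torsion C (sigmai A)
      = (Hpol C sigma v).[1]
        + ratr ((d ^+ 2 - be) / (24 * d * a))
        - ratr ((al + d + 2 * d * r) ^+ 2 / (8 * d * a)).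
  rewrite -sigmat_ext /sigmai /sigmati sl.
  exact: (torsion_surgery C Gacyclic Gneg cT rE r_gt r_le).
have cass := casson_difference Gacyclic Gneg cT v.
have d0 : d != 0 by rewrite /d dG_disc // gt_eqF // disc_gt0.
have a0 : a != 0.
  by rewrite /a acoefE // -pmulrn pnatr_eq0 -lt0n wt_gt0 ?in_setT.
split=> //.
- rewrite /sigmati sl; exact: (chern_difference Gacyclic Gneg cT rE).
- pose y (A : {set G}) := casson_walker (induced_graph A) / (dG (induced_graph A))%:~R.
  have E : casson_walker G / d - \sum_(A in components v) y A
      = - 8^-1 + (d ^+ 2 - be) / (24 * d * a).
    have n24 : (24 : rat) != 0 by [].
    apply: (mulfI n24); rewrite mulrBr mulr_sumr cass -/d -/a -/be.
    by field; rewrite d0 a0.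
  have -> : \sum_(A in components v) sw C (sigmai A) =
     ratr (\sum_(A in components v) y A) - \sum_(A in components v) torsion C (sigmai A).
    by rewrite rmorph_sum -sumrB.
  have swE : sw C sigma = ratr (casson_walker G / d) - torsion C sigma by [].
  have alg (b1 b2 t1 t2 : C) : b1 - t1 - (b2 - t2) = b1 - b2 - (t1 - t2) by ring.
  rewrite swE alg tors -rmorphB E (rmorphD _ (- 8^-1)) rmorphN fmorphV rmorph_nat.
  ring.
Qed.
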